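(* Let $N\in\mathbb N$, $1<p<N$, $1<q<N/2$, $0\le\sigma<N$, $r>1$, $\lambda\in\mathbb R$ and $\tau_1,\tau_2\in\{0,1\}$. Suppose that $u\in\mathcal W\cap L^r_\sigma(\mathbb R^N)$ is a weak solution of $$\Delta_q^2u-\Delta_pu=\lambda\frac{|u|^{r-2}u}{|x|^\sigma}+\tau_1|u|^{p^*-2}u+\tau_2|u|^{q^{**}-2}u\quad\text{in }\mathbb R^N$$ such that, for some $m>N$, $$u\in W^{2,m}_{\rm loc}(\mathbb R^N\setminus\{0\})\quad\text{and}\quad w:=|\Delta u|^{q-2}\Delta u\in W^{1,m}_{\rm loc}(\mathbb R^N\setminus\{0\}).$$ Then $$\frac{N-2q}{q}\int_{\mathbb R^N}|\Delta u|^q\,dx+\frac{N-p}{p}\int_{\mathbb R^N}|\nabla u|^p\,dx=\lambda\frac{N-\sigma}{r}\int_{\mathbb R^N}\frac{|u|^r}{|x|^\sigma}\,dx+\tau_1\frac{N}{p^*}\int_{\mathbb R^N}|u|^{p^*}\,dx+\tau_2\frac{N}{q^{**}}\int_{\mathbb R^N}|u|^{q^{**}}\,dx.$$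
   Context: Exponents: $p^*=\frac{Np}{N-p}$, $q^{**}=\frac{Nq}{N-2q}$. Operators: $\Delta_q^2u=\Delta(|\Delta u|^{q-2}\Delta u)$, $\Delta_pu=\mathrm{div}(|\nabla u|^{p-2}\nabla u)$. Spaces: $D^{1,p}(\mathbb R^N)=\{u\in L^{p^*}(\mathbb R^N):|\nabla u|\in L^p(\mathbb R^N)\}$, $D^{2,q}(\mathbb R^N)=\{u\in L^{q^{**}}(\mathbb R^N):|D^2u|\in L^q(\mathbb R^N)\}$, $\mathcal W=D^{1,p}(\mathbb R^N)\cap D^{2,q}(\mathbb R^N)$, and $L^r_\sigma(\mathbb R^N)$ is the space of measurable $u$ with $\int_{\mathbb R^N}|u|^r|x|^{-\sigma}dx<\infty$. Weak solution: $u\in\mathcal W$ is a weak solution of $\Delta_q^2u-\Delta_pu=f(x,u)$ in $\mathbb R^N$ if $f(\cdot,u)\in L^1_{\rm loc}(\mathbb R^N)$ and $\int_{\mathbb R^N}|\Delta u|^{q-2}\Delta u\,\Delta v\,dx+\int_{\mathbb R^N}|\nabla u|^{p-2}\nabla u\cdot\nabla v\,dx=\int_{\mathbb R^N}f(x,u)v\,dx$ for all $v\in C_c^\infty(\mathbb R^N)$. *)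

(* Defs.v *)
From HB Require Import structures.
From mathcomp Require Import all_boot all_order all_algebra.
From mathcomp Require Import all_classical all_reals all_analysis.

Set Implicit Arguments.
Unset Strict Implicit.
Unset Printing Implicit Defensive.

Import Order.TTheory GRing.Theory Num.Theory.
Import numFieldNormedType.Exports.

Local Open Scope classical_set_scope.
Local Open Scope ring_scope.

(* The coordinate sigma-algebra on 'rV[R]_n, i.e. the Borel sets. *)
Definition rV_display : measure_display. Proof. exact. Qed.

Section rV_measurable.
Variables (R : realType) (n : nat).

Definition rV_coord (i : 'I_n) (x : 'rV[R]_n) : R := x ord0 i.

Let rV_set0 : g_sigma_preimage rV_coord set0.
Proof. exact: sigma_algebra0. Qed.

Let rV_setC A : g_sigma_preimage rV_coord A -> g_sigma_preimage rV_coord (~` A).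
Proof. exact: sigma_algebraC. Qed.

Let rV_bigcup (F : (set 'rV[R]_n)^nat) :
  (forall i, g_sigma_preimage rV_coord (F i)) ->
  g_sigma_preimage rV_coord (\bigcup_i (F i)).
Proof. exact: sigma_algebra_bigcup. Qed.

HB.instance Definition _ := @isMeasurable.Build rV_display
  'rV[R]_n (g_sigma_preimage rV_coord) rV_set0 rV_setC rV_bigcup.

End rV_measurable.

Lemma measurable_rV_coord (R : realType) n (i : 'I_n) :
  measurable_fun [set: 'rV[R]_n] (@rV_coord R n i).
Proof.
move=> _ Y mY; rewrite setTI; apply: sub_sigma_algebra => /=.
rewrite -bigcup_seq/=; exists i => /=; first by rewrite mem_index_enum.
by exists Y => //; rewrite setTI.
Qed.

Lemma measurable_fun_rVP (R : realType) d (T : measurableType d) n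
    (f : T -> 'rV[R]_n) :
  measurable_fun [set: T] f <->
  forall i, measurable_fun [set: T] (@rV_coord R n i \o f).
Proof.
split=> [mf i|mf].
  by apply: measurableT_comp => //; exact: measurable_rV_coord.
apply: (@iffRL _ (g_sigma_preimage
    (fun i => @rV_coord R n i \o f) `<=` measurable)); last first.
  apply: smallest_sub; first exact: sigma_algebra_measurable.
  case: n => [|n] in f mf *; first by rewrite big_ord0.
  rewrite -bigcup_mkord_ord; apply: bigcup_sub => i Ii.
  by move=> A [B mB <-]; exact: mf.
rewrite g_sigma_preimage_comp; split=> [h A [/= C preC <-]|prefS].
  exact: h.
by move=> _ A mA; apply: prefS; exists A.
Qed.

Section lebesgue_rV.
Variable R : realType.
Local Notation RT := (measurableTypeR R).

Definition rV_cons n (x : RT * 'rV[R]_n) : 'rV[R]_n.+1 :=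
  row_mx (x.1 : R)%:M x.2 : 'rV[R]_(1 + n).

Definition rV_uncons n (x : 'rV[R]_n.+1) : RT * 'rV[R]_n :=
  (x ord0 ord0, rsubmx (x : 'rV[R]_(1 + n))).

Lemma rV_cons0 n (x : RT * 'rV[R]_n) : rV_cons x ord0 ord0 = x.1.
Proof.
have := row_mxEl ((x.1 : R)%:M : 'M[R]_1) x.2 ord0 ord0.
by rewrite [RHS]mxE eqxx mulr1n => <-; congr (row_mx _ _ _ _); exact/val_inj.
Qed.

Lemma rV_consK n : cancel (@rV_cons n) (@rV_uncons n).
Proof. by case=> a x; rewrite /rV_uncons rV_cons0 /rV_cons row_mxKr. Qed.

Lemma measurable_rV_cons n : measurable_fun setT (@rV_cons n).
Proof.
apply/measurable_fun_rVP => i.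
case: (@splitP 1 n i) => [j ij|k ik].
  rewrite (_ : _ \o _ = (fst : RT * 'rV[R]_n -> R)); first exact: measurable_fst.
  apply/funext => x /=; rewrite /rV_coord (_ : i = ord0) ?rV_cons0//.
  by apply/val_inj; rewrite /= ij (ord1 j).
rewrite (_ : _ \o _ = @rV_coord R n k \o snd).
  by apply: measurableT_comp => //; exact: measurable_rV_coord.
apply/funext => x /=; rewrite /rV_coord.
rewrite -(row_mxEr ((x.1 : R)%:M : 'M[R]_1) x.2 ord0 k).
by congr (row_mx _ _ _ _); exact/val_inj.
Qed.

Lemma measurable_rV_uncons n : measurable_fun setT (@rV_uncons n).
Proof.
apply/measurable_fun_pair; first exact: measurable_rV_coord.
apply/measurable_fun_rVP => i.
rewrite (_ : _ \o _ = @rV_coord R n.+1 (rshift 1 i)).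
  exact: measurable_rV_coord.
by apply/funext => x /=; rewrite /rV_coord mxE.
Qed.

HB.instance Definition _ n :=
  isMeasurableFun.Build _ _ _ _ (@rV_cons n) (@measurable_rV_cons n).

Section step.
Variables (n : nat) (m : {sigma_finite_measure set 'rV[R]_n -> \bar R}).

Definition lebesgue_rV_step :=
  pushforward (lebesgue_measure \x m)%E (@rV_cons n).

Let step0 : lebesgue_rV_step set0 = 0%E.
Proof. exact: measure0. Qed.

Let step_ge0 A : (0 <= lebesgue_rV_step A)%E.
Proof. exact: measure_ge0. Qed.

Let step_sigma_additive : semi_sigma_additive lebesgue_rV_step.
Proof. exact: measure_semi_sigma_additive. Qed.

HB.instance Definition _ := isMeasure.Build _ _ _ lebesgue_rV_step
  step0 step_ge0 step_sigma_additive.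

Let step_sigma_finite : sigma_finite setT lebesgue_rV_step.
Proof.
have /sigma_finiteP[F [TF ndF Foo]] := sigma_finiteT (@lebesgue_measure R).
have /sigma_finiteP[G [TG ndG Goo]] := sigma_finiteT m.
exists (fun k => @rV_uncons n @^-1` (F k `*` G k)).
  rewrite -preimage_bigcup; apply/esym/seteqP; split=> // x _ /=.
  have [i _ Fi] : (\bigcup_i F i) (rV_uncons x).1 by rewrite -TF.
  have [j _ Gj] : (\bigcup_i G i) (rV_uncons x).2 by rewrite -TG.
  exists (maxn i j) => //; split.
    by move: Fi; apply/subsetPset/ndF/leq_maxl.
  by move: Gj; apply/subsetPset/ndG/leq_maxr.
move=> k; have [mF Fk] := Foo k; have [mG Gk] := Goo k; split.
  rewrite -[X in measurable X]setTI; apply: measurable_rV_uncons => //.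
  exact: measurableX.
rewrite /lebesgue_rV_step /pushforward -comp_preimage.
rewrite (_ : _ \o _ = id); last by apply/funext => x; exact: rV_consK.
by rewrite preimage_id product_measure1E// lte_mul_pinfty// ge0_fin_numE.
Qed.

HB.instance Definition _ := Measure_isSigmaFinite.Build _ _ _ lebesgue_rV_step
  step_sigma_finite.

End step.

(* Lebesgue measure on R^n, restricted to the Borel sets. *)
Fixpoint lebesgue_rV n : {sigma_finite_measure set 'rV[R]_n -> \bar R} :=
  if n is n'.+1 then lebesgue_rV_step (lebesgue_rV n')
  else dirac (0 : 'rV[R]_0).

End lebesgue_rV.

(* The norm `|_| on matrices is the maximum norm. *)
Definition enorm (R : realType) m n (A : 'M[R]_(m, n)) : R :=
  Num.sqrt (\sum_i \sum_j A i j ^+ 2).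

(* |t|^(a-2) t; as 0 `^ b is 0 for b != 0 and 1 for b = 0, the value at t = 0
   is 0 for every a. *)
Definition spow (R : realType) (a t : R) : R := `|t| `^ (a - 2) * t.

Section sobolev.
Variables (R : realType) (N : nat).
Local Notation V := 'rV[R]_N.
Local Notation mu := (lebesgue_rV R N).
Implicit Types (O K : set V) (u g phi : V -> R) (s : seq 'I_N).

Definition pderiv (i : 'I_N) phi : V -> R :=
  fun x => 'D_(delta_mx ord0 i) phi x.

Definition pderivs s phi : V -> R := foldr pderiv phi s.

Definition smooth phi := forall s,
  continuous (pderivs s phi) /\
  forall i x, derivable (pderivs s phi) x (delta_mx ord0 i).

Definition test_function O phi :=
  let supp := closure [set x | phi x != 0] in
  [/\ smooth phi, compact supp & supp `<=` O].

(* Elements of Lebesgue spaces are represented by Borel functions on the whole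
   space; every a.e.-class of Lebesgue measurable functions contains one. *)
Definition Lp O (a : R) u := u \_ O \in Lfun mu a%:E.

Definition Lp_loc O (a : R) u :=
  forall K, compact K -> K `<=` O -> Lp K a u.

Definition Lp_weighted (a sigma : R) u :=
  measurable_fun setT u /\
  (\int[mu]_x (`|u x| `^ a / enorm x `^ sigma)%:E < +oo)%E.

Definition weak_deriv O s u g :=
  [/\ Lp_loc O 1 u, Lp_loc O 1 g &
    forall phi, test_function O phi ->
      \int[mu]_(x in O) (u x * pderivs s phi x) =
      (-1) ^+ size s * \int[mu]_(x in O) (g x * phi x)].

Definition sobolev (k : nat) (a : R) O u :=
  Lp O a u /\
  forall s, (0 < size s <= k)%N -> exists2 g, weak_deriv O s u g & Lp O a g.

Definition sobolev_loc (k : nat) (a : R) O u :=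
  forall O', open O' -> compact (closure O') -> closure O' `<=` O ->
    sobolev k a O' u.

(* A representative of the weak derivative on the whole space; it is
   meaningful only when such a derivative exists. *)
Definition wderiv s u : V -> R := get (weak_deriv setT s u).

Definition wgrad u (x : V) : V := \row_i wderiv [:: i] u x.

Definition whess u (x : V) : 'M[R]_N := \matrix_(i, j) wderiv [:: i; j] u x.

Definition wlaplacian u (x : V) : R := \sum_i wderiv [:: i; i] u x.

Definition critical1 (p : R) : R := N%:R * p / (N%:R - p).

Definition critical2 (q : R) : R := N%:R * q / (N%:R - 2 * q).

Definition D1 (p : R) u :=
  [/\ Lp setT (critical1 p) u,
      forall i, exists g, weak_deriv setT [:: i] u g &
      Lp setT p (fun x => enorm (wgrad u x))].

Definition D2 (q : R) u :=
  [/\ Lp setT (critical2 q) u,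
      forall i j, exists g, weak_deriv setT [:: i; j] u g &
      Lp setT q (fun x => enorm (whess u x))].

Definition spaceW (p q : R) u := D1 p u /\ D2 q u.

Definition weak_solution (p q : R) (f : V -> R -> R) u :=
  [/\ spaceW p q u,
      Lp_loc setT 1 (fun x => f x (u x)) &
      forall v, test_function setT v ->
        \int[mu]_x (spow q (wlaplacian u x) * \sum_i pderivs [:: i; i] v x) +
        \int[mu]_x (enorm (wgrad u x) `^ (p - 2) *
                    \sum_i wgrad u x ord0 i * pderiv i v x) =
        \int[mu]_x (f x (u x) * v x)].

End sobolev.

(* Main.v *)
(** Let eta be a test function vanishing near the origin. Testing the equation with eta
    times a translate u(. + y) of u (legitimate after mollification) gives, for all y, an
    identity between functions y |-> \int W(x) G(x + y) dx, which are differentiable as soon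
    as G has a weak derivative. For eta >= 0, convexity of t |-> |t|^q / q and of
    X |-> |X|^p / p bounds the increment of the principal part by that of
    \int eta(x - y) (|Lap u|^q / q + |grad u|^p / p) dx; both are differentiable in y and
    equal increments at y = 0 force equal derivatives. This is the energy identity in the
    direction e_i, with no derivative of w; the source terms are integrated by parts by the
    same comparison. The terms make sense because u, grad u and w are bounded on compact
    sets off the origin, by Morrey's inequality (m > N).

    With eta = x_i psi_n, psi_n a radial cutoff equal to 1 on 2/n^2 <= |x|^2 <= n^2, sum over
    i and let n tend to infinity. Dominated convergence applies to all terms but
    \int w (a |x|^-2) (x.grad u) over the shells |x| ~ R with R = n and R = 1/n; Young's
    inequality reduces it to R^-q \int_{|x| ~ R} |grad u|^q -> 0, which follows from
    D^2 u in L^q and u in L^{q**} by comparing grad u with difference quotients of step R. *)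
Require Import Defs.
From HB Require Import structures.
From mathcomp Require Import finmap.
From mathcomp Require Import all_boot all_order all_algebra.
From mathcomp Require Import all_classical all_reals all_analysis.
From mathcomp Require Import measurable_realfun ring lra.

Set Implicit Arguments.
Unset Strict Implicit.
Unset Printing Implicit Defensive.

Import Order.TTheory GRing.Theory Num.Theory.
Import numFieldNormedType.Exports.

Local Open Scope classical_set_scope.
Local Open Scope ring_scope.

(** * Lebesgue measure on row vectors *)

Section lebesgue_rV_theory.
Variable R : realType.
Local Notation RT := (measurableTypeR R).

(** The classical multiplier x.grad u is not admissible: its Laplacian involves third derivatives of
    u. A translate of u is as regular as u itself, and in \int W(x) G(x + y) dx a derivative in y
    can fall on G or, after a change of variables, on W. The densities |Lap u|^q and |grad u|^p,
    merely integrable, are therefore differentiated through the smooth factor eta alone, while the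
    equation expresses the principal part through pairings with u and grad u, whose weak derivatives
    exist. If W is bounded with bounded support, G may be any locally integrable function; the
    bounds off the origin provide such W. All cutoffs are functions theta of t = |x|^2. As t theta'
    and t^2 theta'' are bounded independently of the scale, a term in which theta' comes with two
    factors x has a majorant independent of n. The Laplacian of x_i theta is x_i times a quantity of
    size |x|^-2 and leaves a single factor x.grad u next to w. Only this term needs decay of grad u,
    and q** is the exponent for which R^-2 u tends to 0 in L^q of the shell of radius R. *)

Lemma rV_cons_lift n (x : RT * 'rV[R]_n) (i : 'I_n) :
  rV_cons x ord0 (lift ord0 i) = x.2 ord0 i.
Proof.
rewrite -(row_mxEr ((x.1 : R)%:M : 'M[R]_1) x.2 ord0 i).
by congr (row_mx _ _ _ _); exact/val_inj.
Qed.

Lemma rV_consD n (x y : RT * 'rV[R]_n) :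
  rV_cons ((x.1 : R) + (y.1 : R) : RT, x.2 + y.2) = rV_cons x + rV_cons y.
Proof.
apply/rowP => i; rewrite [RHS]mxE; case: (unliftP ord0 i) => [j ->|->].
  by rewrite !rV_cons_lift [LHS]mxE.
by rewrite !rV_cons0.
Qed.

Lemma rV_unconsK n : cancel (@rV_uncons R n) (@rV_cons R n).
Proof.
move=> x; apply/rowP => i; case: (unliftP ord0 i) => [j ->|->].
  rewrite rV_cons_lift /= mxE; congr (x _ _); exact/val_inj.
by rewrite rV_cons0.
Qed.

Lemma lebesgue_rV_box n (C : 'I_n -> set R) :
  (forall i, measurable (C i : set RT)) ->
  lebesgue_rV R n [set x | forall i, C i (x ord0 i)] =
  (\prod_i lebesgue_measure (C i))%E.
Proof.
elim: n C => [|n IH] C mC.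
  by rewrite big_ord0 [LHS]diracE mem_set // => -[].
rewrite big_ord_recl -IH//.
rewrite [LHS]/=/lebesgue_rV_step /pushforward -product_measure1E//; last first.
  rewrite [X in measurable X](_ : _ =
      \bigcap_(i in [set: 'I_n]) (rV_coord i @^-1` C (lift ord0 i))); last first.
    by apply/seteqP; split => x /= h i; [move=> _|]; exact: h.
  apply: fin_bigcap_measurable => // i _.
  by rewrite -[X in measurable X]setTI; exact: (measurable_rV_coord i measurableT (mC _)).
congr (_ _); apply/seteqP; split => x /=.
  move=> h; split; first by have := h ord0; rewrite rV_cons0.
  by move=> i; have := h (lift ord0 i); rewrite rV_cons_lift.
move=> [h0 h] i; case: (unliftP ord0 i) => [j ->|->].
  by rewrite rV_cons_lift; exact: h.
by rewrite rV_cons0.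
Qed.

Lemma measurable_box n (C : 'I_n -> set R) :
  (forall i, measurable (C i : set RT)) ->
  measurable [set x : 'rV[R]_n | forall i, C i (x ord0 i)].
Proof.
move=> mC; rewrite [X in measurable X](_ : _ =
    \bigcap_(i in [set: 'I_n]) (rV_coord i @^-1` C i)); last first.
  by apply/seteqP; split => x /= h i; [move=> _|]; exact: h.
apply: fin_bigcap_measurable => // i _.
by rewrite -[X in measurable X]setTI; exact: (measurable_rV_coord i measurableT (mC _)).
Qed.

Lemma measurable_addv n (y : 'rV[R]_n) : measurable_fun setT (fun x : 'rV[R]_n => x + y).
Proof.
apply/measurable_fun_rVP => i.
rewrite (_ : _ \o _ = fun x => rV_coord i x + y ord0 i); last first.
  by apply/funext => x /=; rewrite /rV_coord mxE.
by apply: measurable_funD => //; exact: measurable_rV_coord.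
Qed.

Lemma measurable_addr1 (a : R) : measurable_fun setT (fun x : RT => x + a : RT).
Proof. exact: measurable_funD. Qed.

(** The image measure under a translation gives every interval ]b, c] its length, and this
    determines Lebesgue measure on the Borel sets. *)
Lemma lebesgue_measure_shift (a : R) (A : set RT) : measurable A ->
  lebesgue_measure ((fun x => x + a) @^-1` A) = lebesgue_measure A.
Proof.
move=> mA.
pose f : RT -> RT := fun x => x + a.
have mf : measurable_fun setT f by exact: measurable_addr1.
pose fM : {mfun RT >-> RT} := HB.pack f (@isMeasurableFun.Build _ _ _ _ f mf).
apply/esym; rewrite (@lebesgue_measure_unique _ (pushforward lebesgue_measure fM))//.
move=> _ [[b c]] _ <-; rewrite /pushforward/=.
rewrite (_ : pushforward _ _ _ = lebesgue_measure `](b - a)%R, (c - a)%R]%classic).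
  rewrite !lebesgue_measure_itv/= !lte_fin ltrD2r.
  by case: ifPn => // _; rewrite -!EFinD opprB addrA addrNK.
congr (lebesgue_measure _).
by apply/seteqP; split => x /=; rewrite !in_itv/= /fM /= /f ltrBlDr lerBrDr.
Qed.

Definition addv_mfun n (y : 'rV[R]_n) : {mfun 'rV[R]_n >-> 'rV[R]_n} :=
  HB.pack (fun x : 'rV[R]_n => x + y)
    (@isMeasurableFun.Build _ _ _ _ (fun x : 'rV[R]_n => x + y) (measurable_addv y)).

(** Translation acts separately on the first coordinate and on the others, so by uniqueness of
    product measures only rectangles need checking; there the one-dimensional case and the induction
    hypothesis apply. *)
Lemma lebesgue_rV_shift n (y : 'rV[R]_n) (A : set 'rV[R]_n) : measurable A ->
  lebesgue_rV R n ((fun x => x + y) @^-1` A) = lebesgue_rV R n A.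
Proof.
elim: n y A => [|n IH] y A mA.
  have -> // : (fun x => x + y) @^-1` A = A.
  by apply/seteqP; split => x /=; rewrite (thinmx0 y) addr0.
rewrite /=/lebesgue_rV_step /pushforward.
pose y' := rV_uncons y.
pose f (x : RT * 'rV[R]_n) : RT * 'rV[R]_n := ((x.1 : R) + y'.1 : RT, x.2 + y'.2).
have mf : measurable_fun setT f.
  apply/measurable_fun_pair.
    exact: (measurableT_comp (measurable_addr1 y'.1) measurable_fst).
  exact: (measurableT_comp (measurable_addv y'.2) measurable_snd).
pose fM : {mfun (RT * 'rV[R]_n)%type >-> (RT * 'rV[R]_n)%type} :=
  HB.pack f (@isMeasurableFun.Build _ _ _ _ f mf).
have mB : measurable (@rV_cons R n @^-1` A).
  by rewrite -[X in measurable X]setTI; exact: (measurable_rV_cons measurableT).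
rewrite [RHS](@product_measure_unique _ _ _ _ _ _ _
  (pushforward (lebesgue_measure \x lebesgue_rV R n)%E fM))//.
  rewrite /pushforward -comp_preimage -[in RHS]comp_preimage.
  congr (_ (_ @^-1` A)); apply/funext => x /=.
  by rewrite /f rV_consD /y' rV_unconsK.
move=> B C mB' mC; rewrite /pushforward.
transitivity ((lebesgue_measure \x lebesgue_rV R n)%E
  ((((fun x => x + y'.1) @^-1` B) : set RT) `*` ((fun x => x + y'.2) @^-1` C))) => //.
rewrite product_measure1E//.
- by rewrite IH//; congr (_ * _)%E; exact: lebesgue_measure_shift.
- by rewrite -[X in measurable X]setTI; exact: (measurable_addr1 _ measurableT).
- by rewrite -[X in measurable X]setTI; exact: (measurable_addv _ measurableT).
Qed.

Section fixN.
Variable N : nat.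
Local Notation V := 'rV[R]_N.
Local Notation mu := (lebesgue_rV R N).

Lemma ge0_integral_addv (y : V) (f : V -> \bar R) : measurable_fun setT f ->
  (forall x, 0 <= f x)%E -> (\int[mu]_x f (x + y)%R = \int[mu]_x f x)%E.
Proof.
move=> mf f0.
rewrite -[in RHS](@eq_measure_integral _ _ _ _ mu (pushforward mu (addv_mfun y))).
  by rewrite ge0_integral_pushforward// preimage_setT.
by move=> A mA _; rewrite /= /pushforward lebesgue_rV_shift.
Qed.

Lemma integrable_addv (y : V) (f : V -> \bar R) : mu.-integrable setT f ->
  mu.-integrable setT (fun x => f (x + y)).
Proof.
move=> /integrableP[mf foo]; apply/integrableP; split.
  by apply: measurableT_comp mf _; exact: measurable_addv.
rewrite (ge0_integral_addv y (f := fun x => `|f x|%E))//.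
exact: measurableT_comp.
Qed.

Lemma integral_addv (y : V) (f : V -> \bar R) : measurable_fun setT f ->
  (\int[mu]_x f (x + y)%R = \int[mu]_x f x)%E.
Proof.
move=> mf; rewrite integralE [RHS]integralE; congr (_ - _)%E.
  rewrite -(ge0_integral_addv y (f := f^\+%E))//; last exact: measurable_funepos.
  by apply: eq_integral => x _; rewrite !(funeposE,funenegE).
rewrite -(ge0_integral_addv y (f := f^\-%E))//; last exact: measurable_funeneg.
by apply: eq_integral => x _; rewrite !(funeposE,funenegE).
Qed.

(** [0 <= r] matters for N = 0, where the norm is 0 and the condition on the coordinates is void. *)
Lemma norm_rV_le (x : V) (r : R) : 0 <= r ->
  (`|x| <= r) <-> (forall i, `|x ord0 i| <= r).
Proof.
move=> r0; rewrite {1}/Num.norm/= mx_normrE; split.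
  move=> + i; apply: le_trans.
  by rewrite (le_bigmax _ (fun ij => `|x ij.1 ij.2|) (ord0, i)).
move=> h; apply/bigmax_leP; split => // -[i j] _ /=.
by rewrite (ord1 i).
Qed.

Lemma coord_le_norm (x : V) i : `|x ord0 i| <= `|x|.
Proof. by have /norm_rV_le : 0 <= `|x| by []; move=> /(_ x)[+ _]; apply. Qed.

Lemma norm_ballE (r : R) : 0 <= r ->
  [set x : V | `|x| <= r] = [set x : V | forall i, `[- r, r]%classic (x ord0 i)].
Proof.
move=> r0; apply/seteqP; split => x /= h.
  by move=> i; rewrite /= in_itv/= -ler_norml; move: i; apply/norm_rV_le.
by apply/norm_rV_le => // i; have := h i; rewrite /= in_itv/= -ler_norml.
Qed.

Lemma measurable_norm_ball (r : R) : measurable [set x : V | `|x| <= r].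
Proof.
have [r0|r0] := leP 0 r.
  by rewrite norm_ballE//; apply: (@measurable_box _ (fun=> `[- r, r]%classic)) => i; exact: measurable_itv.
rewrite [X in measurable X](_ : _ = set0)//; apply/seteqP; split => // x /= h.
by have := le_trans (normr_ge0 _) h; rewrite leNgt r0.
Qed.

Lemma lebesgue_norm_ball (r : R) : 0 <= r ->
  mu [set x : V | `|x| <= r] = ((2 * r) ^+ N)%:E.
Proof.
move=> r0; rewrite norm_ballE// (@lebesgue_rV_box _ (fun=> `[- r, r]%classic)); last first.
  by move=> i; exact: measurable_itv.
rewrite (eq_bigr (fun=> (2 * r)%:E)); last first.
  move=> i _; rewrite lebesgue_measure_itv/= lte_fin.
  case: ifPn; first by rewrite -EFinD opprK mulr_natl mulr2n.
  rewrite -leNgt => h; congr EFin; lra.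
by rewrite prodEFin prodr_const card_ord.
Qed.

(** The sigma-algebra is generated by coordinates, so the open set is written as a countable union
    of closed boxes with rational centres and half-sides 1 / (k + 1). *)
Lemma open_rV_measurable (U : set V) : open U -> measurable U.
Proof.
move=> oU.
pose P (zn : 'rV[rat]_N * nat) : set V :=
  [set x | forall i, `[ratr (zn.1 ord0 i) - zn.2.+1%:R^-1 : R,
                     ratr (zn.1 ord0 i) + zn.2.+1%:R^-1]%classic (x ord0 i)].
have -> : U = \bigcup_(zn in [set zn | P zn `<=` U]) P zn.
  apply/seteqP; split => [x Ux|x [zn /= h]]; last exact: h.
  move: oU; rewrite openE => /(_ _ Ux); rewrite /interior -nbhs_ballE => -[e /= e0 eU].
  (* A box of half-side d whose centre is within d of x stays within 2 d of x; hence d < e / 2 is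
     wanted. *)
  have e20 : 0 < e / 2 by rewrite divr_gt0.
  have [n _ /(_ n (leqnn n)) /= ne] := near_infty_natSinv_lt (PosNum e20).
  have n0 : (0 : R) < n.+1%:R^-1 by rewrite invr_gt0.
  have [z zx] : exists z : 'I_N -> rat,
      forall i, (ratr (z i) : R) \in `](x ord0 i - n.+1%:R^-1), (x ord0 i + n.+1%:R^-1)[.
    have /choice[z zP] : forall i : 'I_N, exists q : rat,
        (ratr q : R) \in `](x ord0 i - n.+1%:R^-1), (x ord0 i + n.+1%:R^-1)[.
      by move=> i; apply: rat_in_itvoo; rewrite ltrBlDr -addrA ltrDl addr_gt0.
    by exists z.
  exists (\row_i z i, n); last first.
    move=> i; rewrite /= mxE in_itv/=; have := zx i; rewrite in_itv/=.
    by move: (n.+1%:R^-1) => d; lra.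
  move=> y Py; apply: eU; rewrite mx_norm_ball /ball_ /=.
  apply: (@le_lt_trans _ _ (2 * n.+1%:R^-1)); last by move: ne; move: (n.+1%:R^-1) => d; lra.
  apply/norm_rV_le; first by rewrite mulr_ge0// ltW.
  move=> i; have := Py i; have := zx i; rewrite /= !mxE !in_itv/= ler_norml.
  move: (n.+1%:R^-1) => d; lra.
rewrite bigcup_mkcond; apply: countable_bigcupT_measurable => [|zn].
  exact: countableP.
case: ifP => // _; apply: (@measurable_box _ (fun i => `[ratr (zn.1 ord0 i) - zn.2.+1%:R^-1 : R,
  ratr (zn.1 ord0 i) + zn.2.+1%:R^-1]%classic)) => i; exact: measurable_itv.
Qed.

Lemma continuous_rV_measurable (f : V -> R) : continuous f ->
  measurable_fun setT f.
Proof.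
move=> /continuousP cf.
apply: (measurability _ (RGenOInfty.measurableE R)) => //.
move=> /= _ [_ [a ->] <-]; rewrite setTI; apply: open_rV_measurable.
by apply: cf; exact: interval_open.
Qed.

End fixN.
End lebesgue_rV_theory.

(** * Integrals of real-valued functions *)

Section real_integral.
Context d (T : measurableType d) (R : realType) (mu : {measure set T -> \bar R}).
Implicit Types f g h : T -> R.

Definition itg f := mu.-integrable setT (EFin \o f).

Lemma itg_measurable f : itg f -> measurable_fun setT f.
Proof. by move=> /integrableP[/measurable_EFinP]. Qed.

Lemma itgP f : itg f <->
  measurable_fun setT f /\ (\int[mu]_x (`|f x|)%:E < +oo)%E.
Proof.
split=> [/integrableP[/measurable_EFinP mf foo]|[mf foo]]; first by split.
by apply/integrableP; split => //; exact/measurable_EFinP.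
Qed.

Lemma itg_le f g : measurable_fun setT f -> (forall x, `|f x| <= g x) ->
  itg g -> itg f.
Proof.
move=> mf fg; apply: le_integrable => //; first exact/measurable_EFinP.
by move=> x _ /=; rewrite lee_fin (le_trans (fg x))// ler_norm.
Qed.

Lemma itg_ae_le f g : measurable_fun setT f -> {ae mu, forall x, `|f x| <= g x} ->
  itg g -> itg f.
Proof.
move=> mf fg /itgP[mg goo]; apply/itgP; split => //.
apply: le_lt_trans goo; apply: ae_ge0_le_integral => //.
- by apply/measurable_EFinP; exact: measurableT_comp.
- by apply/measurable_EFinP; exact: measurableT_comp.
by apply: filterS fg => x fgx _; rewrite lee_fin (le_trans fgx)// ler_norm.
Qed.

Lemma itgD f g : itg f -> itg g -> itg (fun x => f x + g x).
Proof. by move=> fi gi; exact: (integrableD measurableT fi gi). Qed.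

Lemma itgB f g : itg f -> itg g -> itg (fun x => f x - g x).
Proof. by move=> fi gi; exact: (integrableB measurableT fi gi). Qed.

Lemma itgZ k f : itg f -> itg (fun x => k * f x).
Proof. by move=> fi; exact: (integrableZl measurableT k fi). Qed.

Lemma itg_norm f : itg f -> itg (fun x => `|f x|).
Proof. exact: integrable_norm. Qed.

Lemma itg0 : itg (fun=> 0).
Proof. exact: integrable0. Qed.

Lemma itg_sum (J : Type) (s : seq J) (F : J -> T -> R) :
  (forall j, itg (F j)) -> itg (fun x => \sum_(j <- s) F j x).
Proof.
move=> Fi; elim: s => [|j s IH].
  by under eq_fun do rewrite big_nil; exact: itg0.
by under eq_fun do rewrite big_cons; exact: itgD.
Qed.

Lemma RintD f g : itg f -> itg g ->
  \int[mu]_x (f x + g x) = \int[mu]_x f x + \int[mu]_x g x.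
Proof. by move=> fi gi; rewrite RintegralD. Qed.

Lemma RintB f g : itg f -> itg g ->
  \int[mu]_x (f x - g x) = \int[mu]_x f x - \int[mu]_x g x.
Proof. by move=> fi gi; rewrite RintegralB. Qed.

Lemma RintZ k f : itg f -> \int[mu]_x (k * f x) = k * \int[mu]_x f x.
Proof. by move=> fi; rewrite RintegralZl. Qed.

Lemma Rint_sum (J : Type) (s : seq J) (F : J -> T -> R) :
  (forall j, itg (F j)) ->
  \int[mu]_x (\sum_(j <- s) F j x) = \sum_(j <- s) \int[mu]_x F j x.
Proof.
move=> Fi; elim: s => [|j s IH].
  rewrite big_nil; under eq_Rintegral do rewrite big_nil.
  by rewrite /Rintegral integral0.
rewrite big_cons -IH -RintD//; last exact: itg_sum.
by apply: eq_Rintegral => x _; rewrite big_cons.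
Qed.

Lemma eq_Rint f g : f =1 g -> \int[mu]_x f x = \int[mu]_x g x.
Proof. by move=> fg; apply: eq_Rintegral => x _. Qed.

Lemma Rint_EFin f : itg f -> (\int[mu]_x f x)%:E = (\int[mu]_x (f x)%:E)%E.
Proof. by move=> fi; rewrite /Rintegral fineK//; exact: integrable_fin_num. Qed.

Lemma Rint_le f g : itg f -> itg g -> (forall x, f x <= g x) ->
  \int[mu]_x f x <= \int[mu]_x g x.
Proof. by move=> fi gi fg; apply: le_Rintegral. Qed.

Lemma Rint_ge0 f : (forall x, 0 <= f x) -> 0 <= \int[mu]_x f x.
Proof. by move=> f0; apply: Rintegral_ge0. Qed.

Lemma Rint_norm f : itg f -> `|\int[mu]_x f x| <= \int[mu]_x `|f x|.
Proof. by move=> fi; apply: le_normr_Rintegral. Qed.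

Lemma Rint_ae_eq f g : measurable_fun setT f -> measurable_fun setT g ->
  {ae mu, forall x, f x = g x} -> \int[mu]_x f x = \int[mu]_x g x.
Proof.
move=> mf mg fg; congr fine; apply: ae_eq_integral => //.
- exact/measurable_EFinP.
- exact/measurable_EFinP.
by apply: filterS fg => x fgx _; rewrite fgx.
Qed.

Lemma Rint_ae_le f g : itg f -> itg g -> {ae mu, forall x, f x <= g x} ->
  \int[mu]_x f x <= \int[mu]_x g x.
Proof.
move=> fi gi fg; rewrite -subr_ge0 -RintB//.
have mgf : measurable_fun setT (fun x => g x - f x).
  by apply: measurable_funB; exact: itg_measurable.
rewrite (@Rint_ae_eq _ (fun x => `|g x - f x|))//.
- by apply: Rint_ge0.
- exact: measurableT_comp.
by apply: filterS fg => x fgx; rewrite ger0_norm// subr_ge0.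
Qed.

Lemma Rint_norm_ae_le f g : measurable_fun setT f -> itg g ->
  {ae mu, forall x, `|f x| <= g x} -> `|\int[mu]_x f x| <= \int[mu]_x g x.
Proof.
move=> mf gi fg; have fi : itg f by exact: itg_ae_le fg gi.
by apply: (le_trans (Rint_norm fi)); apply: Rint_ae_le => //; exact: itg_norm.
Qed.

Lemma Rint_norm_le f g : measurable_fun setT f -> itg g ->
  (forall x, `|f x| <= g x) -> `|\int[mu]_x f x| <= \int[mu]_x g x.
Proof. by move=> mf gi fg; apply: Rint_norm_ae_le => //; exact: aeW. Qed.

Lemma Rint_dct (f_ : nat -> T -> R) f g :
  (forall n, measurable_fun setT (f_ n)) -> measurable_fun setT f -> itg g ->
  {ae mu, forall x, f_ n x @[n --> \oo] --> f x} ->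
  (forall n, {ae mu, forall x, `|f_ n x| <= g x}) ->
  \int[mu]_x f_ n x @[n --> \oo] --> \int[mu]_x f x.
Proof.
move=> mf_ mf gi ff fg.
have [|||||] := @dominated_convergence _ _ _ mu setT measurableT
    (fun n x => (f_ n x)%:E) (EFin \o f) (EFin \o g).
- by move=> n; exact/measurable_EFinP.
- exact/measurable_EFinP.
- by apply: filterS ff => x ffx _; apply/fine_cvgP; split => //; exact: nearW.
- exact: gi.
- apply/ae_foralln => n; apply: filterS (fg n) => x fgx _.
  by rewrite lee_fin.
by move=> fi _ h; apply: fine_cvg; rewrite fineK //; exact: integrable_fin_num fi.
Qed.

Lemma Rint_eq0_ae f : itg f -> (forall x, 0 <= f x) -> \int[mu]_x f x = 0 ->
  {ae mu, forall x, f x = 0}.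
Proof.
move=> fi f0 If.
have : (\int[mu]_x `|(f x)%:E| = 0)%E.
  under eq_integral do rewrite gee0_abs ?lee_fin//.
  by rewrite -Rint_EFin// If.
have mf := itg_measurable fi.
move/(@ae_eq_integral_abs _ _ _ mu setT measurableT (EFin \o f)) => h.
have /h : measurable_fun setT (EFin \o f) by exact/measurable_EFinP.
by apply: filterS => x /(_ I) [].
Qed.

End real_integral.

(** * Fubini's theorem for real-valued integrands *)

Section real_fubini.
Context d1 d2 (T1 : measurableType d1) (T2 : measurableType d2) (R : realType).
Variables (m1 : {sigma_finite_measure set T1 -> \bar R})
          (m2 : {sigma_finite_measure set T2 -> \bar R}).
Variable f : T1 * T2 -> R.
Hypothesis fi : itg (m1 \x m2)%E f.

Lemma Rfubini_itg1 : {ae m1, forall x, itg m2 (fun y => f (x, y))}.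
Proof. exact: (ae_integrable1 fi). Qed.

Lemma Rfubini_itg2 : {ae m2, forall y, itg m1 (fun x => f (x, y))}.
Proof. exact: (ae_integrable2 fi). Qed.

(** The inner real integral takes a default value where a section is not integrable. This happens on
    a null set only, off which it agrees with the extended-valued inner integral. *)
Lemma Rfubini_F : itg m1 (fun x => \int[m2]_y f (x, y)) /\
  \int[m1]_x \int[m2]_y f (x, y) = \int[(m1 \x m2)%E]_z f z.
Proof.
have Fi := integrable_fubini_F fi.
have mF := measurable_int _ Fi.
have ae : {ae m1, forall x, [set: T1] x ->
   (\int[m2]_y f (x, y))%:E = (fubini_F m2 (EFin \o f)) x}.
  by apply: filterS Rfubini_itg1 => x fx _; rewrite /fubini_F Rint_EFin.
have mf : measurable_fun setT (fun x => \int[m2]_y f (x, y)).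
  by apply: (measurableT_comp _ mF).
split.
  apply/itgP; split => //.
  have /integrableP[_] := Fi; apply: le_lt_trans.
  apply: ae_ge0_le_integral => //.
  + by apply/measurable_EFinP; exact: measurableT_comp.
  + exact: measurableT_comp.
  by apply: filterS ae => x /(_ I) <- _.
congr fine; rewrite -(integral12_prod_meas1 fi).
by apply: ae_eq_integral => //; exact/measurable_EFinP.
Qed.

Lemma Rfubini_G : itg m2 (fun y => \int[m1]_x f (x, y)) /\
  \int[m2]_y \int[m1]_x f (x, y) = \int[(m1 \x m2)%E]_z f z.
Proof.
have mF := measurable_fubini_G fi.
have ae : {ae m2, forall y, [set: T2] y ->
   (\int[m1]_x f (x, y))%:E = (fubini_G m1 (EFin \o f)) y}.
  by apply: filterS Rfubini_itg2 => x fx _; rewrite /fubini_G Rint_EFin.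
have mf : measurable_fun setT (fun y => \int[m1]_x f (x, y)).
  exact: (measurableT_comp _ mF).
have mfi := measurable_int _ fi.
split.
  apply/itgP; split => //.
  have /(integrable21ltyP _ _ mfi) := fi; apply: le_lt_trans.
  apply: ae_ge0_le_integral => //.
  + by apply/measurable_EFinP; exact: measurableT_comp.
  + by move=> y _; apply: integral_ge0.
  + have := @measurable_fun_fubini_tonelli_G _ _ _ _ _ m1 (fun z => (`|f z|)%:E).
    by apply => //; apply/measurable_EFinP; apply: measurableT_comp => //; exact/measurable_EFinP.
  apply: filterS ae => y /(_ I) yE _; rewrite -abse_EFin yE.
  apply: le_abse_integral => //.
  by apply: measurableT_comp mfi _; exact: measurable_pair2.
congr fine; rewrite -(integral21_prod_meas1 fi).
by apply: ae_eq_integral => //; exact/measurable_EFinP.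
Qed.

Lemma Rfubini :
  \int[m1]_x \int[m2]_y f (x, y) = \int[m2]_y \int[m1]_x f (x, y).
Proof. by rewrite (proj2 Rfubini_F) (proj2 Rfubini_G). Qed.

End real_fubini.

Section fubini_bound.
Context d1 d2 (T1 : measurableType d1) (T2 : measurableType d2) (R : realType).
Variables (m1 : {sigma_finite_measure set T1 -> \bar R})
          (m2 : {sigma_finite_measure set T2 -> \bar R}).

Lemma itg_prod (f : T1 * T2 -> R) (g : T1 -> R) : measurable_fun setT f -> itg m1 g ->
  {ae m1, forall x, (\int[m2]_y (`|f (x, y)|)%:E <= (g x)%:E)%E} ->
  itg (m1 \x m2)%E f.
Proof.
move=> mf /itgP[mg goo] fg; apply/(integrable12ltyP m1 m2).
  exact/measurable_EFinP.
apply: le_lt_trans goo; apply: ae_ge0_le_integral => //.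
- by move=> x _; apply: integral_ge0.
- have := @measurable_fun_fubini_tonelli_F _ _ _ _ _ m2 (fun z => (`|f z|)%:E).
  by apply => //; apply/measurable_EFinP; exact: measurableT_comp.
- by apply/measurable_EFinP; exact: measurableT_comp.
by apply: filterS fg => x fgx _; rewrite (le_trans fgx)// lee_fin ler_norm.
Qed.

End fubini_bound.

(** * Continuity of translations in the mean *)

Section translation_continuity.
Variables (R : realType) (N : nat).
Local Notation V := 'rV[R]_N.
Local Notation mu := (lebesgue_rV R N).
Implicit Types (f g G W : V -> R) (K e : R) (x y : V).

Definition cB K x : R := \1_[set x : V | `|x| <= K] x.

Lemma cBE K x : cB K x = if `|x| <= K then 1 else 0.
Proof.
rewrite /cB indicE; case: ifPn => h; first by rewrite mem_set.
by rewrite memNset//=; apply/negP.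
Qed.

Lemma cB_ge0 K x : 0 <= cB K x.
Proof. by rewrite cBE; case: ifP. Qed.

Lemma cB_le1 K x : cB K x <= 1.
Proof. by rewrite cBE; case: ifP. Qed.

Lemma measurable_cB K : measurable_fun setT (cB K).
Proof. by apply: measurable_indic; exact: measurable_norm_ball. Qed.

Lemma cB_mono K K' x : K <= K' -> cB K x <= cB K' x.
Proof.
move=> KK'; rewrite !cBE; case: ifPn => h; last by case: ifP.
by rewrite (le_trans h).
Qed.

Lemma cB_shift K K' x y : `|y| <= K' -> cB K x <= cB (K + K') (x + y).
Proof.
move=> yK; rewrite !cBE; case: ifPn => h; last by case: ifP.
by rewrite (le_trans (ler_normD _ _))// lerD.
Qed.

Lemma itg_cB K : itg mu (cB K).
Proof.
apply/itgP; split; first exact: measurable_cB.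
under eq_integral do rewrite ger0_norm ?cB_ge0//.
rewrite /cB integral_indic//; last exact: measurable_norm_ball.
rewrite setIT; have [K0|K0] := leP 0 K; first by rewrite [ltLHS](lebesgue_norm_ball N K0) ltry.
rewrite (_ : [set _ | _] = set0) ?measure0//.
apply/seteqP; split => // x /= h; have := le_trans (normr_ge0 _) h.
by rewrite leNgt K0.
Qed.

Definition L1loc f := measurable_fun setT f /\ forall K, itg mu (fun x => cB K x * f x).

Lemma measurable_shift f y : measurable_fun setT f ->
  measurable_fun setT (fun x => f (x + y)).
Proof. by move=> mf; apply: measurableT_comp mf _; exact: measurable_addv. Qed.

Lemma itg_shift f y : itg mu f -> itg mu (fun x => f (x + y)).
Proof. exact: (@integrable_addv R N y (EFin \o f)). Qed.

Lemma Rint_shift f y : measurable_fun setT f ->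
  \int[mu]_x f (x + y) = \int[mu]_x f x.
Proof.
by move=> mf; congr fine; apply: (integral_addv y (f := EFin \o f)); exact/measurable_EFinP.
Qed.

Lemma L1loc_shift f y : L1loc f -> L1loc (fun x => f (x + y)).
Proof.
move=> [mf fi]; split=> [|K]; first exact: measurable_shift.
apply: (@itg_le _ _ _ _ _ (fun x => `|cB (K + `|y|) (x + y) * f (x + y)|)).
- by apply: measurable_funM; [exact: measurable_cB|exact: measurable_shift].
- by move=> x; rewrite !normrM ler_wpM2r// !ger0_norm ?cB_ge0// cB_shift.
apply: itg_norm; exact: (itg_shift y (fi (K + `|y|))).
Qed.

Lemma L1locD f g : L1loc f -> L1loc g -> L1loc (fun x => f x + g x).
Proof.
move=> [mf fi] [mg gi]; split=> [|K]; first exact: measurable_funD.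
by under eq_fun do rewrite mulrDr; exact: itgD.
Qed.

Lemma L1locZ k f : L1loc f -> L1loc (fun x => k * f x).
Proof.
move=> [mf fi]; split=> [|K]; first exact: measurable_funM.
by under eq_fun do rewrite mulrCA; exact: itgZ.
Qed.

Lemma L1locB f g : L1loc f -> L1loc g -> L1loc (fun x => f x - g x).
Proof.
move=> hf hg; under eq_fun do rewrite -[X in _ + X]mulN1r.
by apply: L1locD => //; exact: L1locZ.
Qed.

Lemma L1loc_le f g : measurable_fun setT f -> (forall x, `|f x| <= g x) ->
  L1loc g -> L1loc f.
Proof.
move=> mf fg [mg gi]; split => // K.
apply: (itg_le _ _ (gi K)) => [|x]; first by apply: measurable_funM => //; exact: measurable_cB.
by rewrite normrM ger0_norm ?cB_ge0// ler_wpM2l ?cB_ge0.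
Qed.

Lemma L1loc_bounded f M : measurable_fun setT f -> (forall x, `|f x| <= M) -> L1loc f.
Proof.
move=> mf fM; split=> // K; apply: (itg_le _ _ (itgZ M (itg_cB K))) => [|x].
  by apply: measurable_funM => //; exact: measurable_cB.
by rewrite normrM ger0_norm ?cB_ge0// mulrC ler_wpM2r ?cB_ge0.
Qed.

Lemma L1loc_norm f : L1loc f -> L1loc (fun x => `|f x|).
Proof.
move=> [mf fi]; split=> [|K]; first exact: measurableT_comp.
under eq_fun do rewrite -(ger0_norm (cB_ge0 _ _)) -normrM.
exact: itg_norm.
Qed.

Lemma itg_L1loc f : itg mu f -> L1loc f.
Proof.
move=> fi; have mf := itg_measurable fi; split => // K.
apply: (itg_le _ _ (itg_norm fi)) => [|x].
  by apply: measurable_funM => //; exact: measurable_cB.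
by rewrite normrM ger0_norm ?cB_ge0// ler_piMl// cB_le1.
Qed.

Definition shift_cont f := forall K e, 0 < e -> exists2 d, 0 < d &
  forall y, `|y| <= d -> \int[mu]_x (cB K x * `|f (x + y) - f x|) <= e.

Lemma itg_diff K f y : L1loc f -> itg mu (fun x => cB K x * `|f (x + y) - f x|).
Proof.
move=> hf; have [_] : L1loc (fun x => `|f (x + y) - f x|).
  by apply: L1loc_norm; apply: L1locB => //; exact: L1loc_shift.
exact.
Qed.

Lemma shift_contD f g : L1loc f -> L1loc g -> shift_cont f -> shift_cont g ->
  shift_cont (fun x => f x + g x).
Proof.
move=> hf hg cf cg K e e0; have e20 : 0 < e / 2 by rewrite divr_gt0.
have [d1 d10 h1] := cf K _ e20; have [d2 d20 h2] := cg K _ e20.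
exists (Num.min d1 d2) => [|y]; first by rewrite lt_min d10.
rewrite le_min => /andP[y1 y2].
rewrite (splitr e); apply: le_trans (lerD (h1 _ y1) (h2 _ y2)).
rewrite -RintD; [|exact: itg_diff..].
apply: Rint_le => [||x]; first by apply: itg_diff; exact: L1locD.
  by apply: itgD; exact: itg_diff.
rewrite -mulrDr ler_wpM2l ?cB_ge0//.
by rewrite opprD addrACA ler_normD.
Qed.

Lemma shift_contZ k f : L1loc f -> shift_cont f -> shift_cont (fun x => k * f x).
Proof.
move=> hf cf K e e0; have k0 : 0 < `|k| + 1 by rewrite ltr_pwDr.
have [d d0 h] := cf K (e / (`|k| + 1)) (divr_gt0 e0 k0).
exists d => // y /h; rewrite ler_pdivlMr// mulrC -RintZ; last exact: itg_diff.
apply: le_trans; apply: Rint_le => [||x].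
- exact/itg_diff/L1locZ.
- exact/itgZ/itg_diff.
rewrite mulrCA ler_wpM2l ?cB_ge0// -mulrBr normrM ler_wpM2r//.
by rewrite lerDl.
Qed.

Lemma shift_cont_approx f : L1loc f ->
  (forall K e, 0 < e -> exists g, [/\ L1loc g, shift_cont g &
     \int[mu]_x (cB K x * `|f x - g x|) <= e]) -> shift_cont f.
Proof.
move=> hf ap K e e0; have e30 : 0 < e / 3 by rewrite divr_gt0.
(* The approximation is taken on the ball of radius K + 1: a translation by |y| <= 1 moves the ball
   of radius K into it. *)
have [g [hg cg gap]] := ap (K + 1) _ e30.
have [d d0 hd] := cg K _ e30.
exists (Num.min d 1) => [|y]; first by rewrite lt_min d0/=.
rewrite le_min => /andP[yd y1].
have hfg : L1loc (fun x => `|f x - g x|) by exact/L1loc_norm/L1locB.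
have [mfg ifg] := hfg.
have [_ ifgy] := L1loc_shift y hfg.
have -> : e = e / 3 + e / 3 + e / 3 by field.
apply: (@le_trans _ _ (\int[mu]_x (cB K x * `|f (x + y) - g (x + y)|)
   + \int[mu]_x (cB K x * `|g (x + y) - g x|)
   + \int[mu]_x (cB K x * `|f x - g x|))).
  rewrite -RintD//; last exact: itg_diff.
  rewrite -RintD//; last by apply: itgD => //; exact: itg_diff.
  apply: Rint_le => [||x]; first exact: itg_diff.
    by do 2 apply: itgD => //; exact: itg_diff.
  rewrite -!mulrDr ler_wpM2l ?cB_ge0//.
  have -> : f (x + y) - f x = (f (x + y) - g (x + y)) + (g (x + y) - g x) - (f x - g x) by ring.
  by rewrite (le_trans (ler_normB _ _))// lerD2r ler_normD.
apply: lerD; first apply: lerD; last 2 first.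
- exact: hd.
- apply: le_trans gap; apply: Rint_le => // x.
  by rewrite ler_wpM2r// cB_mono// lerDl.
apply: le_trans gap.
rewrite -[leRHS](Rint_shift y); last first.
  by apply: measurable_funM => //; exact: measurable_cB.
apply: Rint_le => //; first exact: (itg_shift y (ifg (K + 1))).
by move=> x; rewrite ler_wpM2r// cB_shift.
Qed.

Lemma L1loc_indic (A : set V) : measurable A -> L1loc (\1_A : V -> R).
Proof.
move=> mA; apply: (@L1loc_bounded _ 1); first exact: measurable_indic.
by move=> x; rewrite indicE; case: (_ \in _); rewrite /= ?normr1 ?normr0.
Qed.

(* These sets form a sigma-algebra containing the half-spaces, hence all Borel sets. *)
Definition shift_good (A : set V) := measurable A /\ shift_cont (\1_A : V -> R).

(** Meant for complements and unions, whose indicators have increments bounded by those of the sets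
    they are built from. *)
Lemma shift_cont_le2 f f1 f2 : L1loc f -> L1loc f1 -> L1loc f2 ->
  shift_cont f1 -> shift_cont f2 ->
  (forall x y, `|f x - f y| <= `|f1 x - f1 y| + `|f2 x - f2 y|) -> shift_cont f.
Proof.
move=> hf hf1 hf2 cf cg hle K e e0; have e20 : 0 < e / 2 by rewrite divr_gt0.
have [d1 d10 h1] := cf K _ e20; have [d2 d20 h2] := cg K _ e20.
exists (Num.min d1 d2) => [|y]; first by rewrite lt_min d10.
rewrite le_min => /andP[y1 y2].
rewrite (splitr e); apply: le_trans (lerD (h1 _ y1) (h2 _ y2)).
rewrite -RintD; [|exact: itg_diff..].
apply: Rint_le => [||x]; first exact: itg_diff.
  by apply: itgD; exact: itg_diff.
by rewrite -mulrDr ler_wpM2l ?cB_ge0.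
Qed.

Lemma shift_cont_cst (k : R) : shift_cont (fun=> k).
Proof.
move=> K e e0; exists 1 => // y _; rewrite (_ : (fun _ => _) = fun=> 0); last first.
  by apply/funext => x; rewrite subrr normr0 mulr0.
by rewrite /Rintegral integral0 ltW.
Qed.

Lemma shift_goodC A : shift_good A -> shift_good (~` A).
Proof.
move=> [mA cA]; split; first exact: measurableC.
have := @shift_cont_le2 (\1_(~` A) : V -> R) (\1_A) (fun=> 0).
apply => //.
- exact/L1loc_indic/measurableC.
- exact/L1loc_indic.
- by apply: (@L1loc_bounded _ 0) => // x; rewrite normr0.
- exact: shift_cont_cst.
move=> x y; rewrite subrr normr0 addr0 !indicE !in_setC.
by case: (x \in A); case: (y \in A); rewrite /= ?subrr ?subr0 ?sub0r ?normrN.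
Qed.

Lemma shift_goodU A B : shift_good A -> shift_good B -> shift_good (A `|` B).
Proof.
move=> [mA cA] [mB cB]; split; first exact: measurableU.
have := @shift_cont_le2 (\1_(A `|` B) : V -> R) (\1_A) (\1_B).
apply => //; [exact/L1loc_indic/measurableU|exact: L1loc_indic|exact: L1loc_indic|].
move=> x y; rewrite !indicE !in_setU.
by case: (x \in A); case: (y \in A); case: (x \in B); case: (y \in B);
  rewrite /= ?subrr ?subr0 ?sub0r ?normrN ?normr1 ?normr0 ?addr0 ?add0r// lerDl.
Qed.

Lemma shift_good0 : shift_good set0.
Proof. by split => //; rewrite indic0; exact: shift_cont_cst. Qed.

Lemma shift_good_bigcup (F : (set V)^nat) :
  (forall i, shift_good (F i)) -> shift_good (\bigcup_i F i).
Proof.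
move=> gF; have mF i : measurable (F i) by have [] := gF i.
pose U n := \big[setU/set0]_(i < n) F i.
have gU n : shift_good (U n).
  rewrite /U; elim: n => [|n IH]; first by rewrite big_ord0; exact: shift_good0.
  by rewrite big_ord_recr; exact: shift_goodU.
split; first exact: bigcupT_measurable.
apply: shift_cont_approx; first exact/L1loc_indic/bigcupT_measurable.
move=> K e e0.
(* The finite unions [U n] exhaust the countable one, and the indicator of the ball is an integrable
   majorant of the error. *)
have : \int[mu]_x (cB K x * `|\1_(\bigcup_i F i) x - \1_(U n) x|) @[n --> \oo] -->
    \int[mu]_x (cst 0 : V -> R) x.
  apply: (@Rint_dct _ _ _ mu _ _ (cB K)) => //.
  - move=> n; apply: measurable_funM; first exact: measurable_cB.
    apply: measurableT_comp => //; apply: measurable_funB; apply: measurable_indic.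
      exact: bigcupT_measurable.
    by have [] := gU n.
  - exact: itg_cB.
  - apply: aeW => x /=; apply: cvg_near_cst.
    have [[k _ Fk]|nF] := pselect ((\bigcup_i F i) x).
      near=> n; rewrite !indicE !mem_set; first by rewrite subrr normr0 mulr0.
        by rewrite /U -bigcup_mkord; exists k => //=; near: n; exact: nbhs_infty_gt.
      by exists k.
    near=> n; rewrite !indicE !memNset//; first by rewrite subrr normr0 mulr0.
    by rewrite /U -bigcup_mkord => -[k _ Fk]; apply: nF; exists k.
  - move=> n; apply: aeW => x; rewrite normrM normr_id ger0_norm ?cB_ge0//.
    rewrite ler_piMr ?cB_ge0// !indicE.
    by case: (_ \in _); case: (_ \in _); rewrite /= ?subrr ?subr0 ?sub0r ?normrN ?normr1 ?normr0.
have -> : \int[mu]_x (cst 0 : V -> R) x = 0 by rewrite /Rintegral integral0.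
move=> /cvgr0_norm_le /(_ _ e0) [n _ /(_ n (leqnn n))] /= h.
exists (\1_(U n)); split; [apply: L1loc_indic; exact: (proj1 (gU n))|exact: (proj2 (gU n))|].
exact: le_trans (ler_norm _) h.
Unshelve. all: by end_near. Qed.

Lemma lebesgue_slab (i : 'I_N) (a d K : R) : 0 <= d -> 0 <= K ->
  mu [set x : V | forall j, (if j == i then `[a - d, a + d] else `[- K, K])%classic (x ord0 j)]
  = (2 * d * (2 * K) ^+ N.-1)%:E.
Proof.
move=> d0 K0; rewrite (@lebesgue_rV_box _ _ (fun j => (if j == i then `[a - d, a + d] else `[- K, K])%classic)); last first.
  by move=> j; case: ifP => _; exact: measurable_itv.
have itvE (b c : R) : b <= c -> lebesgue_measure `[b, c]%classic = (c - b)%:E.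
  move=> bc; rewrite lebesgue_measure_itv/= lte_fin; case: ltP => // cb.
  by rewrite (le_anti (introT andP (conj bc cb))) subrr.
rewrite (bigD1 i)//= eqxx itvE; last by lra.
rewrite (eq_bigr (fun=> (2 * K)%:E)); last first.
  by move=> j /negbTE ->; rewrite itvE; [congr EFin; lra|lra].
rewrite prodEFin prodr_const cardC1 card_ord -EFinM; congr EFin; congr (_ * _); lra.
Qed.

(** Inside the ball a translation by |y| <= d changes the indicator of the half-space only in a slab
    of width 2 d around its boundary, of measure O(d). *)
Lemma shift_good_ray (i : 'I_N) (a : R) : shift_good (rV_coord i @^-1` `]a, +oo[%classic).
Proof.
have mA : measurable (rV_coord i @^-1` `]a, +oo[%classic : set V).
  rewrite -[X in measurable X]setTI; apply: (measurable_rV_coord i measurableT).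
  exact: measurable_itv.
split => // K e e0.
have [K0|K0] := leP 0 K; last first.
  exists 1 => // y _; rewrite (_ : (fun _ => _) = fun=> 0); last first.
    apply/funext => x; rewrite cBE ifF ?mul0r//; apply/negbTE; rewrite -ltNge.
    exact: lt_le_trans K0 _.
  by rewrite /Rintegral integral0 ltW.
(* The slab has volume 2 d (2 K)^(N-1) <= d c; the summand 1 makes c positive in all cases. *)
pose c := 2 * (2 * K) ^+ N.-1 + 1.
have c0 : 0 < c by rewrite ltr_pwDr// mulr_ge0// exprn_ge0// mulr_ge0.
exists (e / c); first exact: divr_gt0.
move=> y ye; set d := e / c in ye; have d0 : 0 <= d by exact: le_trans ye.
pose S := [set x : V | forall j, (if j == i then `[a - d, a + d] else `[- K, K])%classic (x ord0 j)].
have mS : measurable S.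
  apply: (@measurable_box _ _ (fun j => (if j == i then `[a - d, a + d] else `[- K, K])%classic)).
  by move=> j; case: ifP => _; exact: measurable_itv.
have muS : mu S = (2 * d * (2 * K) ^+ N.-1)%:E by exact: lebesgue_slab.
have iS : itg mu (\1_S : V -> R).
  apply/itgP; split; first exact: measurable_indic.
  under eq_integral do rewrite ger0_norm ?indicE//.
  rewrite integral_indic// setIT; apply: (@le_lt_trans _ _ (mu S)); first by [].
  by rewrite muS ltry.
apply: (@le_trans _ _ (\int[mu]_x \1_S x)).
  apply: Rint_le => // [|x]; first exact/itg_diff/L1loc_indic.
  rewrite cBE; case: ifPn => [xK|_]; last by rewrite mul0r indicE.
  rewrite mul1r.
  have xj j : - K <= x ord0 j <= K.
    by rewrite -ler_norml (le_trans (coord_le_norm _ _)).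
  have yi : - d <= y ord0 i <= d.
    by rewrite -ler_norml (le_trans (coord_le_norm _ _)).
  have [Sx|nS] := pselect (S x).
    rewrite [in leRHS]indicE mem_set//= !indicE.
    by case: (_ \in _); case: (_ \in _); rewrite /= ?subrr ?subr0 ?sub0r ?normrN ?normr1 ?normr0.
  have xi : ~~ (a - d <= x ord0 i <= a + d).
    apply/negP => h; apply: nS => j; case: eqP => [->|_]; rewrite /= in_itv/=; first exact: h.
    exact: xj.
  rewrite [in leRHS]indicE memNset//= !indicE.
  have -> : (x + y \in rV_coord i @^-1` `]a, +oo[%classic) = (x \in rV_coord i @^-1` `]a, +oo[%classic).
    apply/idP/idP; rewrite !inE/= /rV_coord !in_itv/= !andbT ?mxE; lra.
  by rewrite subrr normr0.
rewrite /Rintegral integral_indic// setIT [X in fine X]muS /=.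
apply: (@le_trans _ _ (d * c)); last by rewrite /d divfK// gt_eqF.
by rewrite /c mulrDr mulr1 (mulrC 2 d) -mulrA lerDl.
Qed.

Lemma shift_good_measurable (A : set V) : measurable A -> shift_good A.
Proof.
move: A; suff : (@measurable _ V) `<=` shift_good by [].
apply: smallest_sub.
  split; first exact: shift_good0.
    by move=> A gA; rewrite setTD; exact: shift_goodC.
  exact: shift_good_bigcup.
rewrite -bigcup_seq/= => A [i /= _ [C mC <-]]; rewrite setTI.
pose S := [set C : set R | shift_good (rV_coord i @^-1` C)].
suff : (@measurable _ (measurableTypeR R)) `<=` S by apply.
rewrite RGenOInfty.measurableE; apply: smallest_sub.
  split; first by rewrite /S /= preimage_set0; exact: shift_good0.
    by move=> B gB; rewrite /S /= setTD preimage_setC; exact: shift_goodC.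
  by move=> F gF; rewrite /S /= preimage_bigcup; exact: shift_good_bigcup.
by move=> _ [a ->]; exact: shift_good_ray.
Qed.

Lemma shift_cont_sum (J : Type) (s : seq J) (F : J -> V -> R) :
  (forall j, L1loc (F j)) -> (forall j, shift_cont (F j)) ->
  L1loc (fun x => \sum_(j <- s) F j x) /\ shift_cont (fun x => \sum_(j <- s) F j x).
Proof.
move=> hF cF; elim: s => [|j s [IH1 IH2]].
  under eq_fun do rewrite big_nil; split; last exact: shift_cont_cst.
  by apply: (@L1loc_bounded _ 0) => // x; rewrite normr0.
under eq_fun do rewrite big_cons.
by split; [exact: L1locD|exact: shift_contD].
Qed.

Section simple_approximation.
Import HBNNSimple.

Lemma shift_cont_ge0 f : L1loc f -> (forall x, 0 <= f x) -> shift_cont f.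
Proof.
move=> hf f0; have [mf fi] := hf.
apply: shift_cont_approx => // K e e0.
have mfE : measurable_fun setT (EFin \o f) by exact/measurable_EFinP.
pose s := nnsfun_approx measurableT mfE; pose g n : V -> R := s n.
have gf n x : g n x <= f x.
  rewrite -lee_fin /g /s nnsfun_approxE; apply: (@le_approx _ _ _ setT (EFin \o f)) => //.
  by move=> ? _; rewrite lee_fin.
have cvg x : g n x @[n --> \oo] --> f x.
  have := @cvg_nnsfun_approx _ _ _ _ measurableT _ mfE.
  move=> /(_ (fun x _ => f0 x) x I) /fine_cvgP[_]; exact.
have : \int[mu]_x (cB K x * `|f x - g n x|) @[n --> \oo] -->
    \int[mu]_x (cst 0 : V -> R) x.
  apply: (@Rint_dct _ _ _ mu _ _ (fun x => cB K x * f x)) => //.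
  - move=> n; apply: measurable_funM; first exact: measurable_cB.
    by apply: measurableT_comp => //; apply: measurable_funB.
  - apply: aeW => x /=; rewrite -[X in _ --> X](mulr0 (cB K x)).
    apply: cvgMr; rewrite -(normr0 R) -(subrr (f x)).
    by apply: cvg_norm; apply: cvgB => //; exact: cvg_cst.
  - move=> n; apply: aeW => x; rewrite normrM normr_id ger0_norm ?cB_ge0//.
    by rewrite ler_wpM2l ?cB_ge0// ger0_norm ?subr_ge0// lerBlDr lerDl.
have -> : \int[mu]_x (cst 0 : V -> R) x = 0 by rewrite /Rintegral integral0.
move=> /cvgr0_norm_le /(_ _ e0) [n _ /(_ n (leqnn n))] /= h.
exists (g n); split; last exact: le_trans (ler_norm _) h.
  by apply: (L1loc_le _ _ hf) => // x; rewrite ger0_norm.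
have -> : g n = fun x => \sum_(y <- fset_set (range (g n))) (y * \1_(g n @^-1` [set y]) x).
  by apply/funext => x; rewrite /g [LHS]fimfunE fsbig_finite.
apply: (proj2 (shift_cont_sum _ _ _)) => y.
  by apply: L1locZ; exact: L1loc_indic.
apply: shift_contZ; first exact: L1loc_indic.
by have [] : shift_good (g n @^-1` [set y]) by exact: shift_good_measurable.
Qed.

End simple_approximation.

Lemma L1loc_shift_cont f : L1loc f -> shift_cont f.
Proof.
move=> hf; have mf := proj1 hf.
have -> : f = fun x => f^\+ x + (-1) * f^\- x.
  by apply/funext => x; rewrite mulN1r -[in LHS](funrposBneg f).
have hp : L1loc f^\+.
  apply: (L1loc_le _ _ (L1loc_norm hf)); first exact: measurable_funrpos.
  by move=> x; rewrite ger0_norm ?funrpos_ge0// /funrpos ge_max ler_norm normr_ge0.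
have hn : L1loc f^\-.
  apply: (L1loc_le _ _ (L1loc_norm hf)); first exact: measurable_funrneg.
  by move=> x; rewrite ger0_norm ?funrneg_ge0// /funrneg ge_max -normrN ler_norm normr_ge0.
apply: shift_contD => //; first exact: L1locZ.
  by apply: shift_cont_ge0 => // x; exact: funrpos_ge0.
apply: shift_contZ => //.
by apply: shift_cont_ge0 => // x; exact: funrneg_ge0.
Qed.

End translation_continuity.

(** * Pairings of a function with the translates of another *)

Section pairing.
Variables (R : realType) (N : nat).
Local Notation V := 'rV[R]_N.
Local Notation mu := (lebesgue_rV R N).
Implicit Types (f g G W : V -> R) (K M e : R) (x y z : V).

(* "bbs" stands for bounded with bounded support. *)
Definition bbs W := measurable_fun setT W /\
  exists M K, {ae mu, forall x, `|W x| <= M * cB K x}.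

(** The correlation of W with G. [TfE] rewrites it as an integral in which the translation acts on W
    instead of G. *)
Definition Tf W G y := \int[mu]_x (W x * G (x + y)).

Lemma bbs_bounded W M K : measurable_fun setT W ->
  (forall x, `|W x| <= M) -> (forall x, K < `|x| -> W x = 0) -> bbs W.
Proof.
move=> mW WM WK; split => //; exists M, K; apply: aeW => x.
rewrite cBE; case: (leP `|x| K) => [_|/WK ->]; first by rewrite mulr1.
by rewrite mulr0 normr0.
Qed.

Lemma bbs_le W : bbs W -> exists M K, [/\ 0 <= M, 0 <= K &
  {ae mu, forall x, `|W x| <= M * cB K x}].
Proof.
move=> [mW [M [K h]]]; exists `|M|, `|K|; split => //.
apply: filterS h => x h; apply: (le_trans h).
apply: (@le_trans _ _ (`|M| * cB K x)); first by rewrite ler_wpM2r ?cB_ge0// ler_norm.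
by rewrite ler_wpM2l// cB_mono// ler_norm.
Qed.

Lemma bbs_itg W : bbs W -> itg mu W.
Proof.
move=> [mW [M [K h]]]; apply: (itg_ae_le mW h); exact/itgZ/itg_cB.
Qed.

Lemma bbsD W1 W2 : bbs W1 -> bbs W2 -> bbs (fun x => W1 x + W2 x).
Proof.
move=> h1 h2; have [M1 [K1 [M10 K10 ae1]]] := bbs_le h1.
have [M2 [K2 [M20 K20 ae2]]] := bbs_le h2; case: h1 => m1 _; case: h2 => m2 _.
split; first exact: measurable_funD.
exists (M1 + M2), (Num.max K1 K2).
apply: filterS2 ae1 ae2 => x h1 h2; rewrite (le_trans (ler_normD _ _))//.
rewrite mulrDl lerD//; first apply: (le_trans h1); last apply: (le_trans h2).
  by rewrite ler_wpM2l// cB_mono// le_max lexx.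
by rewrite ler_wpM2l// cB_mono// le_max lexx orbT.
Qed.

Lemma bbsZ k W : bbs W -> bbs (fun x => k * W x).
Proof.
move=> [mW [M [K h]]]; split; first exact: measurable_funM.
exists (`|k| * M), K; apply: filterS h => x h.
by rewrite normrM -mulrA ler_wpM2l.
Qed.

Lemma bbs0 : bbs (fun=> 0).
Proof. by apply: (@bbs_bounded _ 0 0) => // x; rewrite normr0. Qed.

Lemma bbs_sum (J : Type) (s : seq J) (F : J -> V -> R) :
  (forall j, bbs (F j)) -> bbs (fun x => \sum_(j <- s) F j x).
Proof.
move=> Fi; elim: s => [|j s IH].
  by under eq_fun do rewrite big_nil; exact: bbs0.
by under eq_fun do rewrite big_cons; exact: bbsD.
Qed.

Lemma measurable_T W G y : bbs W -> L1loc G ->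
  measurable_fun setT (fun x => W x * G (x + y)).
Proof.
by move=> [mW _] [mG _]; apply: measurable_funM => //; exact: measurable_shift.
Qed.

Lemma bbs_dom W : bbs W -> exists M K, [/\ 0 <= M, 0 <= K &
  forall H, {ae mu, forall x, `|W x * H x| <= M * (cB K x * `|H x|)}].
Proof.
move=> /bbs_le[M [K [M0 K0 h]]]; exists M, K; split => // H.
by apply: filterS h => x h; rewrite normrM mulrA ler_wpM2r.
Qed.

Lemma itg_T W G y : bbs W -> L1loc G -> itg mu (fun x => W x * G (x + y)).
Proof.
move=> hW hG; have [M [K [M0 K0 h]]] := bbs_dom hW.
apply: (itg_ae_le (measurable_T y hW hG) (h (fun x => G (x + y)))).
apply: itgZ; have [_] := L1loc_norm (L1loc_shift y hG); exact.
Qed.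

Lemma itg_T0 W G : bbs W -> L1loc G -> itg mu (fun x => W x * G x).
Proof.
by move=> hW hG; have := itg_T 0 hW hG; under eq_fun do rewrite addr0.
Qed.

Lemma Tf0 W G : Tf W G 0 = \int[mu]_x (W x * G x).
Proof. by apply: eq_Rint => x; rewrite addr0. Qed.

Lemma Tf_shift W G y z : Tf W (fun x => G (x + y)) z = Tf W G (y + z).
Proof. by apply: eq_Rint => x; rewrite -addrA (addrC z). Qed.

Lemma TfDl W1 W2 G y : bbs W1 -> bbs W2 -> L1loc G ->
  Tf (fun x => W1 x + W2 x) G y = Tf W1 G y + Tf W2 G y.
Proof.
move=> h1 h2 hG; rewrite /Tf -RintD; [|exact: itg_T..].
by apply: eq_Rint => x; rewrite mulrDl.
Qed.

Lemma Tf_cont0 W G : bbs W -> L1loc G -> forall e, 0 < e -> exists2 d : R, 0 < d &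
  forall y, `|y| <= d -> `|Tf W G y - Tf W G 0| <= e.
Proof.
move=> hW hG e e0; have [M [K [M0 K0 h]]] := bbs_dom hW.
have M10 : 0 < M + 1 by rewrite ltr_pwDr.
have [d d0 hd] := L1loc_shift_cont hG K (divr_gt0 e0 M10).
exists d => // y /hd {}hd.
have hGy := L1loc_shift y hG.
rewrite Tf0 -RintB; [|exact: itg_T|exact: itg_T0].
rewrite (@eq_Rint _ _ _ _ _ (fun x => W x * (G (x + y) - G x))); last first.
  by move=> x; rewrite mulrBr.
apply: (@le_trans _ _ (\int[mu]_x (M * (cB K x * `|G (x + y) - G x|)))).
  apply: Rint_norm_ae_le; last exact: h.
    by have [] := L1locB hGy hG => m _; apply: measurable_funM => //; case: hW.
  exact/itgZ/itg_diff.
rewrite RintZ; last exact: itg_diff.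
apply: (@le_trans _ _ ((M + 1) * (e / (M + 1)))); last by rewrite mulrC divfK// gt_eqF.
apply: ler_pM => //; last by rewrite lerDl.
by apply: Rint_ge0 => x; rewrite mulr_ge0 ?cB_ge0.
Qed.

Lemma Tf_cont W G y : bbs W -> L1loc G -> forall e, 0 < e -> exists2 d : R, 0 < d &
  forall z, `|z| <= d -> `|Tf W G (y + z) - Tf W G y| <= e.
Proof.
move=> hW hG e /(Tf_cont0 hW (L1loc_shift y hG)) [d d0 h].
by exists d => // z /h; rewrite !Tf_shift addr0.
Qed.

Lemma continuousP_ed f : (forall y e, 0 < e -> exists2 d : R, 0 < d &
  forall z, `|z| <= d -> `|f (y + z) - f y| <= e) -> continuous f.
Proof.
move=> h y; apply/(cvgrPdist_le (FF := nbhs_filter y)) => e e0; have [d d0 hd] := h y e e0.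
apply/nbhs_ballP; exists d => //= z; rewrite mx_norm_ball /ball_ /= => yz.
have {}hd := hd ((z : V) - (y : V)).
suff : `|(f y : R) - f z| <= e by [].
have E : f z = f ((y : V) + ((z : V) - (y : V))) by congr f; rewrite addrC subrK.
by rewrite E distrC; apply: hd; rewrite distrC ltW.
Qed.

Lemma continuous_ed f : continuous f -> forall y e, 0 < e -> exists2 d : R, 0 < d &
  forall z, `|z| <= d -> `|f (y + z) - f y| <= e.
Proof.
move=> cf y e e0; have := cf y => /cvgrPdist_le /(_ _ e0)/nbhs_ballP[d /= d0 h].
exists (d / 2); first by rewrite divr_gt0.
move=> z zd; rewrite distrC; apply: h; rewrite mx_norm_ball /ball_ /=.
by rewrite opprD addNKr normrN (le_lt_trans zd)// ltr_pdivrMr// ltr_pMr// ltr1n.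
Qed.

Lemma Tf_continuous W G : bbs W -> L1loc G -> continuous (Tf W G).
Proof. by move=> hW hG; apply: continuousP_ed => y; exact: Tf_cont. Qed.

Lemma compact_norm_ball K : compact [set x : V | `|x| <= K].
Proof.
apply: bounded_closed_compact.
  exists K; split; first exact: num_real.
  by move=> x Kx y /= yK; rewrite (le_trans yK)// ltW.
have cn : continuous (fun x : V => `|x|) by exact: norm_continuous.
have := @closed_comp _ _ (fun x : V => `|x|) [set r | r <= K] _ _.
by apply; [move=> x _; exact: cn|exact: closed_le].
Qed.

Lemma continuous_bounded_ball f K : continuous f ->
  exists2 M : R, 0 <= M & forall x, `|x| <= K -> `|f x| <= M.
Proof.
move=> cf; have cc : compact (f @` [set x : V | `|x| <= K]).
  apply: continuous_compact; last exact: compact_norm_ball.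
  by apply: continuous_subspaceT.
have [M [_ hM]] := compact_bounded cc.
exists (`|M| + 1) => // x xK; apply: (hM (`|M| + 1)).
  by rewrite ltr_pwDr// ler_norm.
by exists x.
Qed.

Lemma continuous_L1loc f : continuous f -> L1loc f.
Proof.
move=> cf; split=> [|K]; first exact: continuous_rV_measurable.
have [M M0 h] := continuous_bounded_ball K cf.
apply: (itg_le _ _ (itgZ M (itg_cB N K))) => [|x].
  by apply: measurable_funM; [exact: measurable_cB|exact: continuous_rV_measurable].
rewrite cBE; case: ifPn => [xK|_]; last by rewrite mul0r mulr0 normr0.
by rewrite mul1r mulr1 h.
Qed.

Lemma continuous_bbs f K : continuous f -> (forall x, K < `|x| -> f x = 0) -> bbs f.
Proof.
move=> cf fK; have [M M0 h] := continuous_bounded_ball K cf.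
apply: (@bbs_bounded _ M K) => //; first exact: continuous_rV_measurable.
by move=> x; have [/h//|/fK ->] := leP `|x| K; rewrite normr0.
Qed.

Lemma measurable_add2 : measurable_fun setT (fun z : V * V => z.1 + z.2).
Proof.
apply/measurable_fun_rVP => i.
rewrite (_ : _ \o _ = fun z : V * V => rV_coord i z.1 + rV_coord i z.2); last first.
  by apply/funext => x /=; rewrite /rV_coord mxE.
apply: measurable_funD; apply: measurableT_comp => //; exact: measurable_rV_coord.
Qed.

(* Both sides are the double integral of W(x) W'(z) G(x + y + z). *)
Lemma Tf_comm W W' G y : bbs W -> bbs W' -> L1loc G ->
  Tf W (Tf W' G) y = Tf W' (Tf W G) y.
Proof.
move=> hW hW' hG; have [M [K [M0 K0 ae]]] := bbs_le hW.
have [M' [K' [M'0 K'0 ae']]] := bbs_le hW'.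
have mW := proj1 hW; have mW' := proj1 hW'; have mG := proj1 hG.
pose F (p : V * V) := W p.1 * (W' p.2 * G (p.1 + p.2 + y)).
have mF : measurable_fun setT F.
  apply: measurable_funM; first exact: measurableT_comp mW measurable_fst.
  apply: measurable_funM; first exact: measurableT_comp mW' measurable_snd.
  apply: (measurableT_comp mG); apply: (measurableT_comp (measurable_addv y)).
  exact: measurable_add2.
have iF : itg (mu \x mu)%E F.
  pose H x := cB (K + K' + `|y|) x * `|G x|.
  have iH : itg mu H by have [_] := L1loc_norm hG; apply.
  pose C := M' * \int[mu]_x H x.
  apply: (itg_prod (g := fun x => `|W x| * C)) => //.
    by under eq_fun do rewrite mulrC; apply: itgZ; apply: itg_norm; exact: bbs_itg.
  apply: filterS ae => x Wx.
  have [xK|xK] := leP `|x| K; last first.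
    move: Wx; rewrite cBE (lt_geF xK) mulr0 normr_le0 => /eqP W0.
    rewrite W0 normr0 mul0r (eq_integral (cst 0%E)) ?integral0//.
    by move=> z _; rewrite /F /= W0 mul0r normr0.
  have iW : itg mu (fun z => `|W x| * (M' * H (z + (x + y)))).
    by do 2 apply: itgZ; exact: itg_shift.
  apply: (@le_trans _ _ (\int[mu]_z (`|W x| * (M' * H (z + (x + y)))))%:E); last first.
    rewrite lee_fin RintZ; last by apply: itgZ; exact: itg_shift.
    rewrite RintZ; last exact: itg_shift.
    by rewrite (@Rint_shift _ _ H (x + y))//; exact: itg_measurable iH.
  rewrite Rint_EFin//; apply: ae_ge0_le_integral => //.
  - apply/measurable_EFinP; apply: measurableT_comp => //.
    by apply: (measurableT_comp mF); exact: measurable_pair1.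
  - move=> z _; rewrite lee_fin mulr_ge0// mulr_ge0// /H mulr_ge0// cB_ge0.
  - by apply/measurable_EFinP; exact: itg_measurable iW.
  apply: filterS ae' => z W'z _; rewrite lee_fin /F /= normrM ler_wpM2l// normrM /H.
  rewrite mulrA (_ : z + (x + y) = x + z + y); last by rewrite addrCA addrA.
  rewrite ler_wpM2r//; apply: (le_trans W'z); rewrite ler_wpM2l//.
  have -> : K + K' + `|y| = K' + (K + `|y|) by ring.
  have -> : x + z + y = z + (x + y) by rewrite (addrC x) -addrA.
  by apply: cB_shift; rewrite (le_trans (ler_normD _ _))// lerD2r.
transitivity (\int[mu]_x \int[mu]_z F (x, z)).
  apply: eq_Rint => x; rewrite /F /= RintZ; last first.
    under eq_fun do rewrite (addrC x) -addrA (addrC x); exact: itg_T.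
  by congr (_ * _); apply: eq_Rint => z; rewrite (addrC z) -!addrA (addrC y).
rewrite Rfubini//; apply: eq_Rint => z; rewrite /F /= /Tf -RintZ; last first.
  exact: itg_T.
by apply: eq_Rint => x; rewrite mulrCA -addrA.
Qed.

End pairing.

(** * Smooth functions *)

Section continuity.
Variables (T : topologicalType) (R : realType).
Implicit Types f g : T -> R.

Lemma continuous_cst (c : R) : continuous (fun _ : T => c).
Proof. by move=> x; exact: cvg_cst. Qed.

Lemma continuous_add f g : continuous f -> continuous g -> continuous (fun x => f x + g x).
Proof. by move=> cf cg x; apply: cvgD; [exact: cf|exact: cg]. Qed.

Lemma continuous_mul f g : continuous f -> continuous g -> continuous (fun x => f x * g x).
Proof. by move=> cf cg x; apply: cvgM; [exact: cf|exact: cg]. Qed.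

Lemma continuous_chi (chi : R -> R) f :
  continuous chi -> continuous f -> continuous (fun x => chi (f x)).
Proof. by move=> cc cf x; apply: continuous_comp; [exact: cf|exact: cc]. Qed.

End continuity.

(** * Directional derivatives and the mean value theorem along lines *)

Section directional_derivative.
Variables (R : realType) (U : normedModType R).
Implicit Types (f : U -> R) (x v : U).

(** The difference quotient is cleared of its denominator, so that h = 0 needs no separate treatment
    in the estimates. *)
Lemma is_derive_ed f x v l :
  (forall e : R, 0 < e -> exists2 d : R, 0 < d &
    forall h : R, `|h| <= d -> `|f (x + h *: v) - f x - h * l| <= e * `|h|) ->
  is_derive x v f l.
Proof.
move=> H.
have cv : (fun h : R => h^-1 *: ((f \o shift x) (h *: v) - f x)) @ 0^' --> l.
  apply/cvgrPdist_le => e e0; have [d d0 hd] := H e e0.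
  near=> h; have h0 : h != 0 by near: h; exact: nbhs_dnbhs_neq.
  have hd' : `|h| <= d.
    near: h; apply: dnbhs0_le; exact: d0.
  have := hd h hd'; rewrite /= /shift/= [_ + x]addrC distrC => K.
  rewrite -(ler_pM2r (_ : 0 < `|h|)) ?normr_gt0// -normrM.
  rewrite mulrBl -[_ *: _]/(h^-1 * _) mulrAC mulVf// mul1r (mulrC l).
  by rewrite distrC; rewrite distrC in K.
apply: DeriveDef; first by apply/cvg_ex; exists l.
exact/cvg_lim.
Unshelve. all: by end_near. Qed.

Lemma is_derive_ex_ed f x v l : is_derive x v f l ->
  (forall e : R, 0 < e -> exists2 d : R, 0 < d &
    forall h : R, `|h| <= d -> `|f (x + h *: v) - f x - h * l| <= e * `|h|).
Proof.
move=> [/cvg_ex[m cv] <-] e e0.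
have -> : 'D_v f x = m by exact/cvg_lim.
move/cvgrPdist_le : cv => /(_ _ e0).
rewrite /dnbhs near_withinE => /nbhs_ballP[d /= d0 hd].
exists (d / 2); first by rewrite divr_gt0.
move=> h hd2; have [->|h0] := eqVneq h 0.
  by rewrite scale0r addr0 subrr mul0r subr0 normr0 mulr0.
have /hd /(_ h0) : ball (0 : R) d h.
  by rewrite /ball/= sub0r normrN (le_lt_trans hd2)// ltr_pdivrMr// ltr_pMr// ltr1n.
rewrite /= /shift/= [_ + x]addrC => K.
rewrite -(ler_pM2r (_ : 0 < `|h|)) ?normr_gt0// -normrM in K.
rewrite mulrBl -[_ *: _]/(h^-1 * _) mulrAC mulVf// mul1r (mulrC m) in K.
by rewrite distrC.
Qed.

End directional_derivative.

Section derivative_along_lines.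
Variables (R : realType) (U : normedModType R).
Implicit Types (f : U -> R) (x v : U).

Lemma is_derive_line f x v (t l : R) :
  is_derive (x + t *: v) v f l <-> is_derive t 1 (fun s : R => f (x + s *: v)) l.
Proof.
split=> H0.
  have H := @is_derive_ex_ed _ _ _ _ _ _ H0.
  apply: is_derive_ed => e /H[d d0 hd].
  by exists d => // h /hd; rewrite scalerDl addrA [h *: 1]mulr1.
have H := @is_derive_ex_ed _ _ _ _ _ _ H0.
apply: is_derive_ed => e /H[d d0 hd].
by exists d => // h /hd; rewrite scalerDl addrA [h *: 1]mulr1.
Qed.

Lemma is_derive_comp (chi : R -> R) f x v (l m : R) :
  is_derive (f x) 1 chi m -> is_derive x v f l ->
  is_derive x v (fun y => chi (f y)) (m * l).
Proof.
move=> Hc Hf; rewrite -(addr0 x) -(scale0r v); apply/is_derive_line.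
have Hf' : is_derive (0 : R) 1 (fun s : R => f (x + s *: v)) l.
  by apply/is_derive_line; rewrite scale0r addr0.
have Hc' : is_derive (f (x + (0 : R) *: v)) 1 chi m by rewrite scale0r addr0.
apply: DeriveDef.
  have d1 := @ex_derive _ _ _ _ _ _ _ Hf'; have d2 := @ex_derive _ _ _ _ _ _ _ Hc'.
  apply/derivable1_diffP; apply: differentiable_comp; exact/derivable1_diffP.
rewrite -derive1E (@derive1_comp _ (fun s : R => f (x + s *: v)) chi 0).
- by rewrite !derive1E (@derive_val _ _ _ _ _ _ _ Hc') (@derive_val _ _ _ _ _ _ _ Hf').
- exact: (@ex_derive _ _ _ _ _ _ _ Hf').
- exact: (@ex_derive _ _ _ _ _ _ _ Hc').
Qed.

Lemma is_derive_mul f g x v (l m : R) : is_derive x v f l -> is_derive x v g m ->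
  is_derive x v (fun y => f y * g y) (f x * m + g x * l).
Proof. by move=> Hf Hg; exact: is_deriveM. Qed.

Lemma is_derive_add f g x v (l m : R) : is_derive x v f l -> is_derive x v g m ->
  is_derive x v (fun y => f y + g y) (l + m).
Proof. by move=> Hf Hg; exact: is_deriveD. Qed.

Lemma is_derive_cast f x v l m : is_derive x v f l -> l = m -> is_derive x v f m.
Proof. by move=> H <-. Qed.

Lemma is_derive_uniq f x v l m : is_derive x v f l -> is_derive x v f m -> l = m.
Proof. by move=> [_ <-] [_ <-]. Qed.

Lemma mvt_line f df x v (h : R) :
  (forall s, is_derive (x + s *: v) v f (df s)) ->
  exists2 s : R, `|s| <= `|h| & f (x + h *: v) - f x = h * df s.
Proof.
move=> H.
have H1 (s : R) : is_derive s 1 (fun s : R => f (x + s *: v)) (df s) by apply/is_derive_line.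
have cf : continuous (fun s : R => f (x + s *: v)).
  move=> s; apply/differentiable_continuous/derivable1_diffP.
  exact: (@ex_derive _ _ _ _ _ _ _ (H1 s)).
have [h0|h0|->] := ltgtP h 0; last first.
- exists 0; rewrite ?normr0// scale0r addr0 subrr mul0r//.
- have [|s sh] := @MVT _ (fun s : R => f (x + s *: v)) df 0 h h0 (fun s _ => H1 s).
    by apply: continuous_subspaceT.
  rewrite scale0r addr0 subr0 mulrC => E; exists s => //.
  move: sh; rewrite in_itv/= => /andP[s0 sh].
  by rewrite !gtr0_norm// ltW.
- have [|s sh] := @MVT _ (fun s : R => f (x + s *: v)) df h 0 h0 (fun s _ => H1 s).
    by apply: continuous_subspaceT.
  rewrite scale0r addr0 sub0r mulrN => E; exists s => //.
    move: sh; rewrite in_itv/= => /andP[hs s0].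
    by rewrite !ltr0_norm// lerN2 ltW.
  by apply: oppr_inj; rewrite opprB E mulrC.
Qed.

End derivative_along_lines.

(** * Closure properties of smooth functions *)

Section smooth_closure.
Variables (R : realType) (N : nat).
Local Notation V := 'rV[R]_N.
Local Notation ei i := (delta_mx ord0 i : V).
Implicit Types (f g : V -> R) (k : nat).

(** Smoothness of finite order, recursive in the innermost derivative. Unlike [smooth], it allows an
    induction on k for products and compositions; [smoothP] relates the two. *)
Fixpoint Ck k f : Prop := continuous f /\
  if k is k'.+1 then
    forall i, (forall x, derivable f x (ei i)) /\ Ck k' (pderiv i f)
  else True.

Lemma pderivP f i x : derivable f x (ei i) -> is_derive x (ei i) f (pderiv i f x).
Proof. exact: derivableP. Qed.

Lemma pderiv_fun f df i : (forall x, is_derive x (ei i) f (df x)) -> pderiv i f = df.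
Proof. by move=> H; apply/funext => x; have [] := H x. Qed.

Lemma pderivs_rcons s i f : pderivs (rcons s i) f = pderivs s (pderiv i f).
Proof. by rewrite /pderivs foldr_rcons. Qed.

Lemma CkP k f df : continuous f ->
  (forall i x, is_derive x (ei i) f (df i x)) -> (forall i, Ck k (df i)) -> Ck k.+1 f.
Proof.
move=> cf df_ ckdf; split => // i; split=> [x|]; first by have [] := df_ i x.
by rewrite (pderiv_fun (df_ i)).
Qed.

Lemma CkSP k f : Ck k.+1 f -> [/\ continuous f,
  forall i x, is_derive x (ei i) f (pderiv i f x) & forall i, Ck k (pderiv i f)].
Proof.
move=> [cf H]; split => // i; last exact: (H i).2.
by move=> x; apply: pderivP; exact: (H i).1.
Qed.

Lemma Ck_continuous k f : Ck k f -> continuous f.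
Proof. by case: k => [|k] []. Qed.

Lemma CkW k f : Ck k.+1 f -> Ck k f.
Proof.
elim: k f => [|k IH] f; first by move=> /Ck_continuous.
move=> /CkSP[cf df ckf]; apply: (CkP cf df) => i; exact: IH.
Qed.

Lemma smoothP f : smooth f <-> forall k, Ck k f.
Proof.
split=> [sf k|H].
  elim: k f sf => [|k IH] f sf; first by split => //; have [] := sf [::].
  split=> [|i]; first by have [] := sf [::].
  split; first by have [_] := sf [::]; apply.
  by apply: IH => s; rewrite -pderivs_rcons.
move=> s; elim/last_ind : s f H => [|s i IH] f H /=.
  split; first exact: Ck_continuous (H 0%N).
  by move=> i; have [_ h] := H 1%N; have [] := h i.
by rewrite pderivs_rcons; apply: IH => k; have [_ h] := H k.+1; have [] := h i.
Qed.

Lemma smooth_continuous f : smooth f -> continuous f.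
Proof. by move=> /smoothP /(_ 0%N)[]. Qed.

Lemma smooth_pderiv f i : smooth f -> smooth (pderiv i f).
Proof. by move=> sf s; rewrite -pderivs_rcons. Qed.

Lemma smooth_pderivs f s : smooth f -> smooth (pderivs s f).
Proof.
move=> sf; elim: s => [//|i s IH]; exact: smooth_pderiv.
Qed.

Lemma smooth_is_derive f i x : smooth f -> is_derive x (ei i) f (pderiv i f x).
Proof. by move=> /smoothP /(_ 1%N) /CkSP[_]. Qed.

Lemma Ck_cst k (c : R) : Ck k (fun=> c).
Proof.
elim: k c => [|k IH] c; first by split => //; exact: continuous_cst.
apply: (@CkP _ _ (fun _ _ => 0)) => //; exact: continuous_cst.
Qed.

Lemma CkD k f g : Ck k f -> Ck k g -> Ck k (fun x => f x + g x).
Proof.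
elim: k f g => [|k IH] f g.
  by move=> [cf _] [cg _]; split => //; exact: continuous_add.
move=> /CkSP[cf df hf] /CkSP[cg dg hg].
apply: (@CkP _ _ (fun i x => pderiv i f x + pderiv i g x)).
- exact: continuous_add.
- by move=> i; apply: IH.
Qed.

Lemma CkM k f g : Ck k f -> Ck k g -> Ck k (fun x => f x * g x).
Proof.
elim: k f g => [|k IH] f g.
  by move=> [cf _] [cg _]; split => //; exact: continuous_mul.
move=> hf hg; have hf0 := CkW hf; have hg0 := CkW hg.
move: hf hg => /CkSP[cf df hf] /CkSP[cg dg hg].
apply: (@CkP _ _ (fun i x => f x * pderiv i g x + g x * pderiv i f x)).
- exact: continuous_mul.
- by move=> i; apply: CkD; exact: IH.
Qed.

Lemma continuous_coord i : continuous (fun x : V => x ord0 i).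
Proof. exact: coord_continuous. Qed.

Lemma is_derive_coord i j x :
  is_derive x (ei j) (fun x : V => x ord0 i) (j == i)%:R.
Proof.
apply: is_derive_ed => e e0; exists 1 => // h _.
rewrite !mxE eqxx /= eq_sym (addrC (x ord0 i)) addrK subrr normr0.
by rewrite mulr_ge0// ltW.
Qed.

Lemma Ck_coord k i : Ck k (fun x : V => x ord0 i).
Proof.
case: k => [|k]; first by split => //; exact: continuous_coord.
apply: (@CkP _ _ (fun j _ => (j == i)%:R)).
- exact: continuous_coord.
- move=> j x; exact: is_derive_coord.
- move=> j; exact: Ck_cst.
Qed.

Lemma smooth_cst (c : R) : smooth (fun _ : V => c).
Proof. by apply/smoothP => k; exact: Ck_cst. Qed.

Lemma smooth_coord i : smooth (fun x : V => x ord0 i).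
Proof. by apply/smoothP => k; exact: Ck_coord. Qed.

Lemma smoothD f g : smooth f -> smooth g -> smooth (fun x => f x + g x).
Proof. by move=> /smoothP hf /smoothP hg; apply/smoothP => k; exact: CkD. Qed.

Lemma smoothM f g : smooth f -> smooth g -> smooth (fun x => f x * g x).
Proof. by move=> /smoothP hf /smoothP hg; apply/smoothP => k; exact: CkM. Qed.

Lemma smoothZ c f : smooth f -> smooth (fun x => c * f x).
Proof. by move=> sf; exact: (smoothM (smooth_cst c) sf). Qed.

Lemma smoothB f g : smooth f -> smooth g -> smooth (fun x => f x - g x).
Proof.
move=> sf sg; under eq_fun do rewrite -[X in _ + X]mulN1r.
exact: (smoothD sf (smoothZ (-1) sg)).
Qed.

Lemma smooth_sum (J : Type) (s : seq J) (F : J -> V -> R) :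
  (forall j, smooth (F j)) -> smooth (fun x => \sum_(j <- s) F j x).
Proof.
move=> Fi; elim: s => [|j s IH].
  by under eq_fun do rewrite big_nil; exact: smooth_cst.
by under eq_fun do rewrite big_cons; exact: (smoothD (Fi j) IH).
Qed.

Lemma pderivM f g i : smooth f -> smooth g ->
  pderiv i (fun x => f x * g x) = fun x => f x * pderiv i g x + g x * pderiv i f x.
Proof.
by move=> sf sg; apply: pderiv_fun => x; apply: is_derive_mul; exact: smooth_is_derive.
Qed.

Lemma pderivD f g i : smooth f -> smooth g ->
  pderiv i (fun x => f x + g x) = fun x => pderiv i f x + pderiv i g x.
Proof.
by move=> sf sg; apply: pderiv_fun => x; apply: is_derive_add; exact: smooth_is_derive.
Qed.

(** Order 0 asks for nothing, not even continuity, which is recovered from order 1; hence the shift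
    by one in [Ck_comp]. *)
Fixpoint D1k k (chi : R -> R) : Prop :=
  if k is k'.+1 then
    exists2 chi', (forall t : R, is_derive t 1 chi (chi' t)) & D1k k' chi'
  else True.

Definition smooth1 chi := forall k, D1k k chi.

Lemma D1k_continuous k chi : D1k k.+1 chi -> continuous chi.
Proof.
move=> [chi' H _] t; apply/differentiable_continuous/derivable1_diffP.
exact: (@ex_derive _ _ _ _ _ _ _ (H t)).
Qed.

Lemma D1kW k chi : D1k k.+1 chi -> D1k k chi.
Proof.
elim: k chi => [//|k IH] chi [chi' H /IH h]; by exists chi'.
Qed.

Lemma Ck_comp k chi f : D1k k.+1 chi -> Ck k f -> Ck k (fun x => chi (f x)).
Proof.
elim: k chi f => [|k IH] chi f hc hf.
  split => //; apply: continuous_chi; last exact: (Ck_continuous hf).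
  exact: D1k_continuous hc.
have cchi := D1k_continuous hc.
have hf0 := CkW hf; move: hf => /CkSP[cf df hf].
case: hc => chi' dchi hchi'.
apply: (@CkP _ _ (fun i x => chi' (f x) * pderiv i f x)).
- exact: continuous_chi.
- by move=> i x; exact: is_derive_comp.
- by move=> i; apply: CkM => //; exact: IH.
Qed.

Lemma smooth_comp chi f : smooth1 chi -> smooth f -> smooth (fun x => chi (f x)).
Proof.
move=> sc /smoothP sf; apply/smoothP => k; apply: Ck_comp => //; exact: sc.
Qed.

(** The witnesses hidden in [D1k k] for different k agree by uniqueness of derivatives. *)
Lemma smooth1_deriv chi : smooth1 chi ->
  exists2 chi', (forall t : R, is_derive t 1 chi (chi' t)) & smooth1 chi'.
Proof.
move=> sc; have [chi' h _] := sc 1%N; exists chi' => // k.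
have [c2 h2 h3] := sc k.+1.
suff -> : chi' = c2 by [].
by apply/funext => t; exact: is_derive_uniq (h t) (h2 t).
Qed.

Lemma smooth1_continuous chi : smooth1 chi -> continuous chi.
Proof. by move=> /(_ 1%N); exact: D1k_continuous. Qed.

End smooth_closure.

Section smooth_one_variable.
Variable R : realType.
Implicit Types (f g : R -> R) (k : nat).

Lemma D1k_cst k (c : R) : D1k k (fun=> c).
Proof.
elim: k c => [//|k IH] c; exists (fun=> 0) => // t; exact: is_derive_cst.
Qed.

Lemma D1kD k f g : D1k k f -> D1k k g -> D1k k (fun x => f x + g x).
Proof.
elim: k f g => [//|k IH] f g [f' df hf] [g' dg hg].
exists (fun x => f' x + g' x); last exact: IH.
by move=> t; exact: is_derive_add.
Qed.

Lemma D1kM k f g : D1k k f -> D1k k g -> D1k k (fun x => f x * g x).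
Proof.
elim: k f g => [//|k IH] f g hf hg; have hf0 := D1kW hf; have hg0 := D1kW hg.
case: hf => f' df hf; case: hg => g' dg hg.
exists (fun x => f x * g' x + g x * f' x); last by apply: D1kD; exact: IH.
by move=> t; exact: is_derive_mul.
Qed.

Lemma D1k_affine k (a b : R) : D1k k (fun t => a * t + b).
Proof.
case: k => [//|k]; exists (fun=> a); last exact: D1k_cst.
move=> t; apply: is_derive_ed => e e0; exists 1 => // h _.
rewrite [h *: _]mulr1 (_ : _ - _ = 0) ?normr0 ?mulr_ge0// ?ltW//.
ring.
Qed.

Lemma D1k_comp k f g : D1k k f -> D1k k g -> D1k k (fun x => g (f x)).
Proof.
elim: k f g => [//|k IH] f g hf [g' dg hg]; have hf0 := D1kW hf.
case: hf => f' df hf.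
exists (fun x => g' (f x) * f' x); last by apply: D1kM => //; exact: IH.
by move=> t; exact: is_derive_comp.
Qed.

Lemma D1k_inv k f : (forall t, f t != 0) -> D1k k f -> D1k k (fun t => (f t)^-1).
Proof.
move=> f0; elim: k => [//|k IH] hf; have h := IH (D1kW hf).
case: hf => f' df hf.
exists (fun t => -1 * ((f t)^-1 * (f t)^-1) * f' t).
  move=> t; have [df1 <-] := df t.
  apply: DeriveDef; first exact: derivableV.
  rewrite [LHS](deriveV (f0 t) df1) -exprVn expr2 mulN1r mulNr.
  by rewrite scaleNr.
apply: D1kM => //; apply: D1kM; first exact: D1k_cst.
exact: D1kM.
Qed.

End smooth_one_variable.

(** * Cutoffs, test functions and mollifiers *)

Section flat_functions.
Variable R : realType.
Implicit Types (t : R) (n k : nat).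

(* t^-n exp(-1/t), a family whose derivatives stay in its linear span. *)
Definition flat n t : R := if 0 < t then t^-1 ^+ n * expR (- t^-1) else 0.

Lemma flat_ge0 n t : 0 <= flat n t.
Proof.
by rewrite /flat; case: ifPn => // t0; rewrite mulr_ge0 ?expR_ge0// exprn_ge0// invr_ge0 ltW.
Qed.

(** The bound exp(s) >= (s / (n + 1))^(n + 1) at s = 1 / t beats the factor t^-n with one power of t
    to spare. *)
Lemma flat_le n t : 0 < t -> flat n t <= n.+1%:R ^+ n.+1 * t.
Proof.
move=> t0; rewrite /flat t0.
have tV0 : 0 < t^-1 by rewrite invr_gt0.
have n0 : (0 : R) < n.+1%:R by [].
have h : (t^-1 / n.+1%:R) ^+ n.+1 <= expR (t^-1).
  have -> : expR (t^-1) = expR (t^-1 / n.+1%:R) ^+ n.+1.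
    by rewrite -expRM_natl mulrC divfK// gt_eqF.
  rewrite lerXn2r ?nnegrE ?expR_ge0//; first by rewrite divr_ge0// ltW.
  by rewrite (le_trans _ (expR_ge1Dx _))// lerDr.
rewrite expRN -[leRHS](mulfK (_ : expR (t^-1) != 0)) ?gt_eqF ?expR_gt0// ler_wpM2r ?invr_ge0 ?expR_ge0//.
apply: (@le_trans _ _ (n.+1%:R ^+ n.+1 * t * (t^-1 / n.+1%:R) ^+ n.+1)); last first.
  by rewrite ler_wpM2l// mulr_ge0 ?exprn_ge0// ltW.
rewrite exprMn (exprVn n.+1%:R) [X in _ <= _ * X]mulrC mulrACA mulfV ?expf_neq0 ?gt_eqF// mul1r.
by rewrite exprS mulrA mulfV ?gt_eqF// mul1r.
Qed.

Lemma is_derive_inv1 t : t != 0 -> is_derive t 1 (fun x : R => x^-1) (- (t^-1 ^+ 2)).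
Proof.
move=> t0; apply: DeriveDef.
  by apply: derivableV => //; exact: derivable_id.
by rewrite deriveV// ?derive_id exprVn [_ *: _]mulr1.
Qed.

Lemma is_derive_flat_gt0 n t : 0 < t ->
  is_derive t 1 (flat n) (- n%:R * flat n.+1 t + flat n.+2 t).
Proof.
move=> t0; apply: (@near_eq_is_derive _ _ _ (fun t => t^-1 ^+ n * expR (- t^-1))).
  by have := open_nbhs_nbhs (conj (@open_gt R 0) t0); apply: filterS => s /= s0; rewrite /flat s0.
have tn0 : t != 0 by rewrite gt_eqF.
have hV := is_derive_inv1 tn0.
have hN : is_derive t 1 (fun x : R => - x^-1) (t^-1 ^+ 2).
  by have := is_deriveN hV; rewrite opprK.
have hE : is_derive t 1 (fun x : R => expR (- x^-1)) (expR (- t^-1) * t^-1 ^+ 2).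
  by apply: (is_derive_comp (chi := expR)) => //; exact: is_derive_expR.
have hX m : is_derive t 1 (fun x : R => x^-1 ^+ m) (- m%:R * t^-1 ^+ m.+1).
  elim: m => [|m IH]; first by rewrite oppr0 mul0r; exact: is_derive_cst.
  under eq_fun do rewrite exprS.
  apply: is_derive_cast (is_derive_mul hV IH) _.
  rewrite !exprS -natr1; ring.
apply: is_derive_cast (is_derive_mul (hX n) hE) _.
rewrite /flat t0 !exprS; ring.
Unshelve. all: by end_near. Qed.

Lemma is_derive_flat n t : is_derive t 1 (flat n) (- n%:R * flat n.+1 t + flat n.+2 t).
Proof.
have [t0|t0|<-] := ltgtP 0 t; first exact: is_derive_flat_gt0.
  rewrite {2 3}/flat !(lt_gtF t0) mulr0 addr0.
  have H : is_derive t 1 (fun _ : R => 0 : R) 0 by exact: is_derive_cst.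
  apply: near_eq_is_derive H.
  have := open_nbhs_nbhs (conj (@open_lt R 0) t0); apply: filterS => s /= s0.
  by rewrite /flat (lt_gtF s0).
have z m : flat m 0 = 0 by rewrite /flat ltxx.
(* At the origin: for h > 0, [flat n h] is h times [flat n.+1 h], and the second factor is O(h) by
   [flat_le]. *)
rewrite !z mulr0 addr0; apply: is_derive_ed => e e0.
pose C : R := n.+2%:R ^+ n.+2; have C0 : 0 < C by rewrite exprn_gt0.
exists (e / C); first exact: divr_gt0.
move=> h he; rewrite add0r [h *: _]mulr1 mulr0 subr0 [X in _ - X](z n) subr0.
have [h0|h0] := ltP 0 h; last by rewrite /flat ltNge h0/= normr0 mulr_ge0// ltW.
rewrite ger0_norm ?flat_ge0// (gtr0_norm h0); rewrite (gtr0_norm h0) in he.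
have -> : flat n h = h * flat n.+1 h.
  by rewrite /flat h0 exprS !mulrA mulfV ?gt_eqF// mul1r.
rewrite mulrC; apply: ler_wpM2r; first exact: ltW.
apply: (le_trans (flat_le n.+1 h0)).
by rewrite -/C mulrC -ler_pdivlMr.
Unshelve. all: by end_near. Qed.

Lemma smooth1_flat n : smooth1 (flat n).
Proof.
move=> k; elim: k n => [//|k IH] n.
exists (fun t => - n%:R * flat n.+1 t + flat n.+2 t) => [t|]; first exact: is_derive_flat.
by apply: D1kD => //; apply: D1kM => //; exact: D1k_cst.
Qed.

Lemma flat0_gt0 t : 0 < t -> 0 < flat 0 t.
Proof. by move=> t0; rewrite /flat t0 expr0 mul1r expR_gt0. Qed.

Lemma flat_le0 n t : t <= 0 -> flat n t = 0.
Proof. by move=> t0; rewrite /flat ltNge t0. Qed.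

(** The standard smooth step, equal to 1 up to t = 1 and to 0 from t = 2 on; the two summands of the
    denominator never vanish together. *)
Definition cutoff t := flat 0 (2 - t) / (flat 0 (2 - t) + flat 0 (t - 1)).

Lemma cutoff_den_gt0 t : 0 < flat 0 (2 - t) + flat 0 (t - 1).
Proof.
have [t2|t2] := ltP t 2; first by rewrite ltr_pwDl ?flat_ge0// flat0_gt0// subr_gt0.
rewrite ltr_pwDr ?flat_ge0// flat0_gt0// subr_gt0 (lt_le_trans _ t2)//.
exact: (ltr1n R 2).
Qed.

Lemma smooth1_cutoff : smooth1 cutoff.
Proof.
have h1 : smooth1 (fun t => flat 0 (2 - t)).
  move=> k; apply: (D1k_comp (f := fun t => 2 - t)); last exact: smooth1_flat.
  by have := D1k_affine k (-1 : R) 2; under eq_fun do rewrite mulN1r addrC.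
have h2 : smooth1 (fun t => flat 0 (t - 1)).
  move=> k; apply: (D1k_comp (f := fun t => t - 1)); last exact: smooth1_flat.
  by have := D1k_affine k (1 : R) (-1); under eq_fun do rewrite mul1r.
move=> k; apply: D1kM; first exact: h1.
by apply: D1k_inv => [t|]; [rewrite gt_eqF// cutoff_den_gt0|exact: D1kD].
Qed.

Lemma cutoff_le1E t : t <= 1 -> cutoff t = 1.
Proof.
move=> t1; rewrite /cutoff (flat_le0 0 (t := t - 1)) ?subr_le0// addr0 divff// gt_eqF//.
by rewrite flat0_gt0// subr_gt0 (le_lt_trans t1)// ltr1n.
Qed.

Lemma cutoff_ge2E t : 2 <= t -> cutoff t = 0.
Proof. by move=> t2; rewrite /cutoff (flat_le0 0 (t := 2 - t)) ?subr_le0// mul0r. Qed.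

Lemma cutoff_ge0 t : 0 <= cutoff t.
Proof. by rewrite divr_ge0 ?flat_ge0// ltW// cutoff_den_gt0. Qed.

Lemma cutoff_le1 t : cutoff t <= 1.
Proof. by rewrite ler_pdivrMr ?cutoff_den_gt0// mul1r lerDl flat_ge0. Qed.

Lemma is_derive_locally_cst (f : R -> R) t l c (A : set R) : open A -> A t ->
  (forall s, A s -> f s = c) -> is_derive t 1 f l -> l = 0.
Proof.
move=> oA At fc H; apply: (is_derive_uniq H).
have H0 : is_derive t 1 (fun _ : R => c) 0 by exact: is_derive_cst.
apply: near_eq_is_derive H0.
by have := open_nbhs_nbhs (conj oA At); apply: filterS => s /fc.
Qed.

(** Off [1, 2] the cutoff is locally constant, so both derivatives vanish there; on [1, 2] they are
    bounded by compactness. *)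
Lemma cutoff_derivatives : exists c1 c2 : R -> R, exists C : R, [/\ 0 <= C,
  (forall t, is_derive t 1 cutoff (c1 t)), (forall t, is_derive t 1 c1 (c2 t)),
  smooth1 c2 &
  forall t, `|c1 t| <= C /\ `|c2 t| <= C /\ (~~ (1 <= t <= 2) -> c1 t = 0 /\ c2 t = 0)].
Proof.
have [c1 d1 s1] := smooth1_deriv smooth1_cutoff.
have [c2 d2 s2] := smooth1_deriv s1.
have c10 t : ~~ (1 <= t <= 2) -> c1 t = 0.
  rewrite negb_and -!ltNge => /orP[t1|t2].
    apply: (@is_derive_locally_cst cutoff t (c1 t) 1 [set s | s < 1]) => //.
    by move=> s /= s1'; rewrite cutoff_le1E// ltW.
  apply: (@is_derive_locally_cst cutoff t (c1 t) 0 [set s | 2 < s]) => //.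
  by move=> s /= s1'; rewrite cutoff_ge2E// ltW.
have c20 t : ~~ (1 <= t <= 2) -> c2 t = 0.
  rewrite negb_and -!ltNge => /orP[t1|t2].
    apply: (@is_derive_locally_cst c1 t (c2 t) 0 [set s | s < 1]) => //.
    by move=> s /= s1'; apply: c10; rewrite negb_and -!ltNge s1'.
  apply: (@is_derive_locally_cst c1 t (c2 t) 0 [set s | 2 < s]) => //.
  by move=> s /= s1'; apply: c10; rewrite negb_and -!ltNge s1' orbT.
have bnd (c : R -> R) : smooth1 c -> (forall t, ~~ (1 <= t <= 2) -> c t = 0) ->
    exists2 C, 0 <= C & forall t, `|c t| <= C.
  move=> sc c0; have cc := smooth1_continuous sc.
  have : compact (c @` `[1, 2]%classic).
    by apply: continuous_compact; [exact: continuous_subspaceT|exact: segment_compact].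
  move/compact_bounded => [M [_ hM]]; exists (`|M| + 1) => // t.
  have [t12|/c0 ->] := boolP (1 <= t <= 2); last by rewrite normr0.
  by apply: (hM (`|M| + 1)); [rewrite ltr_pwDr// ler_norm|exists t => //=; rewrite in_itv].
have [C1 C10 h1] := bnd _ s1 c10; have [C2 C20 h2] := bnd _ s2 c20.
exists c1, c2, (Num.max C1 C2); split => //; first by rewrite le_max C10.
move=> t; split; first by rewrite le_max h1.
split; first by rewrite le_max h2 orbT.
by move=> ht; rewrite c10// c20.
Qed.

End flat_functions.

Section test_functions.
Variables (R : realType) (N : nat).
Local Notation V := 'rV[R]_N.
Local Notation ei i := (delta_mx ord0 i : V).
Local Notation mu := (lebesgue_rV R N).
Implicit Types (f g phi : V -> R) (K : R) (x y z : V).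

(** The squared Euclidean norm. It is smooth at the origin too, which is why all radial functions
    below are written in this variable. *)
Definition sqn x : R := \sum_i x ord0 i ^+ 2.

Lemma smooth_sqn : smooth sqn.
Proof.
apply: (@smooth_sum R N _ _ (fun i (x : V) => x ord0 i ^+ 2)) => i.
rewrite (_ : (fun x : V => _) = fun x : V => x ord0 i * x ord0 i).
  exact: (smoothM (smooth_coord R i) (smooth_coord R i)).
by apply/funext => x; rewrite expr2.
Qed.

Lemma sqn_ge0 x : 0 <= sqn x.
Proof. by apply: sumr_ge0 => i _; rewrite sqr_ge0. Qed.

Lemma norm2_le_sqn x : `|x| ^+ 2 <= sqn x.
Proof.
have : `|x| <= Num.sqrt (sqn x).
  apply/norm_rV_le; first exact: sqrtr_ge0.
  move=> i; rewrite -sqrtr_sqr ler_wsqrtr// /sqn (bigD1 i)//= lerDl.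
  by apply: sumr_ge0 => j _; rewrite sqr_ge0.
by move=> h; rewrite -(sqr_sqrtr (sqn_ge0 x)) lerXn2r ?nnegrE ?sqrtr_ge0.
Qed.

Lemma sqn_le x : sqn x <= N%:R * `|x| ^+ 2.
Proof.
rewrite /sqn (le_trans (ler_sum _ (G := fun=> `|x| ^+ 2) _))//.
  by move=> i _; rewrite -[leLHS]real_normK ?num_real// lerXn2r ?nnegrE// coord_le_norm.
by rewrite sumr_const card_ord mulr_natl.
Qed.

Lemma enorm_sqn x : enorm x = Num.sqrt (sqn x).
Proof. by rewrite /enorm big_ord1. Qed.

Definition tf phi := smooth phi /\ exists K, forall x, K < `|x| -> phi x = 0.

Lemma pderiv_eq0_open phi (A : set V) i x : open A -> A x ->
  (forall y, A y -> phi y = 0) -> pderiv i phi x = 0.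
Proof.
move=> oA Ax h; rewrite /pderiv.
rewrite (@near_eq_derive _ _ _ phi (fun=> 0)); first exact: derive_cst.
by have := open_nbhs_nbhs (conj oA Ax); apply: filterS => y /h.
Qed.

Lemma open_norm_gt K : open [set x : V | K < `|x|].
Proof.
have := @open_comp _ _ (fun x : V => `|x|) [set r | K < r] _ _.
by apply; [move=> x _; exact: norm_continuous|exact: open_gt].
Qed.

Lemma pderivs_eq0_open phi (A : set V) s x : open A -> A x ->
  (forall y, A y -> phi y = 0) -> pderivs s phi x = 0.
Proof.
move=> oA + h; elim: s x => [|i s IH] x Ax; first exact: h.
exact: (pderiv_eq0_open i oA Ax).
Qed.

Lemma tf_pderivs s phi : tf phi -> tf (pderivs s phi).
Proof.
move=> [sp [K h]]; split; first exact: smooth_pderivs.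
exists K => x xK; have := (@pderivs_eq0_open phi [set x : V | K < `|x|] s x (@open_norm_gt K) xK).
by apply.
Qed.

Lemma tf_pderiv i phi : tf phi -> tf (pderiv i phi).
Proof. exact: (@tf_pderivs [:: i]). Qed.

Lemma tf_bbs phi : tf phi -> bbs phi.
Proof.
by move=> [sp [K h]]; apply: (continuous_bbs (K := K)) => //; exact: smooth_continuous.
Qed.

Lemma test_function_sub phi (A O : set V) : smooth phi -> compact A ->
  (forall x, phi x != 0 -> A x) -> A `<=` O -> test_function O phi.
Proof.
move=> sp cA h AO; have clA : closure [set x | phi x != 0] `<=` A.
  have cl : closed A by apply: compact_closed => //; exact: norm_hausdorff.
  by rewrite closureE; apply: smallest_sub => // x; exact: h.
split => //; last exact: subset_trans AO.
by apply: (subclosed_compact _ cA clA); exact: closed_closure.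
Qed.

Lemma tf_test_function phi : tf phi -> test_function setT phi.
Proof.
move=> [sp [K h]]; apply: (test_function_sub (A := [set x | `|x| <= K])) => //.
  exact: compact_norm_ball.
move=> x; rewrite /= leNgt; apply: contraNN => /h ->//.
Qed.

Lemma test_function_tf O phi : test_function O phi -> tf phi.
Proof.
move=> [sp cp _]; split => //; have [M [_ hM]] := compact_bounded cp.
exists (`|M| + 1) => x Mx; apply/eqP; apply: contraLR Mx => px.
rewrite -leNgt; apply: (hM (`|M| + 1)); first by rewrite ltr_pwDr// ler_norm.
exact: subset_closure.
Qed.

Lemma tf_mul f phi : smooth f -> tf phi -> tf (fun x => f x * phi x).
Proof.
move=> sf [sp [K h]]; split; first exact: smoothM.
by exists K => x /h ->; rewrite mulr0.
Qed.

Definition bump (r : R) x := flat 0 (r ^+ 2 - sqn x).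

Lemma smooth_bump r : smooth (bump r).
Proof.
apply: (smooth_comp (chi := flat 0) (f := fun x => r ^+ 2 - sqn x)).
  exact: smooth1_flat.
exact: (@smoothB R N (fun=> r ^+ 2) sqn (smooth_cst _) smooth_sqn).
Qed.

Lemma bump_eq0 r x : 0 <= r -> r < `|x| -> bump r x = 0.
Proof.
move=> r0 rx; apply: flat_le0; rewrite subr_le0 (le_trans _ (norm2_le_sqn x))//.
by rewrite lerXn2r ?nnegrE// ltW.
Qed.

Lemma tf_bump r : 0 <= r -> tf (bump r).
Proof. by move=> r0; split; [exact: smooth_bump|exists r => x; exact: bump_eq0]. Qed.

Lemma bump_ge0 r x : 0 <= bump r x.
Proof. exact: flat_ge0. Qed.

Lemma bump_int_gt0 r : 0 < r -> 0 < \int[mu]_x bump r x.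
Proof.
move=> r0; have ib := bbs_itg (tf_bbs (tf_bump (ltW r0))).
rewrite lt_neqAle eq_sym Rint_ge0 ?andbT; last exact: bump_ge0.
apply/eqP => I0.
have := Rint_eq0_ae ib (bump_ge0 r) I0.
(* On the maximum-norm ball of radius d the squared Euclidean norm is at most N d^2 < r^2, so the
   bump is positive on a set of positive measure. *)
pose d := r / (2 * N.+1%:R).
have d0 : 0 < d by rewrite divr_gt0// mulr_gt0.
move=> [Z [mZ Z0 hZ]].
have : [set x : V | `|x| <= d] `<=` Z.
  move=> x /= xd; apply: hZ => /= h; suff : 0 < bump r x by rewrite h ltxx.
  apply: flat0_gt0; rewrite subr_gt0 (le_lt_trans (sqn_le x))//.
  apply: (@le_lt_trans _ _ (N%:R * d ^+ 2)).
    by rewrite ler_wpM2l// lerXn2r ?nnegrE// ltW.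
  rewrite /d expr_div_n mulrCA gtr_pMr ?exprn_gt0// ltr_pdivrMr ?exprn_gt0 ?mulr_gt0// mul1r.
  rewrite -natrM -natrX ltr_nat.
  by rewrite -mulnn (@leq_trans (2 * N.+1)) ?leq_pmull ?leq_pmulr.
move=> dZ; have := le_measure mu (mem_set (@measurable_norm_ball R N d)) (mem_set mZ) dZ.
rewrite [X in (_ <= X)%E]Z0 [X in (X <= _)%E](lebesgue_norm_ball N (ltW d0)).
by rewrite lee_fin leNgt exprn_gt0// mulr_gt0.
Qed.

Definition moll (k : nat) x := (\int[mu]_x bump k.+1%:R^-1 x)^-1 * bump k.+1%:R^-1 x.

Lemma tf_moll k : tf (moll k).
Proof.
apply: tf_mul; first exact: smooth_cst.
by apply: tf_bump; rewrite invr_ge0.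
Qed.

Lemma moll_ge0 k x : 0 <= moll k x.
Proof.
by rewrite mulr_ge0 ?bump_ge0// invr_ge0; apply: Rint_ge0 => y; exact: bump_ge0.
Qed.

Lemma moll_eq0 k x : k.+1%:R^-1 < `|x| -> moll k x = 0.
Proof. by move=> h; rewrite /moll bump_eq0 ?mulr0// invr_ge0. Qed.

Lemma moll_int k : \int[mu]_x moll k x = 1.
Proof.
rewrite /moll RintZ; last by apply/bbs_itg/tf_bbs/tf_bump; rewrite invr_ge0.
by rewrite mulVf// gt_eqF// bump_int_gt0// invr_gt0.
Qed.

End test_functions.

(** * Mollification and weak derivatives *)

Section derivative_of_translates.
Variables (R : realType) (U : normedModType R).

Lemma is_derive_shiftv (phi : U -> R) x y w l :
  is_derive (x + y) w phi l -> is_derive x w (fun z => phi (z + y)) l.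
Proof.
move=> H0; have H := is_derive_ex_ed H0.
apply: is_derive_ed => e /H[d d0 hd]; exists d => // h /hd.
by rewrite (addrAC x y).
Qed.

End derivative_of_translates.

Section convolution.
Variables (R : realType) (N : nat).
Local Notation V := 'rV[R]_N.
Local Notation ei i := (delta_mx ord0 i : V).
Local Notation mu := (lebesgue_rV R N).
Implicit Types (f g G W v phi : V -> R) (K e : R) (x y z : V).

Lemma pderiv_shift i phi y : smooth phi ->
  pderiv i (fun z => phi (z + y)) = fun z => pderiv i phi (z + y).
Proof.
move=> sp; apply: pderiv_fun => x; apply: is_derive_shiftv; exact: smooth_is_derive.
Qed.

Lemma continuous_shiftv f y : continuous f -> continuous (fun z => f (z + y)).
Proof.
move=> /continuous_ed cf; apply: continuousP_ed => x e /(cf (x + y)) [d d0 h].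
by exists d => // z /h; rewrite addrAC.
Qed.

Lemma smooth_shift phi y : smooth phi -> smooth (fun z => phi (z + y)).
Proof.
move=> /smoothP sp; apply/smoothP => k; elim: k phi sp => [|k IH] phi sp.
  by split => //; apply: continuous_shiftv; exact: Ck_continuous (sp 0%N).
have sph : smooth phi by apply/smoothP.
apply: (@CkP _ _ _ _ (fun i z => pderiv i phi (z + y))).
- by apply: continuous_shiftv; exact: smooth_continuous.
- move=> i x; apply: is_derive_shiftv; exact: smooth_is_derive.
- by move=> i; apply: IH; apply/smoothP; exact: smooth_pderiv.
Qed.

Lemma pderivs_shift s phi y : smooth phi ->
  pderivs s (fun z => phi (z + y)) = fun z => pderivs s phi (z + y).
Proof.
by move=> sp; elim: s => [//|i s /= ->]; rewrite pderiv_shift//; exact: smooth_pderivs.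
Qed.

Lemma tf_shift phi y : tf phi -> tf (fun z => phi (z + y)).
Proof.
move=> [sp [K h]]; split; first exact: smooth_shift.
exists (K + `|y|) => x xK; apply: h.
by have := lerB_normD x y; rewrite lerBlDr => /(lt_le_trans xK); rewrite ltrD2r.
Qed.

Lemma tf_bounded phi : tf phi -> exists M K, [/\ 0 <= M, 0 <= K &
  forall x, `|phi x| <= M * cB K x].
Proof.
move=> [sp [K h]]; have [M M0 hM] := continuous_bounded_ball K (smooth_continuous sp).
exists M, `|K|; split => // x; rewrite cBE; case: ifPn => [xK|].
  rewrite mulr1; have [/hM//|/h ->] := leP `|x| K; by rewrite normr0.
rewrite -ltNge => xK; rewrite h ?normr0 ?mulr0//.
by rewrite (le_lt_trans _ xK)// ler_norm.
Qed.

Lemma itg_conv phi G x : bbs phi -> L1loc G -> itg mu (fun z => phi (z - x) * G z).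
Proof.
move=> tp hG; have := itg_shift (- x) (itg_T x tp hG).
by under eq_fun do rewrite subrK.
Qed.

Lemma TfE phi G x : bbs phi -> L1loc G ->
  Tf phi G x = \int[mu]_z (phi (z - x) * G z).
Proof.
move=> tp hG; rewrite -(@Rint_shift _ _ (fun z => phi (z - x) * G z) x).
  by apply: eq_Rint => z; rewrite addrK.
exact: itg_measurable (itg_conv x tp hG).
Qed.

(** Two applications of the mean value theorem. The radius exceeds that of the support by 1, since
    |h| <= 1 and either w or w + h e_i may lie in the support. *)
Lemma taylor2 phi i : tf phi -> exists C K, [/\ 0 <= C, 0 <= K &
  forall w (h : R), `|h| <= 1 ->
   `|phi (w + h *: ei i) - phi w - h * pderiv i phi w| <= C * `|h| ^+ 2 * cB K w].
Proof.
move=> tp; have [sp [K hK]] := tp.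
have [C [K1 [C0 K10 hC]]] := tf_bounded (tf_pderiv i (tf_pderiv i tp)).
have hei : `|ei i| <= 1.
  apply/norm_rV_le => // j; rewrite mxE eqxx /=.
  by case: (j == i); rewrite /= ?normr1 ?normr0.
exists C, (`|K| + 1); split; [by []|by rewrite addr_ge0|].
move=> w h h1.
have [wK|wK] := leP `|w| (`|K| + 1); last first.
  have zw : phi w = 0.
    by apply: hK; rewrite (le_lt_trans (ler_norm _))// (le_lt_trans _ wK)// lerDl.
  have zw' : pderiv i phi w = 0.
    apply: (@pderiv_eq0_open _ _ phi [set x : V | K < `|x|]) => //.
      exact: (@open_norm_gt R N K).
    by rewrite /= (le_lt_trans (ler_norm _))// (le_lt_trans _ wK)// lerDl.
  rewrite zw zw' mulr0 hK ?subr0 ?normr0 ?mulr_ge0 ?cB_ge0 ?exprn_ge0//.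
  rewrite (le_lt_trans (ler_norm _))//.
  have := lerB_normD w (h *: ei i); apply: lt_le_trans.
  rewrite ltrBrDr (le_lt_trans _ wK)// lerD2l normrZ.
  by rewrite (le_trans (ler_pM _ _ h1 hei))// mulr1.
rewrite cBE wK mulr1.
have [s sh ->] := @mvt_line _ _ phi (fun s => pderiv i phi (w + s *: ei i)) w (ei i) h
  (fun s => smooth_is_derive i _ sp).
have [s' sh' E] := @mvt_line _ _ (pderiv i phi) (fun s => pderiv i (pderiv i phi) (w + s *: ei i))
  w (ei i) s (fun s => smooth_is_derive i _ (smooth_pderiv i sp)).
rewrite -mulrBr E !normrM expr2 [leRHS]mulrCA ler_wpM2l// [leRHS]mulrC.
rewrite ler_pM//; apply: (le_trans (hC _)).
by rewrite ler_piMr// cB_le1.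
Qed.

(** No differentiability of G is involved: the translation is moved onto phi, whose Taylor remainder
    is O(h^2) on a fixed ball. The sign comes from phi(z - x). *)
Lemma is_derive_Tf_test phi G i x : tf phi -> L1loc G ->
  is_derive x (ei i) (Tf phi G) (-1 * Tf (pderiv i phi) G x).
Proof.
move=> tp hG; have [C [K [C0 K0 hC]]] := taylor2 i tp.
have tp' := tf_pderiv i tp; have bp := tf_bbs tp; have bp' := tf_bbs tp'.
pose A := \int[mu]_z (cB (K + `|x|) z * `|G z|).
have iA : itg mu (fun z => cB (K + `|x|) z * `|G z|) by have [_] := L1loc_norm hG; apply.
have A0 : 0 <= A by apply: Rint_ge0 => z; rewrite mulr_ge0 ?cB_ge0.
apply: is_derive_ed => e e0; exists (Num.min 1 (e / (C * A + 1))).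
  by rewrite lt_min ltr01 divr_gt0// ltr_pwDr// mulr_ge0.
move=> h; rewrite le_min => /andP[h1 hd].
rewrite !TfE// (_ : h * _ = \int[mu]_z (- h * (pderiv i phi (z - x) * G z))); last first.
  by rewrite RintZ; [rewrite mulN1r mulrN mulNr|exact: itg_conv].
rewrite -RintB; [|exact: itg_conv..].
rewrite -RintB; [|by apply: itgB; exact: itg_conv|by apply: itgZ; exact: itg_conv].
apply: (@le_trans _ _ (\int[mu]_z (C * `|h| ^+ 2 * (cB (K + `|x|) z * `|G z|)))).
  apply: Rint_norm_le; last first.
  - move=> z; have := hC (z - x) (- h); rewrite normrN => /(_ h1) hC'.
    have -> : phi (z - (x + h *: ei i)) = phi (z - x + - h *: ei i).
      by rewrite opprD addrA scaleNr.
    rewrite mulrA -mulrBl -mulrBl normrM mulrA ler_wpM2r//.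
    apply: (le_trans hC'); rewrite ler_wpM2l ?mulr_ge0 ?exprn_ge0//.
    by have := @cB_shift R N K `|x| (z - x) x (lexx _); rewrite subrK.
  - exact: itgZ.
  - apply: itg_measurable; apply: itgB; first by apply: itgB; exact: itg_conv.
    by apply: itgZ; exact: itg_conv.
rewrite RintZ// -/A expr2.
have -> : C * (`|h| * `|h|) * A = C * A * `|h| * `|h| by ring.
rewrite ler_wpM2r//; apply: (@le_trans _ _ (`|h| * (C * A + 1))).
  by rewrite mulrDr mulr1 mulrC lerDl.
by rewrite -ler_pdivlMr// ltr_pwDr// mulr_ge0.
Qed.

Lemma Tf_test_Ck k phi G : tf phi -> L1loc G -> Ck k (Tf phi G).
Proof.
move=> + hG; elim: k phi => [|k IH] phi tp.
  by split => //; apply: Tf_continuous => //; exact: tf_bbs.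
apply: (@CkP _ _ _ _ (fun i x => -1 * Tf (pderiv i phi) G x)).
- by apply: Tf_continuous => //; exact: tf_bbs.
- by move=> i x; exact: is_derive_Tf_test.
- by move=> i; apply: CkM; [exact: Ck_cst|apply: IH; exact: tf_pderiv].
Qed.

Lemma smooth_Tf phi G : tf phi -> L1loc G -> smooth (Tf phi G).
Proof. by move=> tp hG; apply/smoothP => k; exact: Tf_test_Ck. Qed.

Lemma pderivZ (c : R) i phi : smooth phi ->
  pderiv i (fun x => c * phi x) = fun x => c * pderiv i phi x.
Proof.
move=> sp; apply: pderiv_fun => x; have := smooth_is_derive i x sp.
move=> /(@is_derive_mul _ _ (fun=> c) _ _ _ 0 _ (is_derive_cst _ _ _)).
by rewrite mulr0 addr0.
Qed.

Lemma pderivs_Tf s phi G : tf phi -> L1loc G ->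
  pderivs s (Tf phi G) = fun x => (-1) ^+ size s * Tf (pderivs s phi) G x.
Proof.
move=> tp hG; elim: s => [|i s IH] /=.
  by apply/funext => x; rewrite expr0 mul1r.
have tps := tf_pderivs s tp.
rewrite IH pderivZ; last exact: smooth_Tf.
apply/funext => x; rewrite exprSr -mulrA; congr (_ * _).
by have [_] := is_derive_Tf_test i x tps hG.
Qed.

Definition wd (s : seq 'I_N) v g := [/\ L1loc v, L1loc g &
  forall phi, tf phi ->
    \int[mu]_x (v x * pderivs s phi x) = (-1) ^+ size s * \int[mu]_x (g x * phi x)].

(** Two equal signs cancel: one arises when the derivatives are moved onto phi, the other from the
    definition of the weak derivative, tested with a translate of phi. *)
Lemma pderivs_Tf_wd s phi v g : wd s v g -> tf phi -> pderivs s (Tf phi v) = Tf phi g.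
Proof.
move=> [hv hg H] tp; rewrite pderivs_Tf//; apply/funext => x.
have tps := tf_pderivs s tp.
rewrite !TfE//; try exact: tf_bbs.
have tpx := tf_shift (- x) tp.
have := H _ tpx; rewrite pderivs_shift; last by case: tp.
under eq_Rint do rewrite mulrC; move=> ->.
under eq_Rint do rewrite mulrC.
by rewrite mulrA -expr2 sqrr_sign mul1r.
Qed.

Lemma moll_approx G y (c e : R) k : L1loc G ->
  (forall z, `|z| <= k.+1%:R^-1 -> `|G (z + y) - c| <= e) ->
  `|Tf (moll k) G y - c| <= e.
Proof.
move=> hG h; have bm := tf_bbs (tf_moll R N k); have im := bbs_itg bm.
have E a : a = \int[mu]_z (a * moll k z) by rewrite RintZ// moll_int mulr1.
have iT := itg_T y bm hG.
have -> : Tf (moll k) G y - c = \int[mu]_z (moll k z * G (z + y) - c * moll k z).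
  by rewrite RintB -?E//; exact: itgZ.
rewrite [leRHS]E; apply: Rint_norm_le; last first.
- move=> z; rewrite (mulrC (moll k z)) -mulrBl normrM (ger0_norm (moll_ge0 _ _)).
  have [zk|zk] := leP `|z| k.+1%:R^-1; first by rewrite ler_wpM2r ?moll_ge0// h.
  by rewrite moll_eq0// !mulr0.
- exact: itgZ.
- apply: itg_measurable; apply: itgB; [exact: iT|exact: itgZ].
Qed.

Lemma natSinv_small (d : R) : 0 < d -> exists n, forall k, (n <= k)%N -> k.+1%:R^-1 <= d.
Proof.
move=> d0; have [n _ hn] := near_infty_natSinv_lt (PosNum d0).
by exists n => k nk; apply: ltW; exact: hn.
Qed.

Lemma moll_near F y e : continuous F -> 0 < e ->
  exists n, forall k, (n <= k)%N -> `|F y - Tf (moll k) F y| <= e.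
Proof.
move=> cF e0; have [d d0 hd] := continuous_ed cF y e0.
have [n hn] := natSinv_small d0; exists n => k nk.
rewrite distrC; apply: moll_approx => [|z zk]; first exact: continuous_L1loc.
by rewrite (addrC z); apply: hd; apply: (le_trans zk); exact: hn.
Qed.

(* Mollify F = Tf W v: by Tf_comm its mollification has derivative the
   mollification of Tf W g, and both converge locally uniformly. *)
Lemma is_derive_Tf W v g i y : bbs W -> wd [:: i] v g ->
  is_derive y (ei i) (Tf W v) (Tf W g y).
Proof.
move=> bW vg; have [hv hg _] := vg.
set F := Tf W v; set H := Tf W g.
have cF : continuous F by exact: Tf_continuous.
have cH : continuous H by exact: Tf_continuous.
have hF := continuous_L1loc cF.
have D k x : is_derive x (ei i) (Tf (moll k) F) (Tf (moll k) H x).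
  have tm := tf_moll R N k; have bm := tf_bbs tm; have bm' := tf_bbs (tf_pderiv i tm).
  apply: is_derive_cast (is_derive_Tf_test i x tm hF) _.
  rewrite /F /H (Tf_comm _ bm' bW hv) (Tf_comm _ bm bW hg) /Tf -RintZ; last first.
    exact: (itg_T x bW (continuous_L1loc (Tf_continuous bm' hv))).
  apply: eq_Rint => z; rewrite mulrCA; congr (_ * _).
  have := pderivs_Tf_wd vg tm; rewrite pderivs_Tf//= => /(congr1 (fun f => f (z + x))).
  by rewrite expr1.
clearbody F H.
apply: is_derive_ed => e e0.
have [d d0 hd] := continuous_ed cH y e0.
exists (d / 2); first by rewrite divr_gt0.
(* For fixed h the mollification error r is made arbitrarily small. The order k of the mollifier
   depends on h and r, but the remaining bound e |h| does not involve it. *)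
move=> h hd2; apply/ler_addgt0Pr => r r0.
have r20 : 0 < r / 2 by rewrite divr_gt0.
have hei : `|ei i| <= 1.
  apply/norm_rV_le => // j; rewrite mxE eqxx /=.
  by case: (j == i); rewrite /= ?normr1 ?normr0.
have d20 : 0 < d / 2 by rewrite divr_gt0.
have [n1 hn1] := moll_near (y + h *: ei i) cF r20.
have [n2 hn2] := moll_near y cF r20.
have [n3 hn3] := natSinv_small d20.
pose k := maxn n1 (maxn n2 n3).
have k1 := hn1 k (leq_maxl _ _).
have k2 : `|F y - Tf (moll k) F y| <= r / 2.
  by apply: hn2; rewrite /k !leq_max leqnn orbT.
have kd : k.+1%:R^-1 <= d / 2 by apply: hn3; rewrite /k !leq_max leqnn !orbT.
have [s sh E] := @mvt_line _ _ (Tf (moll k) F) (fun s => Tf (moll k) H (y + s *: ei i)) y (ei i) h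
  (fun s => D k _).
have K : `|Tf (moll k) H (y + s *: ei i) - H y| <= e.
  apply: moll_approx => [|z zk]; first exact: continuous_L1loc.
  rewrite addrCA; apply: hd.
  rewrite (splitr d) (le_trans (ler_normD _ _))// lerD//; first exact: le_trans kd.
  by rewrite normrZ (le_trans (ler_pM _ _ sh hei))// mulr1.
have -> : F (y + h *: ei i) - F y - h * H y =
  (F (y + h *: ei i) - Tf (moll k) F (y + h *: ei i)) - (F y - Tf (moll k) F y)
  + h * (Tf (moll k) H (y + s *: ei i) - H y).
  rewrite mulrBr -E; move: (Tf _ F (y + _)) (Tf _ F y) (F (y + _)) (F y) (h * H y).
  by move=> a1 a2 a3 a4 a5; ring.
rewrite (le_trans (ler_normD _ _))// addrC lerD//.
  by rewrite normrM mulrC ler_wpM2r.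
by rewrite (splitr r) (le_trans (ler_normB _ _))// lerD.
Qed.

(** Pairing with the sign of G, cut off to a ball, shows that |G| has integral 0 over every ball. *)
Lemma ae_eq0_pairing G : L1loc G -> (forall W, bbs W -> \int[mu]_x (W x * G x) = 0) ->
  {ae mu, forall x, G x = 0}.
Proof.
move=> hG H; have [mG iG] := hG.
suff A (n : nat) : {ae mu, forall x, cB n%:R x * `|G x| = 0}.
  have := ae_foralln A; apply: filterS => x h.
  have [n _ /(_ n (leqnn n)) /= hn] : \forall n \near \oo, `|x| <= n%:R.
    by near do apply: ltW; exact: nbhs_infty_gtr.
  by have := h n; rewrite cBE hn mul1r => /eqP; rewrite normr_eq0 => /eqP.
apply: Rint_eq0_ae.
- by have [_] := L1loc_norm hG; apply.
- by move=> x; rewrite mulr_ge0 ?cB_ge0.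
pose sg x : R := \1_[set x | 0 < G x] x - \1_[set x | G x < 0] x.
have sgE x : sg x * G x = `|G x|.
  rewrite /sg !indicE; have [G0|G0|->] := ltgtP (G x) 0.
  - by rewrite memNset ?mem_set//= ?sub0r ?mulN1r ?ltr0_norm//; apply/negP; rewrite -leNgt ltW.
  - by rewrite mem_set ?memNset//= ?subr0 ?mul1r ?gtr0_norm//; apply/negP; rewrite -leNgt ltW.
  - by rewrite mulr0 normr0.
have msg : measurable_fun setT sg.
  apply: measurable_funB; apply: measurable_indic; rewrite -[X in measurable X]setTI.
    by apply: (measurable_fun_ltr (f := cst 0)) => //.
  by apply: (measurable_fun_ltr (g := cst 0)) => //.
rewrite -(H (fun x => cB n%:R x * sg x)).
  by apply: eq_Rint => x; rewrite -mulrA sgE.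
apply: (@bbs_bounded _ _ _ 1 n%:R).
- by apply: measurable_funM => //; exact: measurable_cB.
- move=> x; rewrite normrM ger0_norm ?cB_ge0//.
  rewrite mulr_ile1 ?cB_ge0 ?cB_le1// /sg !indicE.
  by case: (_ \in _); case: (_ \in _); rewrite /= ?subrr ?subr0 ?sub0r ?normrN ?normr1 ?normr0.
- by move=> x xn; rewrite cBE (lt_geF xn) mul0r.
Unshelve. all: by end_near. Qed.

End convolution.

(** * Convexity inequalities and averages along segments *)

Section power_convexity.
Variable R : realType.
Implicit Types (p x y : R).

Lemma normr_spow p x : 1 < p -> `|spow p x| = `|x| `^ (p - 1).
Proof.
move=> p1; rewrite /spow normrM ger0_norm ?powR_ge0// mulrC.
have -> : p - 2 = (p - 1) - 1 by ring.
by rewrite mulr_powRB1// subr_gt0.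
Qed.

Lemma spow_mul p x : 1 < p -> spow p x * x = `|x| `^ p.
Proof.
move=> p1; rewrite /spow -mulrA -expr2 -real_normK ?num_real// expr2 mulrA.
rewrite (mulrC (_ `^ _)) (_ : p - 2 = (p - 1) - 1); last by ring.
rewrite mulr_powRB1// ?subr_gt0// mulrC mulr_powRB1//.
by rewrite (lt_trans ltr01).
Qed.

Lemma young p x y : 1 < p -> 0 <= x -> 0 <= y ->
  x `^ (p - 1) * y <= (1 - p^-1) * x `^ p + p^-1 * y `^ p.
Proof.
move=> p1 x0 y0; have p0 : 0 < p by rewrite (lt_trans ltr01).
have pn0 : p != 0 by rewrite gt_eqF.
have p10 : 0 < p - 1 by rewrite subr_gt0.
have q0 : 0 < p / (p - 1) by rewrite divr_gt0.
have := @conjugate_powR R (x `^ (p - 1)) y (p / (p - 1)) p (powR_ge0 _ _) y0 q0 p0.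
have -> : (p / (p - 1))^-1 + p^-1 = 1.
  by rewrite invf_div mulrBl mulfV// mul1r subrK.
move=> /(_ erefl) h; apply: (le_trans h).
rewrite -powRrM (mulrC (p - 1)) divfK ?gt_eqF// invf_div.
by rewrite mulrBl mulfV// mul1r (mulrC (x `^ p)) (mulrC (y `^ p)).
Qed.

(** The tangent line inequality of t |-> |t|^p / p. Since [spow p x] times x is |x|^p, it reduces to
    Young's inequality for |x|^(p-1) |y|, and no derivative of the power is taken. *)
Lemma power_convex p x y : 1 < p ->
  spow p x * (y - x) <= p^-1 * `|y| `^ p - p^-1 * `|x| `^ p.
Proof.
move=> p1; rewrite mulrBr spow_mul// lerBlDr.
have h : spow p x * y <= (1 - p^-1) * `|x| `^ p + p^-1 * `|y| `^ p.
  apply: (le_trans _ (young p1 (normr_ge0 x) (normr_ge0 y))).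
  by rewrite -normr_spow// -normrM ler_norm.
by apply: (le_trans h); rewrite mulrBl mul1r addrC addrA addrAC.
Qed.

Lemma powR_add_le p x y : 0 <= p -> `|x + y| `^ p <= 2 `^ p * (`|x| `^ p + `|y| `^ p).
Proof.
move=> p0; have n20 : (0 : R) <= 2 by [].
wlog xy : x y / `|x| <= `|y|.
  move=> H; have [/H//|/ltW/H] := leP `|x| `|y|.
  by rewrite addrC [X in _ -> _ <= _ * X]addrC.
apply: (@le_trans _ _ ((2 * `|y|) `^ p)).
  rewrite ge0_ler_powR ?nnegrE ?mulr_ge0//.
  by rewrite (le_trans (ler_normD _ _))// mulr_natl mulr2n lerD2r.
by rewrite powRM// ler_wpM2l ?powR_ge0// lerDr powR_ge0.
Qed.

Lemma powR_lt_inv p (M x : R) : 0 < p -> 0 <= M -> 0 <= x -> x `^ p <= M -> x <= M `^ p^-1.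
Proof.
move=> p0 M0 x0 h; have -> : x = (x `^ p) `^ p^-1.
  by rewrite -powRrM mulfV ?gt_eqF// powRr1.
by rewrite ge0_ler_powR ?nnegrE ?powR_ge0// invr_ge0 ltW.
Qed.

End power_convexity.

Section jensen.
Context d (T : measurableType d) (R : realType) (mu : {measure set T -> \bar R}).
Implicit Types (f rho : T -> R) (p : R).

Lemma Rint_fun0 f : (forall x, f x = 0) -> \int[mu]_x f x = 0.
Proof.
move=> f0; rewrite (_ : f = fun=> 0) ?/Rintegral ?integral0//; exact/funext.
Qed.

(* Integrate the tangent line inequality of |t|^p at the mean of f. *)
Lemma jensen_density rho f p : 1 < p -> (forall x, 0 <= rho x) -> itg mu rho ->
  \int[mu]_x rho x = 1 -> itg mu (fun x => rho x * f x) ->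
  itg mu (fun x => rho x * `|f x| `^ p) ->
  `|\int[mu]_x (rho x * f x)| `^ p <= \int[mu]_x (rho x * `|f x| `^ p).
Proof.
move=> p1 r0 ir r1 irf irp; set b := \int[mu]_x (rho x * f x).
have p0 : 0 < p by rewrite (lt_trans ltr01).
have h x : spow p b * (rho x * f x) - spow p b * b * rho x
    <= p^-1 * (rho x * `|f x| `^ p) - p^-1 * `|b| `^ p * rho x.
  have := ler_wpM2l (r0 x) (power_convex b (f x) p1).
  have -> : rho x * (spow p b * (f x - b)) =
    spow p b * (rho x * f x) - spow p b * b * rho x by ring.
  by move/le_trans; apply; rewrite mulrBr le_eqVlt; apply/orP; left; apply/eqP; ring.
have i1 : itg mu (fun x => spow p b * (rho x * f x)) by exact: itgZ.
have i2 : itg mu (fun x => spow p b * b * rho x) by exact: itgZ.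
have i3 : itg mu (fun x => p^-1 * (rho x * `|f x| `^ p)) by exact: itgZ.
have i4 : itg mu (fun x => p^-1 * `|b| `^ p * rho x) by exact: itgZ.
have := Rint_le (itgB i1 i2) (itgB i3 i4) h.
rewrite !RintB// !RintZ// -/b r1 !mulr1 subrr subr_ge0.
by rewrite ler_pM2l// invr_gt0.
Qed.

Lemma measurable_powR_norm f p : measurable_fun setT f ->
  measurable_fun setT (fun x => `|f x| `^ p).
Proof.
move=> mf; apply: (measurableT_comp (measurable_powR p)).
exact: measurableT_comp.
Qed.

End jensen.

Section averages.
Variables (R : realType) (N : nat).
Local Notation V := 'rV[R]_N.
Local Notation ei i := (delta_mx ord0 i : V).
Local Notation mu := (lebesgue_rV R N).
Local Notation RT := (measurableTypeR R).
Local Notation lam := (@lebesgue_measure R).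
Implicit Types (f g G W v phi : V -> R) (K e : R) (x y z a : V).

Definition u01 (s : RT) : R := \1_(`[0, 1]%classic : set RT) s.

Lemma u01E (s : R) : u01 s = if 0 <= s <= 1 then 1 else 0.
Proof.
rewrite /u01 indicE; case: ifPn => h; first by rewrite mem_set//= in_itv.
by rewrite memNset//= in_itv/=; apply/negP.
Qed.

Lemma u01_ge0 s : 0 <= u01 s.
Proof. by rewrite u01E; case: ifP. Qed.

Lemma measurable_u01 : measurable_fun setT u01.
Proof. by apply: measurable_indic; exact: measurable_itv. Qed.

Lemma itg_u01 : itg lam u01.
Proof.
apply/itgP; split; first exact: measurable_u01.
under eq_integral do rewrite ger0_norm ?u01_ge0//.
rewrite /u01 integral_indic//.
by rewrite setIT [ltLHS]lebesgue_measure_itv/= lte01 ltry.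
Qed.

Lemma Rint_u01 : \int[lam]_s u01 s = 1.
Proof.
rewrite /Rintegral /u01 integral_indic//.
by rewrite setIT [X in fine X]lebesgue_measure_itv/= lte01 oppr0 adde0.
Qed.

Lemma measurable_line a : measurable_fun setT (fun p : RT * V => p.2 + (p.1 : R) *: a).
Proof.
apply/measurable_fun_rVP => i.
rewrite (_ : _ \o _ = fun p : RT * V => rV_coord i p.2 + (p.1 : R) * a ord0 i); last first.
  by apply/funext => p /=; rewrite /rV_coord !mxE.
apply: measurable_funD; first by apply: measurableT_comp => //; exact: measurable_rV_coord.
by apply: measurable_funM => //; exact: measurable_fst.
Qed.

(** The mean of g over the segment from x to x + a. By [ae_itg_line] the integral exists for almost
    every x; elsewhere the value is a default one. *)
Definition avg g a x := \int[lam]_s (u01 s * g (x + (s : R) *: a)).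

Lemma cB_line K a x (s : R) : 0 <= s <= 1 -> cB K x <= cB (K + `|a|) (x + s *: a).
Proof.
move=> /andP[s0 s1]; apply: cB_shift; rewrite normrZ ger0_norm//.
by rewrite ler_piMl.
Qed.

Lemma itg_avg W g a : bbs W -> L1loc g ->
  itg (lam \x mu)%E (fun p : RT * V => W p.2 * (u01 p.1 * g (p.2 + (p.1 : R) *: a))).
Proof.
move=> bW hg; have [M [K [M0 K0 ae]]] := bbs_le bW.
have [mW _] := bW; have [mg _] := hg.
pose H x := cB (K + `|a|) x * `|g x|.
have iH : itg mu H by have [_] := L1loc_norm hg; apply.
have mF : measurable_fun setT (fun p : RT * V => W p.2 * (u01 p.1 * g (p.2 + (p.1 : R) *: a))).
  apply: measurable_funM; first exact: measurableT_comp mW measurable_snd.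
  apply: measurable_funM; first exact: measurableT_comp measurable_u01 measurable_fst.
  exact: (measurableT_comp mg (measurable_line a)).
apply: (itg_prod (g := fun s => M * \int[mu]_x H x * u01 s)) => //.
  by apply: itgZ; exact: itg_u01.
apply: aeW => s.
have iW : itg mu (fun x => M * u01 s * H (x + (s : R) *: a)) by apply/itgZ/itg_shift.
apply: (@le_trans _ _ (\int[mu]_x (M * u01 s * H (x + (s : R) *: a)))%:E); last first.
  rewrite lee_fin RintZ; last exact: itg_shift.
  have -> : \int[mu]_x H (x + (s : R) *: a) = \int[mu]_x H x.
    by apply: Rint_shift; exact: itg_measurable iH.
  by rewrite mulrAC.
rewrite Rint_EFin//; apply: ae_ge0_le_integral => //.
- apply/measurable_EFinP; apply: measurableT_comp => //.
  by apply: (measurableT_comp mF); exact: measurable_pair1.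
- move=> x _; rewrite lee_fin mulr_ge0// ?mulr_ge0 ?u01_ge0// ?cB_ge0//.
- by apply/measurable_EFinP; exact: itg_measurable iW.
apply: filterS ae => x Wx _ /=; rewrite lee_fin !normrM (ger0_norm (u01_ge0 _)).
rewrite /H u01E; case: ifPn => s01; last by rewrite !(mul0r,mulr0).
rewrite mul1r mulr1 mulrA ler_wpM2r//; apply: (le_trans Wx).
by rewrite ler_wpM2l//; exact: cB_line.
Qed.

Lemma cB_bbs K : bbs (cB K : V -> R).
Proof.
apply: (@bbs_bounded _ _ _ 1 K); first exact: measurable_cB.
  by move=> x; rewrite ger0_norm ?cB_ge0 ?cB_le1.
by move=> x xK; rewrite cBE (lt_geF xK).
Qed.

Lemma norm_lt_nat x : exists n : nat, `|x| <= n%:R.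
Proof.
have [n _ /(_ n (leqnn n)) /= hn] : \forall n \near \oo, `|x| <= n%:R.
  by near do apply: ltW; exact: nbhs_infty_gtr.
by exists n.
Unshelve. all: by end_near. Qed.

Lemma ae_itg_line g a : L1loc g ->
  {ae mu, forall x, itg lam (fun s => u01 s * g (x + (s : R) *: a))}.
Proof.
move=> hg; have A (n : nat) := Rfubini_itg2 (itg_avg a (cB_bbs n%:R) hg).
have := ae_foralln A; apply: filterS => x h; have [n xn] := norm_lt_nat x.
by have := h n; rewrite /= cBE xn; under eq_fun do rewrite mul1r.
Qed.

Lemma L1loc_avg g a : L1loc g -> L1loc (avg g a).
Proof.
move=> hg.
have icB K : itg mu (fun x => cB K x * avg g a x).
  have [+ _] := Rfubini_G (itg_avg a (cB_bbs K) hg).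
  congr (itg mu _); apply/funext => x /=.
  rewrite cBE; case: ifP => _; last first.
    by rewrite mul0r Rint_fun0// => s; rewrite mul0r.
  by rewrite mul1r; apply: eq_Rint => s; rewrite mul1r.
split => //.
apply: (measurable_fun_cvg (h := fun n x => cB n%:R x * avg g a x)).
  by move=> n; exact: itg_measurable (icB n%:R).
move=> x _; apply: cvg_near_cst; near=> n.
have xn : `|x| <= n%:R by near: n; near do apply: ltW; exact: nbhs_infty_gtr.
by rewrite cBE xn mul1r.
Unshelve. all: by end_near. Qed.

Lemma avg_pair W g a : bbs W -> L1loc g ->
  \int[mu]_x (W x * avg g a x) = \int[lam]_s (u01 s * Tf W g ((s : R) *: a)).
Proof.
move=> bW hg; have iF := itg_avg a bW hg.
transitivity (\int[mu]_x \int[lam]_s (W x * (u01 s * g (x + (s : R) *: a)))).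
  apply: Rint_ae_eq.
  - by apply: measurable_funM; [exact: (proj1 bW)|exact: (proj1 (L1loc_avg a hg))].
  - exact: itg_measurable (proj1 (Rfubini_G iF)).
  by apply: filterS (ae_itg_line a hg) => x ix; rewrite RintZ.
rewrite -(Rfubini iF); apply: eq_Rint => s /=.
rewrite /Tf -RintZ; last exact: itg_T.
by apply: eq_Rint => x; rewrite mulrCA.
Qed.

Lemma is_derive_scale_dir (Phi : V -> R) y w (h l : R) :
  is_derive y w Phi l -> is_derive y (h *: w) Phi (h * l).
Proof.
move=> H0; have H := is_derive_ex_ed H0; apply: is_derive_ed => e e0.
have h1 : 0 < `|h| + 1 by rewrite ltr_pwDr.
have [d d0 hd] := H _ (divr_gt0 e0 h1).
exists (d / (`|h| + 1)); first exact: divr_gt0.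
move=> k; rewrite ler_pdivlMr// => kd.
have khd : `|k * h| <= d by rewrite normrM (le_trans _ kd)// ler_wpM2l// lerDl.
rewrite scalerA mulrA; apply: (le_trans (hd _ khd)).
rewrite normrM -mulrA ler_wpM2l ?(ltW e0)// mulrCA ler_piMr//.
by rewrite mulrC ler_pdivrMr// mul1r lerDl.
Qed.

Lemma ftc01 (F f : R -> R) : (forall s : R, is_derive s 1 F (f s)) -> continuous f ->
  F 1 - F 0 = \int[lam]_s (u01 s * f s).
Proof.
move=> dF cf.
have cF : continuous F.
  move=> s; apply/differentiable_continuous/derivable1_diffP.
  exact: (@ex_derive _ _ _ _ _ _ _ (dF s)).
have dL : derivable_oo_LRcontinuous F 0 1.
  by split; [move=> s _; exact: (@ex_derive _ _ _ _ _ _ _ (dF s))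
    |apply: cvg_at_right_filter; exact: cF|apply: cvg_at_left_filter; exact: cF].
have E := @continuous_FTC2 R f F 0 1 ltr01 (continuous_subspaceT cf) dL
  (fun s _ => etrans (derive1E _ _) (@derive_val _ _ _ _ _ _ _ (dF s))).
have -> : F 1 - F 0 = \int[lam]_(s in `[0, 1]%classic) f s.
  by rewrite /Rintegral E -EFinB.
rewrite Rintegral_mkcond; apply: eq_Rint => s.
by rewrite /u01 patchE indicE; case: ifPn; rewrite ?mul1r ?mul0r.
Qed.

Lemma Tf_ftc W v g i (h : R) : bbs W -> wd [:: i] v g ->
  Tf W v (h *: ei i) - Tf W v 0 =
  h * \int[lam]_s (u01 s * Tf W g ((s : R) *: (h *: ei i))).
Proof.
move=> bW vg; have [hv hg _] := vg.
have cl : continuous (fun s : R => s *: (h *: ei i)).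
  by move=> s; apply: cvgZr_tmp; exact: cvg_id.
have cT : continuous (fun s : R => Tf W g (s *: (h *: ei i))).
  by move=> s; apply: (@continuous_comp _ _ _ (fun s : R => s *: (h *: ei i)) (Tf W g));
    [exact: cl|exact: Tf_continuous].
rewrite -RintZ; last first.
  have : lam.-integrable `[0, 1]%classic (EFin \o (fun s : R => Tf W g (s *: (h *: ei i)))).
    by apply: continuous_compact_integrable; [exact: segment_compact|exact: continuous_subspaceT].
  rewrite integrable_mkcond//; congr (_ .-integrable _ _); apply/funext => s.
  by rewrite /u01 /= patchE indicE; case: ifPn => _; rewrite ?mul1r ?mul0r.
have dT (s : R) : is_derive s 1 (fun s => Tf W v (s *: (h *: ei i)))
    (h * Tf W g (s *: (h *: ei i))).
  have := is_derive_scale_dir h (is_derive_Tf (s *: (h *: ei i)) bW vg) => H.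
  have H1 : is_derive (0 + s *: (h *: ei i)) (h *: ei i) (Tf W v) (h * Tf W g (s *: (h *: ei i))).
    by rewrite add0r.
  move/is_derive_line : H1; congr (is_derive _ _ _ _).
  by apply/funext => t; rewrite add0r.
have cT' : continuous (fun s : R => h * Tf W g (s *: (h *: ei i))).
  by apply: continuous_mul => //; exact: continuous_cst.
have := ftc01 dT cT'; rewrite scale1r scale0r => E.
by rewrite [LHS]E; apply: eq_Rint => s; rewrite mulrCA.
Qed.

(** The pairings [Tf W v] are continuously differentiable along the line, so they obey the
    fundamental theorem of calculus. A locally integrable function all of whose pairings vanish is 0
    almost everywhere. *)
Lemma ftc_ae v g i (h : R) : wd [:: i] v g ->
  {ae mu, forall x, v (x + h *: ei i) - v x = h * avg g (h *: ei i) x}.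
Proof.
move=> vg; have [hv hg _] := vg.
have ha := L1loc_avg (h *: ei i) hg.
have hvs := L1loc_shift (h *: ei i) hv.
have hG : L1loc (fun x => v (x + h *: ei i) - v x - h * avg g (h *: ei i) x).
  by apply: L1locB; [exact: L1locB|exact: L1locZ].
have : {ae mu, forall x, v (x + h *: ei i) - v x - h * avg g (h *: ei i) x = 0}.
  apply: (ae_eq0_pairing hG) => W bW.
  have i1 := itg_T (h *: ei i) bW hv; have i2 := itg_T0 bW hv; have i3 := itg_T0 bW ha.
  transitivity (\int[mu]_x (W x * v (x + h *: ei i) - W x * v x
    - h * (W x * avg g (h *: ei i) x))).
    by apply: eq_Rint => x; ring.
  rewrite RintB; [|exact: itgB|exact: itgZ].
  rewrite RintB// RintZ// avg_pair// -(Tf_ftc h bW vg) Tf0.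
  by rewrite subrr.
by apply: filterS => x /eqP; rewrite subr_eq0 => /eqP.
Qed.

(** Jensen's inequality on each segment and then Tonelli's theorem carry the bound from the
    translates of g to their average. With c = g the left-hand side is a first-order Taylor
    remainder of v; this is the case used in [half_bound]. *)
Lemma ftc_pow_sub v g (c : V -> R) i (h p : R) (S : set V) (B : \bar R) : 1 < p -> wd [:: i] v g ->
  measurable_fun setT c -> measurable S -> (0 <= B)%E ->
  (forall s, 0 <= s <= 1 ->
    (\int[mu]_x (\1_S x * `|g (x + s *: (h *: ei i)) - c x| `^ p)%:E <= B)%E) ->
  (\int[mu]_x (\1_S x * `|v (x + h *: ei i) - v x - h * c x| `^ p)%:E
    <= (`|h| `^ p)%:E * B)%E.
Proof.
move=> p1 vg mc mS B0 hB; have [hv hg _] := vg; have p0 : 0 < p by rewrite (lt_trans ltr01).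
set a := h *: ei i.
pose H (q : RT * V) := u01 q.1 * (\1_S q.2 * `|g (q.2 + (q.1 : R) *: a) - c q.2| `^ p).
have mg := proj1 hg; have mv := proj1 hv.
have mH : measurable_fun setT H.
  apply: measurable_funM; first exact: measurableT_comp measurable_u01 measurable_fst.
  apply: measurable_funM.
    by apply: measurableT_comp measurable_snd; exact: measurable_indic.
  apply: measurable_powR_norm; apply: measurable_funB.
    exact: (measurableT_comp mg (measurable_line a)).
  exact: measurableT_comp mc measurable_snd.
have mHE : measurable_fun setT (EFin \o H) by exact/measurable_EFinP.
have H0 q : 0 <= H q by rewrite mulr_ge0 ?u01_ge0// mulr_ge0 ?powR_ge0// indicE.
have mF := @measurable_fun_fubini_tonelli_F _ _ _ _ _ mu (EFin \o H) mHE (fun q => H0 q).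
have mG := @measurable_fun_fubini_tonelli_G _ _ _ _ _ lam (EFin \o H) mHE (fun q => H0 q).
have key : {ae mu, forall x, ((\1_S x * `|v (x + a) - v x - h * c x| `^ p)%:E <=
    (`|h| `^ p)%:E * \int[lam]_s (H (s, x))%:E)%E}.
  have aeI := ae_itg_line a hg.
  apply: filterS2 (ftc_ae h vg) aeI => x -> ix0.
  have ic : itg lam (fun s => c x * u01 s) by exact: itgZ itg_u01.
  have ix : itg lam (fun s => u01 s * (g (x + (s : R) *: a) - c x)).
    have := itgB ix0 ic; congr (itg _ _); apply/funext => s.
    by rewrite mulrBr (mulrC (c x)).
  have -> : h * avg g a x - h * c x = h * \int[lam]_s (u01 s * (g (x + (s : R) *: a) - c x)).
    rewrite -mulrBr; congr (_ * _); rewrite /avg -[X in _ - X]mulr1 -Rint_u01 -RintZ; last exact: itg_u01.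
    by rewrite -RintB//; apply: eq_Rint => s; rewrite mulrBr (mulrC (c x)).
  rewrite indicE; have [xS|xS] := boolP (x \in S); last first.
    by rewrite mul0r mule_ge0// ?lee_fin ?powR_ge0//; apply: integral_ge0 => s _; rewrite lee_fin.
  rewrite mul1r normrM powRM// EFinM lee_wpmul2l ?lee_fin ?powR_ge0//.
  (* If the p-th power is not integrable along the segment, the right-hand side is infinite. *)
  have [ip|nip] := pselect (itg lam (fun s => u01 s * `|g (x + (s : R) *: a) - c x| `^ p)).
    have := jensen_density p1 u01_ge0 itg_u01 Rint_u01 ix ip.
    rewrite -lee_fin Rint_EFin// => /le_trans; apply.
    by rewrite le_eqVlt; apply/orP; left; apply/eqP; apply: eq_integral => s _; rewrite /H /= indicE xS mul1r.
  suff -> : (\int[lam]_s (H (s, x))%:E = +oo)%E by rewrite leey.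
  have := leey (\int[lam]_s (H (s, x))%:E)%E; rewrite le_eqVlt => /orP[/eqP//|loo].
  exfalso; apply: nip.
  have HE : (fun s => u01 s * `|g (x + (s : R) *: a) - c x| `^ p) = (fun s => H (s, x)).
    by apply/funext => s; rewrite /H /= indicE xS mul1r.
  rewrite HE; apply/itgP; split; first by apply: (measurableT_comp mH); exact: measurable_pair2.
  by under eq_integral do rewrite ger0_norm//.
apply: (@le_trans _ _ (\int[mu]_x ((`|h| `^ p)%:E * \int[lam]_s (H (s, x))%:E))%E).
  apply: ae_ge0_le_integral => //.
  - apply/measurable_EFinP; apply: measurable_funM; first exact: measurable_indic.
    apply: measurable_powR_norm; apply: measurable_funB; last exact: measurable_funM.
    by apply: measurable_funB => //; exact: measurable_shift.
  - move=> x _; rewrite mule_ge0// ?lee_fin ?powR_ge0//; apply: integral_ge0 => s _; rewrite lee_fin//.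
  - exact: measurable_funeM.
  by apply: filterS key => x kx _.
rewrite ge0_integralZl//; last first.
  by move=> x _; apply: integral_ge0 => s _; rewrite lee_fin.
rewrite lee_wpmul2l ?lee_fin ?powR_ge0//.
rewrite -[leLHS](@fubini_tonelli _ _ _ _ _ lam mu (EFin \o H) mHE (fun q => H0 q)).
apply: (@le_trans _ _ (\int[lam]_s ((u01 s)%:E * B))%E).
  apply: ge0_le_integral => //.
  - by move=> s _; apply: integral_ge0 => x _; rewrite lee_fin.
  - by apply: emeasurable_funM => //; apply/measurable_EFinP; exact: measurable_u01.
  move=> s _; rewrite /H /=.
  have [s01|s01] := boolP (0 <= (s : R) <= 1); last first.
    rewrite (eq_integral (cst 0%E)); last by move=> x _; rewrite u01E (negbTE s01) mul0r.
    by rewrite integral0 mule_ge0// lee_fin u01_ge0.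
  rewrite u01E s01 mul1e (le_trans _ (hB _ s01))// le_eqVlt; apply/orP; left; apply/eqP.
  by apply: eq_integral => x _; rewrite mul1r.
rewrite ge0_integralZr//; [|by apply/measurable_EFinP; exact: measurable_u01|by move=> s _; rewrite lee_fin u01_ge0].
by rewrite -Rint_EFin ?Rint_u01 ?mul1e//; exact: itg_u01.
Qed.

Lemma ftc_pow v g i (h p : R) (S : set V) (B : \bar R) : 1 < p -> wd [:: i] v g ->
  measurable S -> (0 <= B)%E ->
  (forall s, 0 <= s <= 1 ->
    (\int[mu]_x (\1_S x * `|g (x + s *: (h *: ei i))| `^ p)%:E <= B)%E) ->
  (\int[mu]_x (\1_S x * `|v (x + h *: ei i) - v x| `^ p)%:E <= (`|h| `^ p)%:E * B)%E.
Proof.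
move=> p1 vg mS B0 hB.
have -> : (\int[mu]_x (\1_S x * `|v (x + h *: ei i) - v x| `^ p)%:E)%E =
    (\int[mu]_x (\1_S x * `|v (x + h *: ei i) - v x - h * (fun=> 0) x| `^ p)%:E)%E.
  by apply: eq_integral => x _; rewrite mulr0 subr0.
apply: (ftc_pow_sub (g := g)) => // s s01.
by under eq_integral do rewrite subr0; exact: hB.
Qed.

End averages.

(** * Morrey's inequality *)

Section morrey.
Variables (R : realType) (N : nat).
Local Notation V := 'rV[R]_N.
Local Notation ei i := (delta_mx ord0 i : V).
Local Notation mu := (lebesgue_rV R N).
Implicit Types (f g G W v : V -> R) (K e h : R) (x y z : V).

Lemma TfB W f g x : bbs W -> L1loc f -> L1loc g ->
  Tf W (fun x => f x - g x) x = Tf W f x - Tf W g x.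
Proof.
move=> bW hf hg; rewrite /Tf -RintB; [|exact: itg_T..].
by apply: eq_Rint => z; rewrite mulrBr.
Qed.

Lemma itg_powD f g (m : R) : 0 <= m -> measurable_fun setT f -> measurable_fun setT g ->
  itg mu (fun x => `|f x| `^ m) -> itg mu (fun x => `|g x| `^ m) ->
  itg mu (fun x => `|f x + g x| `^ m).
Proof.
move=> m0 mf mg i1 i2; apply: (itg_le _ _ (itgZ (2 `^ m) (itgD i1 i2))).
  by apply: measurable_powR_norm; exact: measurable_funD.
by move=> x; rewrite ger0_norm ?powR_ge0// powR_add_le.
Qed.

Lemma itg_powB f g (m : R) : 0 <= m -> measurable_fun setT f -> measurable_fun setT g ->
  itg mu (fun x => `|f x| `^ m) -> itg mu (fun x => `|g x| `^ m) ->
  itg mu (fun x => `|f x - g x| `^ m).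
Proof.
move=> m0 mf mg i1 i2; apply: itg_powD => //.
  exact: measurable_funN.
by under eq_fun do rewrite normrN.
Qed.

Definition wbox h x : R := ((2 * h) ^+ N)^-1 * cB h x.

Lemma wbox_ge0 h x : 0 <= h -> 0 <= wbox h x.
Proof. by move=> h0; rewrite mulr_ge0 ?cB_ge0// invr_ge0 exprn_ge0// mulr_ge0. Qed.

Lemma bbs_wbox h : bbs (wbox h).
Proof. by apply: bbsZ; exact: cB_bbs. Qed.

Lemma wbox_int h : 0 < h -> \int[mu]_x wbox h x = 1.
Proof.
move=> h0; rewrite /wbox RintZ; last exact: itg_cB.
rewrite /cB /Rintegral integral_indic//; last exact: measurable_norm_ball.
rewrite setIT [X in fine X](lebesgue_norm_ball N (ltW h0)) /= mulVf// expf_neq0//.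
by rewrite mulf_neq0// gt_eqF.
Qed.

(** Jensen's inequality for the uniform density, which is then replaced by its maximum (2 h)^-N. The
    condition m > N will compensate for this loss. *)
Lemma wbox_pow_le f x (m h : R) : 1 < m -> 0 < h -> L1loc f ->
  itg mu (fun x => `|f x| `^ m) ->
  `|Tf (wbox h) f x| `^ m <= ((2 * h) ^+ N)^-1 * \int[mu]_x `|f x| `^ m.
Proof.
move=> m1 h0 hf im; have mf := proj1 hf.
have ims : itg mu (fun z => `|f (z + x)| `^ m).
  exact: (itg_shift x im).
have mf' : measurable_fun setT (fun z => f (z + x)) by exact: measurable_shift.
have iw : itg mu (fun z => wbox h z * `|f (z + x)| `^ m).
  have := itg_T x (bbs_wbox h) (itg_L1loc im); exact.
apply: (le_trans (jensen_density (f := fun z => f (z + x)) m1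
  (fun z => wbox_ge0 z (ltW h0)) (bbs_itg (bbs_wbox h)) (wbox_int h0) _ iw)).
  exact: itg_T (bbs_wbox h) hf.
have -> : \int[mu]_x `|f x| `^ m = \int[mu]_z `|f (z + x)| `^ m.
  by rewrite (@Rint_shift _ _ (fun z => `|f z| `^ m) x)//; exact: itg_measurable im.
rewrite -RintZ//; apply: Rint_le => //; first exact: itgZ.
move=> z; rewrite /wbox -mulrA ler_wpM2l ?invr_ge0 ?exprn_ge0 ?mulr_ge0 ?(ltW h0)//.
by rewrite ler_piMl ?cB_le1// powR_ge0.
Qed.

Section fixed_function.
Variables (v : V -> R) (g : 'I_N -> V -> R) (m : R).
Hypotheses (m1 : 1 < m) (Nm : N%:R < m) (hv : L1loc v)
  (iv : itg mu (fun x => `|v x| `^ m))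
  (vg : forall i, wd [:: i] v (g i)) (ig : forall i, itg mu (fun x => `|g i x| `^ m)).

Let m0 : 0 < m := lt_trans ltr01 m1.

Let Dv y x := `|v (x + y) - v x| `^ m.

Let mDv y : measurable_fun setT (Dv y).
Proof.
apply: measurable_powR_norm; apply: measurable_funB; last exact: (proj1 hv).
exact: measurable_shift (proj1 hv).
Qed.

Let iDv y : itg mu (Dv y).
Proof.
apply: itg_powB (ltW m0) _ (proj1 hv) _ iv; first exact: measurable_shift (proj1 hv).
exact: (itg_shift y iv).
Qed.

Lemma difference_pow1 i (c : R) :
  \int[mu]_x Dv (c *: ei i) x <= `|c| `^ m * \int[mu]_x `|g i x| `^ m.
Proof.
rewrite -lee_fin EFinM !Rint_EFin//.
have := @ftc_pow R N v (g i) i c m setT (\int[mu]_x (`|g i x| `^ m)%:E)%E m1 (vg i)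
  measurableT _ _.
under [X in _ -> _ -> (X <= _)%E]eq_integral do rewrite indicT mul1r.
apply.
  by apply: integral_ge0 => x _; rewrite lee_fin powR_ge0.
move=> s _; under eq_integral do rewrite indicT mul1r.
rewrite (@ge0_integral_addv R N (s *: (c *: ei i)) (fun x => (`|g i x| `^ m)%:E))//.
by apply/measurable_EFinP; exact: itg_measurable (ig i).
Qed.

(** The point y is reached one coordinate at a time. Each increment is evaluated at points
    translated by the previous ones, which does not change its integral over the whole space. *)
Lemma difference_pow_seq (s : seq 'I_N) : exists2 C, 0 <= C & forall y,
  \int[mu]_x Dv (\sum_(i <- s) y ord0 i *: ei i) x <= C * `|y| `^ m.
Proof.
elim: s => [|i s [C C0 IH]].
  exists 0 => // y; rewrite big_nil mul0r Rint_fun0// => x.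
  by rewrite /Dv addr0 subrr normr0 powR0// gt_eqF.
set Gi := \int[mu]_x `|g i x| `^ m.
have Gi0 : 0 <= Gi by apply: Rint_ge0 => x; exact: powR_ge0.
exists (2 `^ m * (Gi + C)); first by rewrite mulr_ge0 ?powR_ge0// addr_ge0.
move=> y; rewrite big_cons; set Y := \sum_(j <- s) _.
have h x : Dv (y ord0 i *: ei i + Y) x <= 2 `^ m * (Dv (y ord0 i *: ei i) (x + Y) + Dv Y x).
  rewrite /Dv; apply: le_trans (powR_add_le _ _ (ltW m0)).
  by rewrite addrA (addrAC x) addrA subrK.
have i1 := itg_shift Y (iDv (y ord0 i *: ei i)).
apply: (@le_trans _ _ (\int[mu]_x (2 `^ m * (Dv (y ord0 i *: ei i) (x + Y) + Dv Y x)))).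
  by apply: Rint_le => //; apply: itgZ; exact: itgD.
rewrite RintZ; last exact: itgD.
rewrite RintD// -mulrA ler_wpM2l ?powR_ge0// mulrDl lerD//; last exact: IH.
rewrite (@Rint_shift _ _ (Dv (y ord0 i *: ei i)) Y)//.
apply: (le_trans (difference_pow1 _ _)); rewrite mulrC ler_wpM2l//.
by rewrite ge0_ler_powR ?nnegrE ?(ltW m0)// coord_le_norm.
Qed.

Lemma difference_pow : exists2 C, 0 <= C & forall y, \int[mu]_x Dv y x <= C * `|y| `^ m.
Proof.
have [C C0 h] := difference_pow_seq (index_enum 'I_N); exists C; [exact: C0|move=> y].
by move: (h y); rewrite (_ : \sum_(i <- _) _ = y) //; exact: esym (row_sum_delta y).
Qed.

(** Jensen's inequality bounds the m-th power by the mean over |y| <= h of |v(x + y) - v(x)|^m.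
    Integrating in x first leaves C |y|^m <= C h^m. *)
Lemma wbox_diff : exists2 C, 0 <= C & forall h, 0 < h ->
  itg mu (fun x => `|Tf (wbox h) v x - v x| `^ m) /\
  \int[mu]_x `|Tf (wbox h) v x - v x| `^ m <= C * h `^ m.
Proof.
have [C C0 hC] := difference_pow; exists C => // h h0.
pose Q (p : V * V) := wbox h p.1 * Dv p.1 p.2.
have mv := proj1 hv; have bw := bbs_wbox h; have iw := bbs_itg bw.
have mQ : measurable_fun setT Q.
  apply: measurable_funM; first exact: measurableT_comp (proj1 bw) measurable_fst.
  apply: measurable_powR_norm; apply: measurable_funB.
    apply: (measurableT_comp mv).
    by under eq_fun do rewrite addrC; exact: measurable_add2.
  exact: measurableT_comp mv measurable_snd.
have QE y : \int[mu]_x Q (y, x) = wbox h y * \int[mu]_x Dv y x.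
  exact: (RintZ (wbox h y) (iDv y)).
have Qle y : wbox h y * \int[mu]_x Dv y x <= C * h `^ m * wbox h y.
  rewrite mulrC /wbox cBE; case: ifPn => yh; last by rewrite !mulr0.
  rewrite ler_wpM2r ?mulr1 ?invr_ge0 ?exprn_ge0 ?mulr_ge0 ?(ltW h0)//.
  apply: (le_trans (hC y)); rewrite ler_wpM2l//.
  by rewrite ge0_ler_powR ?nnegrE ?(ltW m0)// (ltW h0).
have iQ : itg (mu \x mu)%E Q.
  apply: (itg_prod (g := fun y => C * h `^ m * wbox h y)) => //; first exact: itgZ.
  apply: aeW => y.
  have -> : (\int[mu]_x `|Q (y, x)|%:E)%E = (\int[mu]_x (Q (y, x))%:E)%E.
    by apply: eq_integral => x _; rewrite ger0_norm// mulr_ge0 ?wbox_ge0 ?powR_ge0 ?(ltW h0).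
  rewrite -(@Rint_EFin _ _ _ mu (fun x => Q (y, x))) ?lee_fin ?QE//.
  exact: (itgZ (wbox h y) (iDv y)).
have [iF EF] := Rfubini_F iQ; have [iG EG] := Rfubini_G iQ.
have pw x : `|Tf (wbox h) v x - v x| `^ m <= \int[mu]_y Q (y, x).
  have i1 := itg_T x bw hv.
  have i2 : itg mu (fun y => v x * wbox h y) by exact: itgZ.
  have -> : Tf (wbox h) v x - v x = \int[mu]_y (wbox h y * (v (y + x) - v x)).
    transitivity (\int[mu]_y (wbox h y * v (y + x) - v x * wbox h y)).
      by rewrite RintB// RintZ// wbox_int// mulr1.
    by apply: eq_Rint => y; rewrite mulrBr (mulrC (v x)).
  have -> : \int[mu]_y Q (y, x) = \int[mu]_y (wbox h y * `|v (y + x) - v x| `^ m).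
    by apply: eq_Rint => y; rewrite /Q /Dv/= (addrC x).
  apply: jensen_density => //.
  - by move=> y; rewrite wbox_ge0 ?(ltW h0).
  - exact: wbox_int.
  - have := itgB i1 i2; congr (itg _ _); apply/funext => y.
    by rewrite mulrBr (mulrC (v x)).
  - apply: (itg_le (g := fun y => 2 `^ m * (wbox h y * `|v (y + x)| `^ m)
        + 2 `^ m * `|v x| `^ m * wbox h y)).
    + apply: measurable_funM; first exact: (proj1 bw).
      apply: measurable_powR_norm; apply: measurable_funB => //.
      exact: measurable_shift.
    + move=> y; rewrite ger0_norm; last first.
        by apply: mulr_ge0; [exact: wbox_ge0 (ltW h0)|exact: powR_ge0].
      have := powR_add_le (v (y + x)) (- v x) (ltW m0); rewrite normrN.
      move=> /(ler_wpM2l (wbox_ge0 y (ltW h0))) /le_trans; apply.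
      by rewrite le_eqVlt; apply/orP; left; apply/eqP; ring.
    + apply: itgD; last exact: itgZ.
      by apply: itgZ; exact: (itg_T x bw (itg_L1loc iv)).
have mT : measurable_fun setT (fun x => `|Tf (wbox h) v x - v x| `^ m).
  apply: measurable_powR_norm; apply: measurable_funB => //.
  by apply: continuous_rV_measurable; exact: Tf_continuous.
have iT : itg mu (fun x => `|Tf (wbox h) v x - v x| `^ m).
  apply: (itg_le mT _ iG) => x; rewrite (ger0_norm (powR_ge0 _ _)).
  exact: pw.
split=> //; apply: (le_trans (Rint_le iT iG pw)); rewrite EG -EF.
have -> : C * h `^ m = \int[mu]_y (C * h `^ m * wbox h y) by rewrite RintZ// wbox_int// mulr1.
by apply: Rint_le => //; [exact: itgZ|move=> y; rewrite QE].
Qed.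

(* Averages over the boxes of sides 2^-k and 2^-(k+1) differ by O(t^k) with
   t = (2^N 2^-m)^(1/m) < 1, and they converge to v in L^m. *)
Lemma morrey_bounded : exists M : R, {ae mu, forall x, `|v x| <= M}.
Proof.
have [C C0 hC] := wbox_diff.
have bw h := bbs_wbox h.
have cT h : continuous (Tf (wbox h) v) by exact: Tf_continuous.
(* The bound given by [wbox_pow_le] for the function [Tf (wbox k) v - v], whose m-th power has
   integral at most C k^m by [wbox_diff]. *)
pose A h k : R := (((2 * h) ^+ N)^-1 * (C * k `^ m)) `^ m^-1.
have hA h k x : 0 < h -> 0 < k ->
    `|Tf (wbox h) (Tf (wbox k) v) x - Tf (wbox h) v x| <= A h k.
  move=> h0 k0; rewrite -TfB//; last exact: continuous_L1loc.
  have hf : L1loc (fun x => Tf (wbox k) v x - v x).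
    by apply: L1locB => //; exact: continuous_L1loc.
  apply: powR_lt_inv => //.
    by rewrite mulr_ge0 ?invr_ge0 ?exprn_ge0 ?mulr_ge0 ?powR_ge0 ?(ltW h0).
  have [i1 i2] := hC k k0.
  apply: (le_trans (wbox_pow_le x m1 h0 hf i1)); rewrite ler_wpM2l//.
  by rewrite invr_ge0 exprn_ge0// mulr_ge0// (ltW h0).
(* Averages over the two cubes commute, so each simple average is compared with the same double
   average. *)
have hAA h k x : 0 < h -> 0 < k -> `|Tf (wbox h) v x - Tf (wbox k) v x| <= A h k + A k h.
  move=> h0 k0; have := lerD (hA h k x h0 k0) (hA k h x k0 h0); apply: le_trans.
  rewrite (Tf_comm x (bw h) (bw k) hv).
  move: (Tf (wbox k) (Tf (wbox h) v) x) (Tf (wbox h) v x) (Tf (wbox k) v x) => c1 a1 b1.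
  by rewrite (_ : a1 - b1 = (c1 - b1) - (c1 - a1)) ?(le_trans (ler_normB _ _)) 1?addrC//; ring.
pose b : R := 2^-1 `^ m.
have b0 : 0 < b by rewrite powR_gt0.
pose hh (k : nat) : R := 2^-1 ^+ k.
have hh0 k : 0 < hh k by rewrite exprn_gt0.
have hhm k : hh k `^ m = b ^+ k.
  have h2 : 0 <= 2^-1 :> R by rewrite invr_ge0.
  by rewrite /hh /= -(powR_mulrn k h2) powRAC powR_mulrn// ltW.
pose r : R := 2 ^+ N * b.
have r0 : 0 < r by rewrite mulr_gt0// exprn_gt0.
(* This is where m > N is used. *)
have r1 : r < 1.
  rewrite /r /b -ltr_pdivlMl ?exprn_gt0// mulr1 -exprVn -powR_mulrn ?invr_ge0//.
  have h2 : 2^-1 < 1 :> R by lra.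
  have h20 : 0 < 2^-1 :> R by rewrite invr_gt0.
  have ln2 : ln (2^-1 : R) < 0 by apply: ln_lt0; rewrite h20 h2.
  by rewrite /powR !(gt_eqF h20) ltr_expR ltr_nM2r.
have b1 : b <= 1.
  by apply: le_trans (ltW r1); rewrite /r ler_peMl ?(ltW b0)// exprn_ege1// ler1n.
have hN k : (hh k ^+ N)^-1 = (2 ^+ N) ^+ k.
  by rewrite /hh -!exprM -exprVn invrK mulnC.
pose t : R := r `^ m^-1.
have t0 : 0 < t by rewrite powR_gt0.
have t1 : t < 1.
  have := @gt0_ltr_powR R m^-1 _ r 1; rewrite powR1; apply=> //; rewrite ?nnegrE ?invr_gt0 ?(ltW r0)//.
pose c : R := C `^ m^-1.
have c0 : 0 <= c by exact: powR_ge0.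
have tk k : (r ^+ k) `^ m^-1 = t ^+ k by rewrite -powR_mulrn ?(ltW r0)// powRAC powR_mulrn// ltW.
have key h k (B : R) : 0 < h -> 0 < k -> ((2 * h) ^+ N)^-1 * (C * k `^ m) <= C * B -> 0 <= B ->
    A h k <= c * B `^ m^-1.
  move=> h0 k0 le B0; rewrite /c -powRM//.
  rewrite /A ge0_ler_powR ?nnegrE ?invr_ge0 ?(ltW m0)//; last by rewrite mulr_ge0.
  by rewrite mulr_ge0 ?invr_ge0 ?exprn_ge0 ?mulr_ge0 ?powR_ge0// (ltW h0).
have step k x : `|Tf (wbox (hh k.+1)) v x - Tf (wbox (hh k)) v x| <= 2 * c * t ^+ k.
  apply: (le_trans (hAA _ _ _ (hh0 _) (hh0 _))).
  have -> : 2 * c * t ^+ k = c * t ^+ k + c * t ^+ k by ring.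
  rewrite -tk; apply: lerD; apply: key => //; rewrite ?exprn_ge0 ?(ltW r0)// hhm.
  - have -> : 2 * hh k.+1 = hh k by rewrite /hh exprS mulrA divff// mul1r.
    by rewrite hN mulrCA ler_wpM2l// /r exprMn.
  - rewrite exprMn invfM hN -mulrA mulrCA /r exprMn exprS !mulrA -!mulrA.
    have Pb : (2 ^+ N)^-1 * b <= 1.
      apply: mulr_ile1; [by rewrite invr_ge0 exprn_ge0|exact: ltW b0| |exact: b1].
      by rewrite invf_le1 ?exprn_gt0// exprn_ege1// ler1n.
    have : 0 <= C * ((2 ^+ N) ^+ k * b ^+ k).
      by rewrite !mulr_ge0// ?exprn_ge0 ?exprn_ge0 ?(ltW b0).
    move: Pb ((2 ^+ N) ^+ k) (b ^+ k); move: (2 ^+ N)^-1 => P Pb A1 A2 A0.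
    by apply: le_trans (ler_piMl A0 Pb); rewrite le_eqVlt; apply/orP; left; apply/eqP; ring.
have bnd k x : `|Tf (wbox (hh k)) v x - Tf (wbox (hh 0)) v x| <= 2 * c * ((1 - t ^+ k) / (1 - t)).
  elim: k => [|k IH]; first by rewrite subrr normr0 expr0 subrr mul0r mulr0.
  apply: (le_trans (ler_distD (Tf (wbox (hh k)) v x) _ _)).
  apply: (le_trans (lerD (step k x) IH)).
  rewrite -mulrDr ler_wpM2l ?mulr_ge0// le_eqVlt; apply/orP; left; apply/eqP.
  by rewrite exprS; field; rewrite subr_eq0 eq_sym lt_eqF.
pose M0 : R := (((2 * hh 0) ^+ N)^-1 * \int[mu]_x `|v x| `^ m) `^ m^-1.
have hM0 x : `|Tf (wbox (hh 0)) v x| <= M0.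
  apply: powR_lt_inv => //.
    rewrite mulr_ge0 ?invr_ge0 ?exprn_ge0 ?mulr_ge0 ?(ltW (hh0 0%N))//.
    by apply: Rint_ge0 => z; exact: powR_ge0.
  exact: wbox_pow_le.
pose M := M0 + 2 * c / (1 - t).
have hM k x : `|Tf (wbox (hh k)) v x| <= M.
  rewrite -[X in `|X|](subrK (Tf (wbox (hh 0)) v x)) (le_trans (ler_normD _ _))//.
  rewrite addrC lerD// (le_trans (bnd k x))// mulrA ler_pM2r ?invr_gt0 ?subr_gt0//.
  by rewrite ler_piMr ?mulr_ge0// lerBlDr lerDl exprn_ge0 ?(ltW t0).
exists M.
(* All the averages are bounded by M, so the excess of |v| over M is at most |v - average|, whose
   m-th power has integral O(b^k). Hence the excess vanishes almost everywhere. *)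
pose psi x := (Num.max (`|v x| - M) 0) `^ m.
have mv := proj1 hv.
have hpsi k x : psi x <= `|Tf (wbox (hh k)) v x - v x| `^ m.
  rewrite /psi ge0_ler_powR ?nnegrE ?(ltW m0) ?le_max ?lexx ?orbT//.
  rewrite ge_max normr_ge0 andbT distrC.
  by apply: (le_trans _ (lerB_normD _ _)); rewrite normrN lerB.
have psi0 x : 0 <= psi x by exact: powR_ge0.
have mpsi : measurable_fun setT psi.
  have -> : psi = fun x => `|Num.max (`|v x| - M) 0| `^ m.
    by apply/funext => x; rewrite ger0_norm// le_max lexx orbT.
  apply: measurable_powR_norm; apply: measurable_maxr => //.
  by apply: measurable_funB => //; exact: measurableT_comp.
have ipsi : itg mu psi.
  by apply: (itg_le mpsi _ (hC _ (hh0 0%N)).1) => x; rewrite (ger0_norm (psi0 x)); exact: hpsi.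
have I0 : \int[mu]_x psi x = 0.
  apply/eqP; rewrite eq_le Rint_ge0 ?andbT//.
  apply/ler_addgt0Pr => e e0; rewrite add0r.
  have C1 : 0 < C + 1 by rewrite ltr_pwDr.
  have : b ^+ k @[k --> \oo] --> 0.
    by apply: cvg_expr; rewrite ger0_norm ?(ltW b0)//; apply: le_lt_trans r1; rewrite /r ler_peMl ?(ltW b0)// exprn_ege1// ler1n.
  move=> /cvgr0_norm_le /(_ _ (divr_gt0 e0 C1)) [n _ /(_ n (leqnn n))] /=.
  rewrite ger0_norm ?exprn_ge0 ?(ltW b0)// ler_pdivlMr// => be.
  have [i1 i2] := hC _ (hh0 n).
  apply: (le_trans (Rint_le ipsi i1 (hpsi n))); apply: (le_trans i2); rewrite hhm.
  by apply: le_trans be; rewrite mulrC mulrDr mulr1 lerDl exprn_ge0// ltW.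
have := Rint_eq0_ae ipsi psi0 I0; apply: filterS => x /powR_eq0_eq0 h.
have : `|v x| - M <= Num.max (`|v x| - M) 0 by rewrite le_max lexx.
by rewrite h subr_le0.
Qed.

End fixed_function.
End morrey.

(** * Weak derivatives on open sets *)

Section weak_derivatives.
Variables (R : realType) (N : nat).
Local Notation V := 'rV[R]_N.
Local Notation ei i := (delta_mx ord0 i : V).
Local Notation mu := (lebesgue_rV R N).
Implicit Types (f g G W v u phi chi : V -> R) (K e : R) (x y z : V) (O : set V).

Lemma restrictE f O x : (f \_ O) x = if x \in O then f x else 0.
Proof. by rewrite patchE. Qed.

Lemma Lp_itg O (a : R) f : 1 <= a -> Lp O a f ->
  measurable_fun setT (f \_ O) /\ itg mu (fun x => `|(f \_ O) x| `^ a).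
Proof.
move=> a1 h; split; last exact: Lfun_integrable h.
by move: h; rewrite /Lp inE => /andP[/[!inE]/=].
Qed.

Lemma Lp1_itg O f : Lp O 1 f -> itg mu (f \_ O).
Proof. by move=> h; apply/Lfun1_integrable. Qed.

Lemma L1loc_pow f (a : R) : 1 <= a -> measurable_fun setT f ->
  itg mu (fun x => `|f x| `^ a) -> L1loc f.
Proof.
move=> a1 mf ia.
have h : L1loc (fun x => 1 + `|f x| `^ a).
  apply: L1locD (itg_L1loc ia).
  by apply: (@L1loc_bounded _ _ _ 1) => // x; rewrite normr1.
apply: (L1loc_le mf _ h) => x.
have [l1|l1] := leP `|f x| 1; first by rewrite (le_trans l1)// lerDl powR_ge0.
rewrite (@le_trans _ _ (`|f x| `^ a))// ?lerDr//.
by rewrite -{1}(@powRr1 _ `|f x|)// ler_powR// ltW.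
Qed.

Lemma Lp_L1loc O (a : R) f : 1 <= a -> Lp O a f -> L1loc (f \_ O).
Proof. by move=> a1 /(Lp_itg a1)[mf ia]; exact: L1loc_pow ia. Qed.

Lemma Lp_loc_L1loc f : Lp_loc setT 1 f -> L1loc f.
Proof.
move=> h; pose B (n : nat) : set V := [set x | `|x| <= n%:R].
have iB n : itg mu (f \_ (B n)).
  by apply: Lp1_itg; apply: h => //; exact: compact_norm_ball.
split.
  apply: (@measurable_fun_cvg _ _ _ _ (fun n => f \_ (B n))).
    by move=> n; exact: itg_measurable (iB n).
  move=> x _; apply: cvg_near_cst; have [n hn] := norm_lt_nat x.
  exists n => // m /= nm; rewrite restrictE mem_set//= /B /=.
  by rewrite (le_trans hn)// ler_nat.
move=> K.
have : itg mu (f \_ [set x | `|x| <= K]).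
  by apply: Lp1_itg; apply: h => //; exact: compact_norm_ball.
congr (itg _ _); apply/funext => x; rewrite restrictE cBE.
by case: ifPn => [/set_mem/= ->|/negP]; rewrite ?mul1r// inE /= => /negP/negbTE ->; rewrite mul0r.
Qed.

Lemma Rint_restrict O f phi :
  \int[mu]_(x in O) (f x * phi x) = \int[mu]_x ((f \_ O) x * phi x).
Proof.
rewrite Rintegral_mkcond; apply: eq_Rint => x; rewrite !restrictE.
by case: ifP => // _; rewrite mul0r.
Qed.

Lemma weak_deriv_wd s f g : weak_deriv setT s f g -> wd s f g.
Proof.
move=> [hf hg h]; split; [exact: Lp_loc_L1loc|exact: Lp_loc_L1loc|].
by move=> phi /tf_test_function; exact: h.
Qed.

Lemma wderiv_wd s f : (exists g, weak_deriv setT s f g) -> wd s f (wderiv s f).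
Proof. by move=> /getPex; exact: weak_deriv_wd. Qed.

Lemma pderivs_pair (i j : 'I_N) phi : pderivs [:: j; i] phi = pderivs [:: j] (pderiv i phi).
Proof. by []. Qed.

(** The second derivatives are given as derivatives of f. Testing the first derivative with the i-th
    derivative of phi exhibits h as a derivative of g. *)
Lemma wd_iter i j f g h : wd [:: j] f g -> wd [:: j; i] f h -> wd [:: i] g h.
Proof.
move=> [Lf Lg hg] [_ Lh hh]; split => // phi tphi.
have := hh _ tphi; rewrite pderivs_pair hg; last exact: tf_pderiv.
rewrite /= expr1 expr2 mulN1r mulrNN mulr1 mul1r => <-.
by rewrite mulN1r opprK.
Qed.

Lemma test_function_pderiv O phi i : test_function O phi -> test_function O (pderiv i phi).
Proof.
move=> [sp cp hO]; apply: (test_function_sub (A := closure [set x | phi x != 0])) => //.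
  exact: smooth_pderiv.
move=> x; apply: contraPP => nx; apply/negP; rewrite negbK; apply/eqP.
apply: (@pderiv_eq0_open _ _ _ (~` closure [set x | phi x != 0])) => //.
  by apply: closed_openC; exact: closed_closure.
by move=> y; apply: contra_notP => /eqP py; exact: subset_closure.
Qed.

Lemma test_function_mul O chi phi : test_function O chi -> smooth phi ->
  test_function O (fun x => chi x * phi x).
Proof.
move=> [sp cp hO] sphi; apply: (test_function_sub (A := closure [set x | chi x != 0])) => //.
  exact: smoothM.
move=> x; rewrite mulf_eq0 negb_or => /andP[cx _]; exact: subset_closure.
Qed.

Lemma weak_deriv_iter O i j f g h : weak_deriv O [:: j] f g ->
  weak_deriv O [:: j; i] f h -> weak_deriv O [:: i] g h.
Proof.
move=> [Lf Lg hg] [_ Lh hh]; split => // phi tphi.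
have := hh _ tphi; rewrite pderivs_pair hg; last exact: test_function_pderiv.
rewrite /= expr1 expr2 mulN1r mulrNN mulr1 mul1r => <-.
by rewrite mulN1r opprK.
Qed.

Lemma L1loc_bbs_mul W f : bbs W -> L1loc f -> L1loc (fun x => W x * f x).
Proof. by move=> bW hf; apply: itg_L1loc; exact: itg_T0. Qed.

(** The product rule, in a form that carries a weak derivative on O to the whole space, where
    Morrey's inequality is available. *)
Lemma cutoff_wd O i f g chi : L1loc (f \_ O) -> L1loc (g \_ O) ->
  weak_deriv O [:: i] f g -> test_function O chi ->
  wd [:: i] (fun x => chi x * (f \_ O) x)
            (fun x => chi x * (g \_ O) x + pderiv i chi x * (f \_ O) x).
Proof.
move=> Lf Lg [_ _ h] tc; have tfc := test_function_tf tc; have sc := proj1 tfc.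
have bc := tf_bbs tfc; have bdc := tf_bbs (tf_pderiv i tfc).
split; [exact: L1loc_bbs_mul|by apply: L1locD; exact: L1loc_bbs_mul|].
move=> phi tphi; have sphi := proj1 tphi.
have := h _ (test_function_mul tc sphi).
have -> : pderivs [:: i] (fun x => chi x * phi x) =
  fun x => chi x * pderiv i phi x + phi x * pderiv i chi x by exact: pderivM.
have -> : (-1) ^+ size [:: i] = -1 :> R by rewrite /= expr1.
rewrite (Rint_restrict O f) (Rint_restrict O g).
have bcdp : bbs (fun x => chi x * pderiv i phi x).
  exact: tf_bbs (tf_mul sc (tf_pderiv i tphi)).
have bpdc : bbs (fun x => phi x * pderiv i chi x).
  exact: tf_bbs (tf_mul sphi (tf_pderiv i tfc)).
have bcp : bbs (fun x => chi x * phi x) by exact: tf_bbs (tf_mul sc tphi).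
have i1 := itg_T0 bcdp Lf; have i2 := itg_T0 bpdc Lf; have i3 := itg_T0 bcp Lg.
have -> : \int[mu]_x ((f \_ O) x * (chi x * pderiv i phi x + phi x * pderiv i chi x))
  = \int[mu]_x (chi x * pderiv i phi x * (f \_ O) x) + \int[mu]_x (phi x * pderiv i chi x * (f \_ O) x).
  by rewrite -RintD//; apply: eq_Rint => x; rewrite mulrC mulrDl.
have -> : \int[mu]_x ((g \_ O) x * (chi x * phi x)) = \int[mu]_x (chi x * phi x * (g \_ O) x).
  by apply: eq_Rint => x; rewrite mulrC.
have -> : \int[mu]_x (chi x * (f \_ O) x * pderiv i phi x) = \int[mu]_x (chi x * pderiv i phi x * (f \_ O) x).
  by apply: eq_Rint => x; rewrite mulrAC.
have -> : \int[mu]_x ((chi x * (g \_ O) x + pderiv i chi x * (f \_ O) x) * phi x) =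
  \int[mu]_x (chi x * phi x * (g \_ O) x) + \int[mu]_x (phi x * pderiv i chi x * (f \_ O) x).
  rewrite -RintD//; apply: eq_Rint => x; rewrite mulrDl mulrAC; congr (_ + _).
  by rewrite mulrC mulrA.
move: (\int[mu]_x _) (\int[mu]_x _) (\int[mu]_x _) => A B C.
by move=> /eqP; rewrite eq_sym -subr_eq => /eqP <-; ring.
Qed.

(** All mollifications of G vanish, hence by [Tf_comm] so do those of the continuous function
    [Tf W G], and therefore its value at 0. *)
Lemma test_ae_eq0 G : L1loc G -> (forall phi, tf phi -> \int[mu]_x (G x * phi x) = 0) ->
  {ae mu, forall x, G x = 0}.
Proof.
move=> hG h; apply: ae_eq0_pairing => // W bW.
have T0 k : Tf (moll k) G = fun=> 0.
  apply/funext => x; rewrite TfE//; last exact: tf_bbs (tf_moll R N k).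
  have := h _ (tf_shift (- x) (tf_moll R N k)); under eq_Rint do rewrite mulrC.
  by [].
have cT : continuous (Tf W G) by exact: Tf_continuous.
apply/eqP; rewrite -normr_le0; apply/ler_addgt0Pr => e e0; rewrite add0r.
have [n /(_ n (leqnn n))] := moll_near 0 cT e0.
rewrite Tf_comm//; last exact: tf_bbs (tf_moll R N n).
rewrite T0 Tf0; have -> : Tf W (fun=> 0) 0 = 0.
  by rewrite /Tf; apply: Rint_fun0 => x; rewrite mulr0.
by rewrite subr0.
Qed.

(** Compares a derivative known only locally with a global one: products of chi with test functions
    are admissible for both. *)
Lemma weak_deriv_unique O s f g g' chi : L1loc (g \_ O) ->
  weak_deriv O s f g -> wd s f g' -> test_function O chi ->
  {ae mu, forall x, chi x * ((g \_ O) x - g' x) = 0}.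
Proof.
move=> Lg [_ _ h] [Lf Lg' h'] tc; have tfc := test_function_tf tc.
have [_ _ sO] := tc; have bc := tf_bbs tfc.
apply: test_ae_eq0.
  by apply: L1loc_bbs_mul => //; exact: L1locB.
move=> phi tphi; have sphi := proj1 tphi.
have tcp := test_function_mul tc sphi.
have tfcp := test_function_tf tcp; have bcp := tf_bbs tfcp.
have -> : \int[mu]_x (chi x * ((g \_ O) x - g' x) * phi x) =
  \int[mu]_x (chi x * phi x * (g \_ O) x) - \int[mu]_x (chi x * phi x * g' x).
  rewrite -RintB; [|exact: itg_T0..].
  by apply: eq_Rint => x; rewrite mulrAC mulrBr.
have e1 := h _ tcp; have e2 := h' _ tfcp.
(* The support of chi lies in O, so the derivatives of chi phi vanish off O and the integral over O
   is one over the whole space. *)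
have e3 : \int[mu]_(x in O) (f x * pderivs s (fun x => chi x * phi x) x)
  = \int[mu]_x (f x * pderivs s (fun x => chi x * phi x) x).
  rewrite Rint_restrict; apply: eq_Rint => x; rewrite restrictE.
  case: ifPn => // /negP; rewrite inE => Ox; rewrite mul0r.
  rewrite (@pderivs_eq0_open _ _ _ (~` closure [set x | chi x != 0])) ?mulr0//.
  - by apply: closed_openC; exact: closed_closure.
  - by move=> /sO.
  - move=> y /= cy; have -> : chi y = 0; last by rewrite mul0r.
    by apply: contra_notP cy => /eqP cy; exact: subset_closure.
move: e1; rewrite e3 e2 => /(mulfI _); rewrite signr_eq0 => /(_ isT).
rewrite (Rint_restrict O g).
have -> : \int[mu]_x (chi x * phi x * (g \_ O) x) = \int[mu]_x ((g \_ O) x * (chi x * phi x)).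
  by apply: eq_Rint => x; rewrite mulrC.
have -> : \int[mu]_x (chi x * phi x * g' x) = \int[mu]_x (g' x * (chi x * phi x)).
  by apply: eq_Rint => x; rewrite mulrC.
by move=> ->; rewrite subrr.
Qed.

End weak_derivatives.

(** * Local boundedness away from the origin *)

Section annuli.
Variables (R : realType) (N : nat).
Local Notation V := 'rV[R]_N.
Local Notation ei i := (delta_mx ord0 i : V).
Local Notation mu := (lebesgue_rV R N).
Implicit Types (f g G F u phi chi : V -> R) (K r t : R) (x y z : V) (O : set V).

(** The square of the outer radius. The shift by 2 keeps it at least 4, which separates the
    transition intervals [1 / kap, 2 / kap] and [kap, 2 kap] of [theta]. *)
Definition kap (n : nat) : R := n.+2%:R ^+ 2.

Lemma kap_ge4 n : 4 <= kap n.
Proof.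
have h : 2 <= n.+2%:R :> R by rewrite ler_nat.
by rewrite /kap expr2 (_ : 4 = 2 * 2) ?ler_pM// -natrM.
Qed.

Lemma kap_gt0 n : 0 < kap n.
Proof. by apply: lt_le_trans (kap_ge4 n). Qed.

Lemma kapV n : 0 < (kap n)^-1 <= 1.
Proof.
rewrite invr_gt0 kap_gt0/= invf_le1 ?kap_gt0//.
by apply: le_trans (kap_ge4 n); rewrite ler1n.
Qed.

Lemma kap_ge_nat n : n%:R <= kap n.
Proof.
rewrite /kap -natrX ler_nat expnS expn1 (leq_trans (leqW (leqnSn n)))//.
exact: leq_pmulr.
Qed.

Definition theta n t := cutoff ((kap n)^-1 * t) - cutoff (kap n * t).

Lemma smooth1_theta n : smooth1 (theta n).
Proof.
have sc := @smooth1_cutoff R.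
have comp a k : D1k k (fun t : R => cutoff (a * t)).
  have -> : (fun t => cutoff (a * t)) = fun t : R => cutoff (a * t + 0).
    by apply/funext => t; rewrite addr0.
  exact: (D1k_comp (D1k_affine _ _ _) (sc k)).
move=> k; rewrite /theta (_ : (fun t => _) =
    fun t => cutoff ((kap n)^-1 * t) + (-1) * cutoff (kap n * t)); last first.
  by apply/funext => t; rewrite mulN1r.
apply: D1kD => //; apply: D1kM => //; exact: D1k_cst.
Qed.

Lemma theta_eq0_le n t : t <= (kap n)^-1 -> theta n t = 0.
Proof.
move=> h; have k0 := kap_gt0 n; have /andP[v0 v1] := kapV n.
rewrite /theta !cutoff_le1E ?subrr//.
  by rewrite -ler_pdivlMl// mulr1.
have [t0|t0] := leP t 0.
  by rewrite (@le_trans _ _ 0)// mulr_ge0_le0// (ltW v0).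
by rewrite mulr_ile1 ?(ltW v0) ?(ltW t0)// (le_trans h).
Qed.

Lemma theta_eq0_ge n t : 2 * kap n <= t -> theta n t = 0.
Proof.
move=> h; have k0 := kap_gt0 n; have k4 := kap_ge4 n.
rewrite /theta !cutoff_ge2E ?subrr//; last by rewrite mulrC ler_pdivlMr.
nra.
Qed.

Lemma theta_eq1 n t : 2 * (kap n)^-1 <= t <= kap n -> theta n t = 1.
Proof.
move=> /andP[h1 h2]; have k0 := kap_gt0 n.
rewrite /theta cutoff_le1E; last by rewrite mulrC ler_pdivrMr// mul1r.
by rewrite cutoff_ge2E ?subr0// mulrC -ler_pdivrMr.
Qed.

Lemma theta_ge0 n t : 0 <= theta n t.
Proof.
have k0 := kap_gt0 n; have k4 := kap_ge4 n; rewrite /theta subr_ge0.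
have [h|h] := leP t (kap n).
  by rewrite [leRHS]cutoff_le1E ?cutoff_le1// mulrC ler_pdivrMr// mul1r.
by rewrite [leLHS]cutoff_ge2E ?cutoff_ge0//; nra.
Qed.

Lemma theta_le1 n t : theta n t <= 1.
Proof. by rewrite /theta lerBlDr (le_trans (cutoff_le1 _))// lerDl cutoff_ge0. Qed.

Definition psi n x := theta n (sqn x).

Lemma smooth_psi n : smooth (psi n).
Proof. by rewrite /psi; apply: smooth_comp; [exact: smooth1_theta|exact: smooth_sqn]. Qed.

Lemma psi_supp n x : psi n x != 0 -> (kap n)^-1 < sqn x < 2 * kap n.
Proof.
rewrite /psi => h; apply/andP; split; rewrite ltNge; apply: contra_neqN h.
  by move=> h; exact: theta_eq0_le.
by move=> h; exact: theta_eq0_ge.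
Qed.

(** An open set slightly larger than the support of [psi n], with compact closure off the origin as
    [sobolev_loc] requires. *)
Definition ann n : set V := [set x | (2 * kap n)^-1 < sqn x < 3 * kap n].

Lemma continuous_sqn : continuous (@sqn R N).
Proof. by apply: smooth_continuous; exact: smooth_sqn. Qed.

Lemma open_ann n : open (ann n).
Proof.
have := @open_comp _ _ (@sqn R N) [set t | (2 * kap n)^-1 < t < 3 * kap n] _ _.
apply; first by move=> x _; exact: continuous_sqn.
have -> : [set t | (2 * kap n)^-1 < t < 3 * kap n] =
    [set t | (2 * kap n)^-1 < t] `&` [set t | t < 3 * kap n].
  by apply/seteqP; split=> t /=; [move=> /andP|move=> []->].
by apply: openI; [exact: open_gt|exact: open_lt].
Qed.

Lemma closed_shell (a b : R) : closed [set x : V | a <= sqn x <= b].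
Proof.
have -> : [set x : V | a <= sqn x <= b] = @sqn R N @^-1` [set t | a <= t <= b] by [].
apply: preimage_closed.
  by move=> x _; exact: continuous_sqn.
have -> : [set t : R | a <= t <= b] = [set t | a <= t] `&` [set t | t <= b].
  by apply/seteqP; split=> t /=; [move=> /andP|move=> []->].
by apply: closedI; [exact: closed_ge|exact: closed_le].
Qed.

Lemma compact_shell (a b : R) : compact [set x : V | a <= sqn x <= b].
Proof.
apply: (subclosed_compact _ (@compact_norm_ball R N (b + 1))); first exact: closed_shell.
move=> x /= /andP[_ xb].
have h := norm2_le_sqn x; have n0 := normr_ge0 x; have b0 := sqn_ge0 x; nra.
Qed.

Lemma test_function_psi n : test_function (ann n) (psi n).
Proof.
apply: (test_function_sub (A := [set x | (kap n)^-1 <= sqn x <= 2 * kap n])).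
- exact: smooth_psi.
- exact: compact_shell.
- by move=> x /psi_supp/andP[h1 h2] /=; rewrite !ltW.
- move=> x /= /andP[h1 h2]; have k0 := kap_gt0 n.
  rewrite /ann /= (le_lt_trans h2) ?ltr_pM2r ?ltr_nat// andbT (lt_le_trans _ h1)//.
  by rewrite ltf_pV2 ?posrE ?mulr_gt0// ltr_pMl// ltr1n.
Qed.

Lemma compact_closure_ann n : compact (closure (ann n)) /\ closure (ann n) `<=` [set~ 0].
Proof.
have k0 := kap_gt0 n.
have sub : closure (ann n) `<=` [set x | (2 * kap n)^-1 <= sqn x <= 3 * kap n].
  rewrite closureE; apply: smallest_sub; first exact: closed_shell.
  by move=> x /= /andP[h1 h2]; rewrite !ltW.
split.
  apply: (subclosed_compact _ (@compact_shell _ _) sub); exact: closed_closure.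
move=> x /sub /= /andP[h _] x0; move: h; rewrite x0.
have -> : sqn (0 : V) = 0.
  by rewrite /sqn big1// => i _; rewrite mxE expr0n.
by rewrite leNgt invr_gt0 mulr_gt0.
Qed.

Lemma psi_eq1 r K : 0 < r -> exists n, forall x, r <= `|x| <= K -> psi n x = 1.
Proof.
(* In the maximum norm r <= |x| <= K gives r^2 <= [sqn x] <= N K^2, so [kap] has to exceed both 2 /
   r^2 and N K^2. *)
move=> r0; pose A := 2 / r ^+ 2 + N%:R * K ^+ 2.
have r20 : 0 < r ^+ 2 by rewrite exprn_gt0.
have A1 : 2 / r ^+ 2 <= A by rewrite lerDl mulr_ge0// sqr_ge0.
have A2 : N%:R * K ^+ 2 <= A by rewrite lerDr divr_ge0// ltW.
exists (Num.truncn A).+1 => x /andP[rx xK]; apply: theta_eq1.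
have Ak : A <= kap (Num.truncn A).+1.
  by apply: le_trans (kap_ge_nat _); apply/ltW/truncnS_gt.
have n0 := normr_ge0 x.
apply/andP; split.
  apply: le_trans (norm2_le_sqn x); rewrite ler_pdivrMr ?kap_gt0//.
  apply: (@le_trans _ _ (r ^+ 2 * kap (Num.truncn A).+1)).
    by rewrite mulrC -ler_pdivrMr// (le_trans A1).
  rewrite ler_wpM2r ?(ltW (kap_gt0 _))// ler_pXn2r ?nnegrE ?(ltW r0)//.
apply: (le_trans (sqn_le x)); apply: le_trans Ak; apply: le_trans A2.
by rewrite ler_wpM2l// ler_pXn2r ?nnegrE//; apply: le_trans xK.
Qed.

(* "lbd": bounded, up to a null set, on compact sets avoiding the origin. *)
Definition lbd F := forall r K, 0 < r ->
  exists M : R, {ae mu, forall x, r <= `|x| <= K -> `|F x| <= M}.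

Lemma lbd_local F : (forall n, exists2 G, {ae mu, forall x, psi n x * (G x - F x) = 0} &
    exists M : R, {ae mu, forall x, `|psi n x * G x| <= M}) -> lbd F.
Proof.
move=> h r K r0; have [n hn] := psi_eq1 K r0; have [G hG [M hM]] := h n.
exists M; apply: filterS2 hG hM => x + + rx; rewrite hn// !mul1r.
by move=> /eqP; rewrite subr_eq0 => /eqP ->.
Qed.

Lemma morrey_cutoff O F (g : 'I_N -> V -> R) (m : R) chi : 1 < m -> N%:R < m ->
  Lp O m F -> (forall i, Lp O m (g i)) -> (forall i, weak_deriv O [:: i] F (g i)) ->
  test_function O chi ->
  exists M : R, {ae mu, forall x, `|chi x * (F \_ O) x| <= M}.
Proof.
move=> m1 Nm LF Lg h tc; have m0 : 0 <= m by rewrite ltW// (lt_trans _ m1).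
have tfc := test_function_tf tc.
have mulm f1 f2 : tf f1 -> Lp O m f2 -> itg mu (fun x => `|f1 x * (f2 \_ O) x| `^ m).
  move=> t1 /(Lp_itg (ltW m1))[mf im].
  have [M [K [M0 K0 hM]]] := tf_bounded t1.
  apply: (itg_le _ _ (itgZ (M `^ m) im)).
    by apply: measurable_powR_norm; apply: measurable_funM => //; exact: (tf_bbs t1).1.
  move=> x; rewrite ger0_norm ?powR_ge0// normrM powRM//.
  rewrite ler_wpM2r ?powR_ge0// ge0_ler_powR ?nnegrE//.
  by rewrite (le_trans (hM x))// ler_piMr ?cB_le1.
have mm f1 f2 : tf f1 -> Lp O m f2 -> measurable_fun setT (fun x => f1 x * (f2 \_ O) x).
  move=> t1 /(Lp_itg (ltW m1))[mf im].
  by apply: measurable_funM => //; exact: (tf_bbs t1).1.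
apply: (@morrey_bounded R N _ (fun i x => chi x * (g i \_ O) x + pderiv i chi x * (F \_ O) x) m) => //.
- exact: (L1loc_bbs_mul (tf_bbs tfc) (Lp_L1loc (ltW m1) LF)).
- exact: mulm.
- move=> i; apply: cutoff_wd => //; first exact: Lp_L1loc (ltW m1) LF.
  exact: Lp_L1loc (ltW m1) (Lg i).
- move=> i; apply: itg_powD => //; [exact: mm|by apply: mm => //; exact: tf_pderiv|exact: mulm|].
  by apply: mulm => //; exact: tf_pderiv.
Qed.

Lemma psi_restrict n F x : psi n x * ((F \_ (ann n)) x - F x) = 0.
Proof.
rewrite restrictE; case: ifPn => [_|/negP]; first by rewrite subrr mulr0.
rewrite inE => h; apply/eqP; rewrite mulf_eq0; apply/orP; left.
apply: contra_notT h => /psi_supp /andP[h1 h2]; have k0 := kap_gt0 n.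
rewrite /ann/= (lt_trans h2) ?ltr_pM2r ?ltr_nat// andbT (lt_trans _ h1)//.
by rewrite ltf_pV2 ?posrE ?mulr_gt0// ltr_pMl// ltr1n.
Qed.

Lemma lbd_sobolev1 F (m : R) : 1 < m -> N%:R < m -> sobolev_loc 1 m [set~ 0] F -> lbd F.
Proof.
move=> m1 Nm h; apply: lbd_local => n; exists (F \_ (ann n)).
  by apply: aeW => x; exact: psi_restrict.
have [cc c0] := compact_closure_ann n.
have [LF hd] := h _ (@open_ann n) cc c0.
have /choice[g hg] : forall i, exists g, weak_deriv (ann n) [:: i] F g /\ Lp (ann n) m g.
  by move=> i; have [//|g] := hd [:: i]; exists g.
apply: (morrey_cutoff m1 Nm LF (g := g)) => //.
- by move=> i; have [] := hg i.
- by move=> i; have [] := hg i.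
- exact: test_function_psi.
Qed.

Lemma sobolev_locW (k l : nat) (m : R) O F : (k <= l)%N ->
  sobolev_loc l m O F -> sobolev_loc k m O F.
Proof.
move=> kl h O' oO' cO' sO'; have [L hs] := h _ oO' cO' sO'; split => // s /andP[s0 sk].
by apply: hs; rewrite s0 (leq_trans sk).
Qed.

(** The local derivative of F lies in W^{1,m} and is bounded by Morrey's inequality; by uniqueness
    it coincides with the global derivative g. *)
Lemma lbd_sobolev2 F g j (m : R) : 1 < m -> N%:R < m -> sobolev_loc 2 m [set~ 0] F ->
  wd [:: j] F g -> lbd g.
Proof.
move=> m1 Nm h Fg; apply: lbd_local => n.
have [cc c0] := compact_closure_ann n.
have [LF hd] := h _ (@open_ann n) cc c0.
have [//|gj wgj Lgj] := hd [:: j].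
exists (gj \_ (ann n)).
  apply: weak_deriv_unique wgj Fg (test_function_psi n).
  exact: Lp_L1loc (ltW m1) Lgj.
have /choice[G hG] : forall i, exists G, weak_deriv (ann n) [:: j; i] F G /\ Lp (ann n) m G.
  by move=> i; have [//|G] := hd [:: j; i]; exists G.
apply: (morrey_cutoff m1 Nm Lgj (g := G)) => //.
- by move=> i; have [] := hG i.
- by move=> i; have [hi _] := hG i; exact: weak_deriv_iter wgj hi.
- exact: test_function_psi.
Qed.

Definition tf0 chi := tf chi /\ exists2 r, 0 < r & forall x, `|x| < r -> chi x = 0.

(** The support of chi lies in some r <= |x| <= K with r > 0, the only kind of region where a bound
    on F is known. *)
Lemma tf0_bbs chi F : tf0 chi -> measurable_fun setT F -> lbd F -> bbs (fun x => F x * chi x).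
Proof.
move=> [tc [r r0 hr]] mF bF; have [M [K [M0 K0 hM]]] := tf_bounded tc.
have [C hC] := bF r K r0; split.
  by apply: measurable_funM => //; exact: (tf_bbs tc).1.
exists (`|C| * M), K; apply: filterS hC => x hx.
have [xr|xr] := ltP `|x| r.
  by rewrite hr// mulr0 normr0 mulr_ge0 ?cB_ge0// mulr_ge0.
rewrite normrM; have := hM x; rewrite cBE; case: ifPn => xK hMx.
  rewrite mulr1; apply: ler_pM => //; last by rewrite mulr1 in hMx.
  by rewrite (le_trans (hx _)) ?xr ?xK// ler_norm.
have -> : chi x = 0 by apply/eqP; rewrite -normr_le0; rewrite mulr0 in hMx.
by rewrite normr0 !mulr0.
Qed.

Lemma tf0_pderiv i chi : tf0 chi -> tf0 (pderiv i chi).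
Proof.
move=> [tc [r r0 hr]]; split; first exact: tf_pderiv.
exists r => // x xr; apply: (@pderiv_eq0_open _ _ _ [set y : V | `|y| < r]) => //.
have := @open_comp _ _ (fun x : V => `|x|) [set s | s < r] _ _.
by apply; [move=> y _; exact: norm_continuous|exact: open_lt].
Qed.

Lemma tf0_mul f chi : smooth f -> tf0 chi -> tf0 (fun x => f x * chi x).
Proof.
move=> sf [tc [r r0 hr]]; split; first exact: tf_mul.
by exists r => // x /hr ->; rewrite mulr0.
Qed.

Lemma tf0_psi n : tf0 (psi n).
Proof.
split; first exact: test_function_tf (test_function_psi n).
have k0 := kap_gt0 n; have k4 := kap_ge4 n.
have N1 : 0 < N%:R + 1 :> R by rewrite ltr_pwDr.
(* Below this radius [sqn x] <= N |x|^2 <= 1 / kap, where [theta n] vanishes. *)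
exists ((N%:R + 1) * kap n)^-1; first by rewrite invr_gt0 mulr_gt0.
move=> x; rewrite -[X in _ < X]mul1r ltr_pdivlMr ?mulr_gt0// => xr.
rewrite /psi theta_eq0_le// (le_trans (sqn_le x))// -[leRHS]mul1r ler_pdivlMr//.
have x0 := normr_ge0 x; have N0 : 0 <= N%:R :> R by [].
move: `|x| (N%:R : R) x0 N0 N1 xr => t M t0 M0 M1 tr.
move: (kap n) k0 k4 tr => k k0 k4 tr.
have h1 : 0 <= t * M * k by rewrite !mulr_ge0// ltW.
have h2 : 0 <= t * (k - 4) by rewrite mulr_ge0// subr_ge0.
have E : t * ((M + 1) * k) = t * M * k + t * (k - 4) + 4 * t by ring.
have t1 : t <= 1 by lra.
have h3 : t * M * k <= 1 by lra.
rewrite expr2 (_ : M * (t * t) * k = t * M * k * t); last by ring.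
exact: mulr_ile1.
Qed.

End annuli.

(** * The local energy identity *)

Section vectors.
Variables (R : realType) (N : nat).
Implicit Types (X Y : 'I_N -> R) (p : R).

Definition vnorm X : R := Num.sqrt (\sum_i X i ^+ 2).

Lemma enorm_row X : enorm (\row_i X i) = vnorm X.
Proof.
rewrite enorm_sqn /sqn /vnorm; congr Num.sqrt; apply: eq_bigr => i _.
by rewrite mxE.
Qed.

Lemma vnorm_ge0 X : 0 <= vnorm X. Proof. exact: sqrtr_ge0. Qed.

Lemma sum_sqr_ge0 X : 0 <= \sum_i X i ^+ 2.
Proof. by apply: sumr_ge0 => i _; exact: sqr_ge0. Qed.

Lemma vnorm_sqr X : vnorm X ^+ 2 = \sum_i X i ^+ 2.
Proof. by rewrite sqr_sqrtr// sum_sqr_ge0. Qed.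

Lemma coord_le_vnorm X i : `|X i| <= vnorm X.
Proof.
rewrite -(ler_pXn2r (_ : 0 < 2)%N) ?nnegrE ?vnorm_ge0// vnorm_sqr real_normK ?num_real//.
by rewrite (bigD1 i)//= lerDl; apply: sumr_ge0 => j _; exact: sqr_ge0.
Qed.

Lemma vnorm_le_sum X : vnorm X <= \sum_i `|X i|.
Proof.
have S0 : 0 <= \sum_i `|X i| by apply: sumr_ge0.
rewrite -(ler_pXn2r (_ : 0 < 2)%N) ?nnegrE ?vnorm_ge0// vnorm_sqr expr2 mulr_suml.
apply: ler_sum => i _; rewrite -[X i ^+ 2]real_normK ?num_real// expr2 ler_wpM2l//.
by rewrite (bigD1 i)//= lerDl; apply: sumr_ge0.
Qed.

(** For s = 1 or -1 the sum of (|Y| X_i - s |X| Y_i)^2 equals 2 |X| |Y| (|X| |Y| - s X.Y). The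
    factor |X| |Y| is cancelled, so the case where it is 0 comes apart. *)
Lemma cauchy_schwarz X Y : `|\sum_i X i * Y i| <= vnorm X * vnorm Y.
Proof.
have x0 := vnorm_ge0 X; have y0 := vnorm_ge0 Y.
have [E|nz] := eqVneq (vnorm X * vnorm Y) 0.
  rewrite E normr_le0; apply/eqP/big1 => i _; apply/eqP; rewrite -normr_eq0 normrM.
  have hx := coord_le_vnorm X i; have hy := coord_le_vnorm Y i.
  move/eqP: E; rewrite mulf_eq0 => /orP[]/eqP E; rewrite E normr_le0 in hx hy.
    by rewrite (eqP hx) normr0 mul0r.
  by rewrite (eqP hy) normr0 mulr0.
have xy0 : 0 < vnorm X * vnorm Y by rewrite lt_def nz mulr_ge0.
suff h s : `|s| = 1 -> s * (\sum_i X i * Y i) <= vnorm X * vnorm Y.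
  rewrite ler_norml; apply/andP; split; last by rewrite -[leLHS]mul1r h ?normr1.
  by rewrite lerNl -[leLHS]mulN1r h// normrN1.
move=> s1; have : 0 <= \sum_i (vnorm Y * X i - s * vnorm X * Y i) ^+ 2.
  by apply: sumr_ge0 => i _; exact: sqr_ge0.
have s2 : s ^+ 2 = 1 by rewrite -[s ^+ 2]real_normK ?num_real// s1 expr1n.
have -> : \sum_i (vnorm Y * X i - s * vnorm X * Y i) ^+ 2 =
    2 * (vnorm X * vnorm Y) * (vnorm X * vnorm Y - s * (\sum_i X i * Y i)).
  transitivity (vnorm Y ^+ 2 * (\sum_i X i ^+ 2) + s ^+ 2 * vnorm X ^+ 2 * (\sum_i Y i ^+ 2)
     - 2 * s * vnorm X * vnorm Y * (\sum_i X i * Y i)).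
    rewrite !mulr_sumr -big_split -sumrB/=; apply: eq_bigr => i _; ring.
  by rewrite s2 -!vnorm_sqr; ring.
by rewrite pmulr_rge0 ?subr_ge0// mulr_gt0.
Qed.

Lemma vnorm_powM p X : 1 < p -> vnorm X `^ (p - 2) * vnorm X = vnorm X `^ (p - 1).
Proof.
move=> p1; have := normr_spow (vnorm X) p1.
by rewrite /spow normrM !ger0_norm ?powR_ge0 ?vnorm_ge0.
Qed.

Lemma vnorm_pow2 p X : 1 < p -> vnorm X `^ (p - 2) * (\sum_i X i * X i) = vnorm X `^ p.
Proof.
move=> p1; have := spow_mul (vnorm X) p1.
rewrite /spow ger0_norm ?vnorm_ge0// => <-; rewrite -mulrA; congr (_ * _).
by rewrite -expr2 vnorm_sqr; apply: eq_bigr => i _; rewrite expr2.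
Qed.

(** The tangent plane inequality of X |-> |X|^p / p: Cauchy-Schwarz reduces it to Young's inequality
    for the norms. *)
Lemma vector_convex p X Y : 1 < p ->
  vnorm X `^ (p - 2) * (\sum_i X i * (Y i - X i)) <=
  p^-1 * vnorm Y `^ p - p^-1 * vnorm X `^ p.
Proof.
move=> p1; have x0 := vnorm_ge0 X; have y0 := vnorm_ge0 Y.
have -> : \sum_i X i * (Y i - X i) = (\sum_i X i * Y i) - (\sum_i X i * X i).
  by rewrite -sumrB; apply: eq_bigr => i _; rewrite mulrBr.
rewrite mulrBr vnorm_pow2//.
have := young p1 x0 y0; rewrite -vnorm_powM//.
have := ler_wpM2l (powR_ge0 (vnorm X) (p - 2)) (le_trans (ler_norm _) (cauchy_schwarz X Y)).
rewrite mulrA mulrBl mul1r; move: (_ * (\sum_i _)) (_ * vnorm X * _) (p^-1 * _) (p^-1 * _) => A B C D.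
move: (vnorm X `^ p) => Z h1 h2; lra.
Qed.

End vectors.

Section local_identity.
Variables (R : realType) (N : nat).
Local Notation V := 'rV[R]_N.
Local Notation ei i := (delta_mx ord0 i : V).
Local Notation mu := (lebesgue_rV R N).
Implicit Types (G F W v eta phi rho : V -> R) (i j : 'I_N) (x y z : V).

Lemma TfDr W F G y : bbs W -> L1loc F -> L1loc G ->
  Tf W (fun x => F x + G x) y = Tf W F y + Tf W G y.
Proof.
move=> bW hF hG; rewrite /Tf -RintD; [|exact: itg_T..].
by apply: eq_Rint => x; rewrite mulrDr.
Qed.

Lemma L1loc0 : L1loc ((fun=> 0) : V -> R).
Proof. by apply: (@L1loc_bounded _ _ _ 0) => // x; rewrite normr0. Qed.

Lemma L1loc_sum (J : Type) (s : seq J) (F : J -> V -> R) :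
  (forall k, L1loc (F k)) -> L1loc (fun x => \sum_(k <- s) F k x).
Proof.
move=> hF; elim: s => [|j s IH].
  by under eq_fun do rewrite big_nil; exact: L1loc0.
by under eq_fun do rewrite big_cons; exact: L1locD.
Qed.

Lemma Tf_sumr (J : Type) (s : seq J) (F : J -> V -> R) W y : bbs W ->
  (forall k, L1loc (F k)) ->
  Tf W (fun x => \sum_(k <- s) F k x) y = \sum_(k <- s) Tf W (F k) y.
Proof.
move=> bW hF; rewrite /Tf -Rint_sum; last by move=> j; exact: itg_T.
by apply: eq_Rint => x; rewrite mulr_sumr.
Qed.

Lemma is_derive_bigsum (J : Type) (s : seq J) (F : J -> V -> R) (l : J -> R) x z :
  (forall k, is_derive x z (F k) (l k)) ->
  is_derive x z (fun y => \sum_(k <- s) F k y) (\sum_(k <- s) l k).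
Proof.
move=> h; elim: s => [|j s IH].
  rewrite big_nil (_ : (fun y => _) = cst 0); first exact: is_derive_cst.
  by apply/funext => y; rewrite big_nil.
rewrite big_cons (_ : (fun y => _) = fun y => F j y + \sum_(i <- s) F i y).
  exact: is_derive_add.
by apply/funext => y; rewrite big_cons.
Qed.

Lemma is_derive_mulc (c : R) F x z (l : R) : is_derive x z F l ->
  is_derive x z (fun y => c * F y) (c * l).
Proof.
move=> h; have := is_derive_mul (is_derive_cst c x z) h.
by move=> /is_derive_cast; apply; rewrite mulr0 addr0.
Qed.

Lemma is_derive_min0 F x z (l : R) : is_derive x z F l ->
  (forall h : R, F x <= F (x + h *: z)) -> l = 0.
Proof.
move=> /is_derive_ex_ed d m; apply/eqP; rewrite -normr_le0.
apply/ler_addgt0Pr => e e0; rewrite add0r; have [s s0 hs] := d e e0.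
have [->|l0] := eqVneq l 0; first by rewrite normr0 (ltW e0).
(* A step of length s against the sign of l would lower F by s |l| up to an error s e; minimality
   forces |l| <= e. *)
have := hs (s * - Num.sg l); rewrite normrM gtr0_norm// normrN normr_sg l0.
rewrite mulr1 => /(_ (lexx _)) h.
have := le_trans (ler_norm _) h; have := m (s * - Num.sg l).
have -> : s * - Num.sg l * l = - (s * `|l|).
  by rewrite mulrN mulNr -mulrA (normrEsg l).
rewrite opprK; move: (F _) (F _) => A B AB h1.
have : s * `|l| <= s * e by lra.
by rewrite ler_pM2l.
Qed.

Variables (u : V -> R) (ud : 'I_N -> V -> R) (ud2 : 'I_N -> 'I_N -> V -> R).
Variables (f : V -> R) (p q : R).
Hypotheses (p1 : 1 < p) (q1 : 1 < q).
Hypotheses (hu1 : forall j, wd [:: j] u (ud j))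
  (hu2 : forall j i, wd [:: i] (ud j) (ud2 j i))
  (hui : forall i, wd [:: i; i] u (ud2 i i)).

Definition lap x := \sum_i ud2 i i x.
Definition grn x := vnorm (ud^~ x).
Definition wfun x := spow q (lap x).
Definition afun j x := grn x `^ (p - 2) * ud j x.

Hypotheses (mf : measurable_fun setT f) (bud : forall j, lbd (ud j))
  (bw : lbd wfun) (bf : lbd f).
Hypotheses (iL : itg mu (fun x => `|lap x| `^ q)) (iG : itg mu (fun x => grn x `^ p)).
Hypothesis weak : forall v, tf v ->
  \int[mu]_x (wfun x * \sum_i pderivs [:: i; i] v x) +
  \int[mu]_x (grn x `^ (p - 2) * \sum_i ud i x * pderiv i v x) =
  \int[mu]_x (f x * v x).

Hypothesis hLu : L1loc u.

Let Lud j : L1loc (ud j). Proof. by have [] := hu1 j. Qed.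
Let Lud2 j i : L1loc (ud2 j i). Proof. by have [] := hu2 j i. Qed.
Let Llap : L1loc lap. Proof. exact: L1loc_sum. Qed.

Let mw : measurable_fun setT wfun.
Proof.
apply: measurable_funM; last exact: (proj1 Llap).
exact: measurable_powR_norm (proj1 Llap).
Qed.

Lemma measurable_grn : measurable_fun setT grn.
Proof.
have -> : grn = fun x => `|\sum_i ud i x ^+ 2| `^ 2^-1.
  by apply/funext => x; rewrite /grn /vnorm ger0_norm ?sum_sqr_ge0// powR12_sqrt ?sum_sqr_ge0.
apply: measurable_powR_norm; apply: measurable_sum => j.
by apply: measurable_funX; exact: (proj1 (Lud j)).
Qed.

Let grn_ge0 x : 0 <= grn x. Proof. exact: vnorm_ge0. Qed.

Let grn_normE a : (fun x => grn x `^ a) = fun x => `|grn x| `^ a.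
Proof. by apply/funext => x; rewrite ger0_norm. Qed.

Let ma j : measurable_fun setT (afun j).
Proof.
apply: measurable_funM; last exact: (proj1 (Lud j)).
by rewrite grn_normE; apply: measurable_powR_norm; exact: measurable_grn.
Qed.

Lemma norm_afun_le j x : `|afun j x| <= grn x `^ (p - 1).
Proof.
rewrite /afun normrM ger0_norm ?powR_ge0// -(vnorm_powM _ p1).
by rewrite ler_wpM2l ?powR_ge0// coord_le_vnorm.
Qed.

Lemma ae_all (P : 'I_N -> V -> Prop) : (forall j, {ae mu, forall x, P j x}) ->
  {ae mu, forall x, forall j, P j x}.
Proof. by move=> h; exact: filter_forall. Qed.

Let ba j : lbd (afun j).
Proof.
move=> r K r0; have /choice[M hM] : forall j, exists M : R,
  {ae mu, forall x, r <= `|x| <= K -> `|ud j x| <= M} by move=> i; exact: bud.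
exists ((\sum_i `|M i|) `^ (p - 1)); apply: filterS (ae_all hM) => x hx rx.
apply: (le_trans (norm_afun_le j x)).
rewrite ge0_ler_powR ?nnegrE ?subr_ge0 ?(ltW p1)//; first by apply: sumr_ge0.
apply: (le_trans (vnorm_le_sum _)); apply: ler_sum => i _.
by rewrite (le_trans (hx i rx))// ler_norm.
Qed.

(** [WL], [W1] and [W0] are the coefficients of the Laplacian, the gradient and the value of rho
    when the equation is tested with eta rho. *)
Definition WL eta x := wfun x * eta x.
Definition W1 eta j x := 2 * (wfun x * pderiv j eta x) + afun j x * eta x.
Definition W0 eta x := wfun x * (\sum_i pderivs [:: i; i] eta x) +
  \sum_j afun j x * pderiv j eta x - f x * eta x.

Lemma tf0_pderivs2 i eta : tf0 eta -> tf0 (pderivs [:: i; i] eta).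
Proof. by move=> h; do 2 apply: tf0_pderiv. Qed.

Let bWL eta : tf0 eta -> bbs (WL eta).
Proof. by move=> h; exact: tf0_bbs. Qed.

Let bW1 eta j : tf0 eta -> bbs (W1 eta j).
Proof.
move=> h; apply: bbsD; last exact: tf0_bbs.
by apply: bbsZ; apply: tf0_bbs => //; exact: tf0_pderiv.
Qed.

Let bW0 eta : tf0 eta -> bbs (W0 eta).
Proof.
move=> h; apply: bbsD; last first.
  by under eq_fun do rewrite -mulN1r; apply: bbsZ; exact: tf0_bbs.
apply: bbsD.
  under eq_fun do rewrite mulr_sumr.
  by apply: bbs_sum => i; apply: tf0_bbs => //; exact: tf0_pderivs2.
by apply: bbs_sum => i; apply: tf0_bbs => //; exact: tf0_pderiv.
Qed.

Lemma pderivs2M eta rho i : smooth eta -> smooth rho ->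
  pderivs [:: i; i] (fun x => eta x * rho x) = fun x =>
    eta x * pderivs [:: i; i] rho x + 2 * (pderiv i eta x * pderiv i rho x)
    + rho x * pderivs [:: i; i] eta x.
Proof.
move=> se sr.
have -> : pderivs [:: i; i] (fun x => eta x * rho x) = pderiv i (pderiv i (fun x => eta x * rho x)).
  by [].
rewrite pderivM// pderivD; [|exact: smoothM (smooth_pderiv i _)..].
rewrite (pderivM _ se (smooth_pderiv i sr)) (pderivM _ sr (smooth_pderiv i se)).
apply/funext => x /=.
move: (eta x) (rho x) (pderiv i eta x) (pderiv i rho x) (pderiv i (pderiv i eta) x)
  (pderiv i (pderiv i rho) x) => a b c d a2 b2.
by ring.
Qed.

(** The product rule at one point: e, E, E2 are the values of eta and of its first and pure second
    derivatives, b, P, P2 those of rho; w, g X and c come from the equation. *)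
Lemma weak_expand_algebra (w g c e b : R) (X E P E2 P2 : 'I_N -> R) :
  w * e * (\sum_i P2 i) + \sum_j (2 * (w * E j) + g * X j * e) * P j
    + (w * (\sum_i E2 i) + \sum_j g * X j * E j - c * e) * b =
  w * (\sum_i (e * P2 i + 2 * (E i * P i) + b * E2 i))
    + g * (\sum_i X i * (e * P i + b * E i)) - c * (e * b).
Proof.
rewrite mulrBl mulrDl !mulr_sumr !mulr_suml -!big_split/= addrA -!big_split/=.
rewrite mulrA; congr (_ - _); apply: eq_bigr => i _; ring.
Qed.

(* The weak equation tested with eta * rho. *)
Lemma weak_expand eta rho : tf0 eta -> smooth rho ->
  \int[mu]_x (WL eta x * \sum_i pderivs [:: i; i] rho x) +
  \sum_j \int[mu]_x (W1 eta j x * pderiv j rho x) +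
  \int[mu]_x (W0 eta x * rho x) = 0.
Proof.
move=> te sr; have se := te.1.1.
have t0v : tf0 (fun x => eta x * rho x).
  have -> : (fun x => eta x * rho x) = fun x => rho x * eta x by apply/funext => x; rewrite mulrC.
  exact: tf0_mul.
have Lr : L1loc rho by apply: continuous_L1loc; exact: smooth_continuous.
have Lrs s : L1loc (pderivs s rho).
  by apply: continuous_L1loc; apply: smooth_continuous; exact: smooth_pderivs.
have i1 : itg mu (fun x => WL eta x * \sum_i pderivs [:: i; i] rho x).
  by apply: itg_T0; [exact: bWL|apply: L1loc_sum => i; exact: Lrs].
have i2 j : itg mu (fun x => W1 eta j x * pderiv j rho x).
  by apply: itg_T0; [exact: bW1|exact: (Lrs [:: j])].
have i3 : itg mu (fun x => W0 eta x * rho x) by apply: itg_T0 => //; exact: bW0.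
rewrite -(Rint_sum _ i2) -RintD//; last exact: itg_sum.
rewrite -RintD//; last by apply: itgD => //; exact: itg_sum.
have := weak t0v.1.
set A := fun x => wfun x * \sum_i pderivs [:: i; i] (fun x => eta x * rho x) x.
set B := fun x => grn x `^ (p - 2) * \sum_i ud i x * pderiv i (fun x => eta x * rho x) x.
set C := fun x => f x * (eta x * rho x).
have jA : itg mu A.
  rewrite /A; under eq_fun do rewrite mulr_sumr.
  by apply: itg_sum => i; apply: bbs_itg; apply: tf0_bbs => //; exact: tf0_pderivs2.
have jB : itg mu B.
  rewrite /B; under eq_fun do rewrite mulr_sumr.
  apply: itg_sum => i; under eq_fun do rewrite mulrA.
  by apply: bbs_itg; apply: (tf0_bbs (F := afun i)) => //; exact: tf0_pderiv.
have jC : itg mu C by apply: bbs_itg; exact: tf0_bbs.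
move=> /eqP; rewrite -RintD// -subr_eq0 -RintB//; last exact: itgD.
move=> /eqP E; rewrite -[RHS]E; apply: eq_Rint => x.
rewrite /A /B /C /WL /W1 /W0.
have e1 i : pderivs [:: i; i] (fun x => eta x * rho x) x = eta x * pderivs [:: i; i] rho x
  + 2 * (pderiv i eta x * pderiv i rho x) + rho x * pderivs [:: i; i] eta x.
  by rewrite pderivs2M.
have e2 i : pderiv i (fun x => eta x * rho x) x = eta x * pderiv i rho x + rho x * pderiv i eta x.
  by rewrite pderivM.
apply: (etrans (weak_expand_algebra (wfun x) (grn x `^ (p - 2)) (f x) (eta x) (rho x)
  (ud^~ x) (fun i => pderiv i eta x) (fun i => pderiv i rho x)
  (fun i => pderivs [:: i; i] eta x) (fun i => pderivs [:: i; i] rho x))).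
congr (_ * _ + _ * _ - _); apply: eq_bigr => i _; first exact: esym (e1 i).
by congr (_ * _); exact: esym (e2 i).
Qed.

(** Formally, the weak equation tested with eta u(. + y). *)
Definition residual eta y := Tf (WL eta) lap y + \sum_j Tf (W1 eta j) (ud j) y + Tf (W0 eta) u y.

(* Take for rho a translate of a mollification of u and let the mollifier shrink. *)
Lemma residual_eq0 eta y : tf0 eta -> residual eta y = 0.
Proof.
move=> te.
have tm k := tf_moll R N k; have bm k := tf_bbs (tm k).
have cL : continuous (Tf (WL eta) lap) by apply: Tf_continuous => //; exact: bWL.
have c1 j : continuous (Tf (W1 eta j) (ud j)) by apply: Tf_continuous => //; exact: bW1.
have c0 : continuous (Tf (W0 eta) u) by apply: Tf_continuous => //; exact: bW0.
have cS : continuous (fun y => \sum_j Tf (W1 eta j) (ud j) y).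
  elim: (index_enum _) => [|j s IH].
    by under eq_fun do rewrite big_nil; exact: continuous_cst.
  by under eq_fun do rewrite big_cons; exact: continuous_add.
have cE : continuous (residual eta) by apply: continuous_add => //; exact: continuous_add.
have mE k : Tf (moll k) (residual eta) y = 0.
  rewrite [LHS]TfDr//; [|exact: continuous_L1loc (continuous_add cL cS)|exact: continuous_L1loc].
  rewrite TfDr//; [|exact: continuous_L1loc..].
  rewrite Tf_sumr//; last by move=> j; exact: continuous_L1loc.
  have sr : smooth (fun x => Tf (moll k) u (x + y)) by apply: smooth_shift; exact: smooth_Tf.
  rewrite -[RHS](weak_expand te sr); congr (_ + _ + _).
  - rewrite (Tf_comm y (bm k) (bWL te) Llap); apply: eq_Rint => x; congr (_ * _).
    rewrite [LHS](Tf_sumr _ _ (bm k))//.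
    apply: eq_bigr => i _; rewrite pderivs_shift; last exact: smooth_Tf.
    by rewrite (pderivs_Tf_wd (hui i) (tm k)).
  - apply: eq_bigr => j _.
    rewrite (Tf_comm y (bm k) (bW1 j te) (Lud j)); apply: eq_Rint => x; congr (_ * _).
    rewrite pderiv_shift; last exact: smooth_Tf.
    by rewrite -(pderivs_Tf_wd (hu1 j) (tm k)).
  - by rewrite (Tf_comm y (bm k) (bW0 te) hLu).
apply/eqP; rewrite -normr_le0; apply/ler_addgt0Pr => e e0; rewrite add0r.
have [n /(_ n (leqnn n))] := moll_near y cE e0.
by rewrite mE subr0.
Qed.

(** The energy identity in the direction e_i as one integrand: for the two energies the derivative
    falls on eta, for the other terms on grad u and u. *)
Definition energy_integrand eta i x := q^-1 * (pderiv i eta x * `|lap x| `^ q)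
  + p^-1 * (pderiv i eta x * grn x `^ p)
  - (\sum_j 2 * (wfun x * pderiv j eta x) * ud2 j i x + W0 eta x * ud i x).

Let LL : L1loc (fun x => `|lap x| `^ q). Proof. exact: itg_L1loc. Qed.
Let LG : L1loc (fun x => grn x `^ p). Proof. exact: itg_L1loc. Qed.

Let bc eta j : tf0 eta -> bbs (fun x => 2 * (wfun x * pderiv j eta x)).
Proof. by move=> te; apply: bbsZ; apply: tf0_bbs => //; exact: tf0_pderiv. Qed.

Lemma itg_energy_integrand eta i : tf0 eta -> itg mu (energy_integrand eta i).
Proof.
move=> te; have bd : bbs (pderiv i eta) by exact: tf_bbs (tf0_pderiv i te).1.
apply: itgB; apply: itgD.
- by apply: itgZ; exact: itg_T0.
- by apply: itgZ; exact: itg_T0.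
- by apply: itg_sum => j; apply: itg_T0 => //; exact: bc.
- by apply: itg_T0 => //; exact: bW0.
Qed.

(* By convexity the increment P y - P 0 of the principal part is at most Q y - Q 0.
   Both functions are differentiable at 0, so their derivatives there agree. *)
Lemma energy_identity_ge0 eta i : tf0 eta -> (forall x, 0 <= eta x) -> \int[mu]_x energy_integrand eta i x = 0.
Proof.
move=> te eta0; have be := tf_bbs te.1.
have bd : bbs (pderiv i eta) by exact: tf_bbs (tf0_pderiv i te).1.
pose P y := Tf (WL eta) lap y + \sum_j Tf (fun x => afun j x * eta x) (ud j) y.
pose C y := \sum_j Tf (fun x => 2 * (wfun x * pderiv j eta x)) (ud j) y + Tf (W0 eta) u y.
pose Q y := q^-1 * Tf eta (fun x => `|lap x| `^ q) y + p^-1 * Tf eta (fun x => grn x `^ p) y.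
have bae j : bbs (fun x => afun j x * eta x) by exact: tf0_bbs.
(* [P] pairs with [lap], for which no weak derivative is available. Its differentiability comes from
   the equation, because [C] pairs with grad u and u only. *)
have PC y : P y = - 1 * C y.
  have := residual_eq0 y te; rewrite /residual.
  have -> : \sum_j Tf (W1 eta j) (ud j) y =
     \sum_j Tf (fun x => 2 * (wfun x * pderiv j eta x)) (ud j) y +
     \sum_j Tf (fun x => afun j x * eta x) (ud j) y.
    rewrite -big_split; apply: eq_bigr => j _.
    by rewrite /W1; apply: TfDl => //; exact: bc.
  rewrite /P /C; move: (Tf _ _ _) (\sum_j _) (\sum_j _) (Tf _ _ _) => a b c d E.
  apply/eqP; rewrite -subr_eq0 -[X in _ == X]E; apply/eqP; ring.
have dC : is_derive 0 (ei i) C (\sum_j Tf (fun x => 2 * (wfun x * pderiv j eta x)) (ud2 j i) 0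
    + Tf (W0 eta) (ud i) 0).
  apply: is_derive_add; last by apply: is_derive_Tf => //; exact: bW0.
  by apply: is_derive_bigsum => j; apply: is_derive_Tf => //; exact: bc.
have dQ : is_derive 0 (ei i) Q (q^-1 * (-1 * Tf (pderiv i eta) (fun x => `|lap x| `^ q) 0)
    + p^-1 * (-1 * Tf (pderiv i eta) (fun x => grn x `^ p) 0)).
  by apply: is_derive_add; apply: is_derive_mulc; apply: is_derive_Tf_test => //; exact: te.1.
have PQ y : P y - P 0 <= Q y - Q 0.
  have iA z : itg mu (fun x => WL eta x * lap (x + z)) by apply: itg_T => //; exact: bWL.
  have iB j z : itg mu (fun x => afun j x * eta x * ud j (x + z)) by exact: itg_T.
  have iC z : itg mu (fun x => eta x * `|lap (x + z)| `^ q) by exact: (itg_T z be LL).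
  have iD z : itg mu (fun x => eta x * grn (x + z) `^ p) by exact: (itg_T z be LG).
  have PE z : P z = \int[mu]_x (WL eta x * lap (x + z) + \sum_j afun j x * eta x * ud j (x + z)).
    by rewrite RintD//; [rewrite Rint_sum|exact: itg_sum].
  have QE z : Q z = \int[mu]_x (q^-1 * (eta x * `|lap (x + z)| `^ q) + p^-1 * (eta x * grn (x + z) `^ p)).
    by rewrite RintD ?RintZ//; exact: itgZ.
  have iP z : itg mu (fun x => WL eta x * lap (x + z) + \sum_j afun j x * eta x * ud j (x + z)).
    by apply: itgD => //; exact: itg_sum.
  have iQ z : itg mu (fun x => q^-1 * (eta x * `|lap (x + z)| `^ q) + p^-1 * (eta x * grn (x + z) `^ p)).
    by apply: itgD; exact: itgZ.
  rewrite !PE !QE -!RintB//; apply: Rint_le; [exact: itgB..|].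
  move=> x; rewrite addr0.
  have h1 := ler_wpM2l (eta0 x) (power_convex (lap x) (lap (x + y)) q1).
  have h2 := ler_wpM2l (eta0 x) (vector_convex (ud^~ x) (ud^~ (x + y)) p1).
  have E1 : \sum_j afun j x * eta x * ud j (x + y) - \sum_j afun j x * eta x * ud j x =
     eta x * (vnorm (ud^~ x) `^ (p - 2) * \sum_j ud j x * (ud j (x + y) - ud j x)).
    rewrite -sumrB !mulr_sumr; apply: eq_bigr => j _; rewrite /afun /grn; ring.
  rewrite -E1 in h2; rewrite -subr_ge0 in h1; rewrite -subr_ge0 in h2; rewrite -subr_ge0.
  move: h1 h2; rewrite /WL -/(wfun x) -/(grn x) -/(grn (x + y)).
  move: (wfun x) (\sum_j _) (\sum_j _) (_ `^ q) (_ `^ q) (_ `^ p) (_ `^ p) => w S1 S2 a b c d h1 h2.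
  by apply: le_trans (addr_ge0 h1 h2) _; rewrite le_eqVlt; apply/orP; left; apply/eqP; ring.
have dd := is_derive_add dQ (is_derive_mulc 1 dC).
have /(is_derive_min0 dd) : forall h : R, Q 0 + 1 * C 0 <= Q (0 + h *: ei i) + 1 * C (0 + h *: ei i).
  move=> h; have := PQ (0 + h *: ei i); rewrite !PC.
  move: (C _) (C _) (Q _) (Q _) => a b c d; lra.
rewrite !Tf0 => E.
have i1 : itg mu (fun x => pderiv i eta x * `|lap x| `^ q) by exact: itg_T0.
have i2 : itg mu (fun x => pderiv i eta x * grn x `^ p) by exact: itg_T0.
have i3 j : itg mu (fun x => 2 * (wfun x * pderiv j eta x) * ud2 j i x).
  by apply: itg_T0 => //; exact: bc.
have i4 : itg mu (fun x => W0 eta x * ud i x) by apply: itg_T0 => //; exact: bW0.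
rewrite /energy_integrand RintB; [|by apply: itgD; exact: itgZ|by apply: itgD => //; exact: itg_sum].
rewrite !RintD//; [|exact: itg_sum|exact: itgZ|exact: itgZ].
rewrite !RintZ// Rint_sum//.
have E' : \sum_j Tf (fun x => 2 * (wfun x * pderiv j eta x)) (ud2 j i) 0 =
  \sum_j \int[mu]_x (2 * (wfun x * pderiv j eta x) * ud2 j i x).
  by apply: eq_bigr => j _; rewrite Tf0.
move: E; rewrite E'.
move: (\int[mu]_x _) (\int[mu]_x _) (\int[mu]_x _) (\sum_j _) => a b c d E.
apply/eqP; rewrite -oppr_eq0 -[X in _ == X]E; apply/eqP; ring.
Qed.

Lemma pderivB eta1 eta2 i : smooth eta1 -> smooth eta2 ->
  pderiv i (fun x => eta1 x - eta2 x) = fun x => pderiv i eta1 x - pderiv i eta2 x.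
Proof.
move=> s1 s2; have -> : (fun x => eta1 x - eta2 x) = fun x => eta1 x + (-1) * eta2 x.
  by apply/funext => x; rewrite mulN1r.
rewrite pderivD//; last exact: smoothZ.
by rewrite pderivZ//; apply/funext => x; rewrite mulN1r.
Qed.

(** [energy_integrand] at one point as a function of the values of eta and its derivatives. It is
    linear in them, and explicit radial values can be inserted later. *)
Definition energy_expr (d D : 'I_N -> R) (e : R) i x := q^-1 * (d i * `|lap x| `^ q)
  + p^-1 * (d i * grn x `^ p) - (\sum_j 2 * (wfun x * d j) * ud2 j i x
  + (wfun x * (\sum_j D j) + \sum_j afun j x * d j - f x * e) * ud i x).

Lemma energy_integrandE eta i x :
  energy_integrand eta i x = energy_expr (fun j => pderiv j eta x) (fun j => pderivs [:: j; j] eta x) (eta x) i x.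
Proof. by []. Qed.

Lemma energy_exprB d d' D D' e e' i x :
  energy_expr (fun j => d j - d' j) (fun j => D j - D' j) (e - e') i x =
  energy_expr d D e i x - energy_expr d' D' e' i x.
Proof.
rewrite /energy_expr sumrB.
have -> : \sum_j afun j x * (d j - d' j) = \sum_j afun j x * d j - \sum_j afun j x * d' j.
  by rewrite -sumrB; apply: eq_bigr => j _; rewrite mulrBr.
have -> : \sum_j 2 * (wfun x * (d j - d' j)) * ud2 j i x =
  \sum_j 2 * (wfun x * d j) * ud2 j i x - \sum_j 2 * (wfun x * d' j) * ud2 j i x.
  by rewrite -sumrB; apply: eq_bigr => j _; ring.
ring.
Qed.

Lemma energy_integrandB eta1 eta2 i x : smooth eta1 -> smooth eta2 ->
  energy_integrand (fun x => eta1 x - eta2 x) i x = energy_integrand eta1 i x - energy_integrand eta2 i x.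
Proof.
move=> s1 s2; rewrite !energy_integrandE -energy_exprB; congr (energy_expr _ _ _ i x); apply/funext => j.
  by rewrite pderivB.
have -> : pderivs [:: j; j] (fun x => eta1 x - eta2 x)
  = pderiv j (pderiv j (fun x => eta1 x - eta2 x)) by [].
by rewrite (pderivB j s1 s2) (pderivB j (smooth_pderiv j s1) (smooth_pderiv j s2)).
Qed.

(** The convexity argument needs eta >= 0, but x_i chi has no sign. Where |x| <= K it is the
    difference of the nonnegative functions (x_i + K) chi and K chi, and the integrand is linear in
    eta. *)
Lemma energy_identity_coord chi i : tf0 chi -> (forall x, 0 <= chi x) ->
  itg mu (energy_integrand (fun x => x ord0 i * chi x) i) /\
  \int[mu]_x energy_integrand (fun x => x ord0 i * chi x) i x = 0.
Proof.
move=> tc c0; have [K [K0 hK]] : exists K, 0 <= K /\ forall x, K < `|x| -> chi x = 0.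
  by have [[_ [K hK]] _] := tc; exists `|K|; split=> // x /(le_lt_trans (ler_norm K))/hK.
have sc := tc.1.1; have ss : smooth (fun x : V => x ord0 i + K).
  by apply: smoothD; [exact: smooth_coord|exact: smooth_cst].
have t1 : tf0 (fun x => (x ord0 i + K) * chi x) by exact: tf0_mul.
have t2 : tf0 (fun x => K * chi x) by apply: tf0_mul => //; exact: smooth_cst.
have h1 x : 0 <= (x ord0 i + K) * chi x.
  have [/hK ->|xK] := ltP K `|x|; first by rewrite mulr0.
  rewrite mulr_ge0// -lerBlDr sub0r; have := le_trans (coord_le_norm x i) xK.
  by rewrite ler_norml => /andP[].
have h2 x : 0 <= K * chi x by rewrite mulr_ge0.
have E : (fun x : V => x ord0 i * chi x) = fun x => (x ord0 i + K) * chi x - K * chi x.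
  by apply/funext => x; rewrite mulrDl addrK.
have EP : energy_integrand (fun x => x ord0 i * chi x) i =
   fun x => energy_integrand (fun x => (x ord0 i + K) * chi x) i x - energy_integrand (fun x => K * chi x) i x.
  by apply/funext => x; rewrite E energy_integrandB//; [exact: t1.1.1|exact: t2.1.1].
have i1 := itg_energy_integrand i t1; have i2 := itg_energy_integrand i t2.
rewrite EP; split; first exact: itgB.
by rewrite RintB// !energy_identity_ge0// subrr.
Qed.

End local_identity.

(** * Radial functions and the chain rule *)

Section power_weights.
Variable R : realType.
Implicit Types (A : R -> R) (t b : R).

(** Below t0 > 0 the product is identically 0, so the singularity of t^b at the origin is never
    met. *)
Lemma is_derive_powmul A b t0 t (l : R) : 0 < t0 -> (forall s, s < t0 -> A s = 0) ->
  is_derive t 1 A l ->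
  is_derive t 1 (fun t => A t * t `^ b) (A t * (b * t `^ (b - 1)) + t `^ b * l).
Proof.
move=> t00 A0 dA; have [tt|tt] := ltP t t0; last first.
  have t1 : 0 < t by exact: lt_le_trans tt.
  exact: is_derive_mul dA (is_derive1_powR b t1).
have l0 : l = 0.
  by apply: (@is_derive_locally_cst R A t l 0 [set s | s < t0]).
have := is_derive_cst (0 : R) t 1; rewrite A0// l0 mul0r mulr0 addr0.
apply: near_eq_is_derive.
have := open_nbhs_nbhs (conj (@open_lt R t0) tt); apply: filterS => s /= st.
by rewrite A0// mul0r.
Qed.

(** The derivative is b A t^(b-1) + A' t^b, a combination of products of the same kind; hence the
    induction runs over all A and b at once. *)
Lemma smooth1_powmul A b t0 : 0 < t0 -> smooth1 A -> (forall s, s < t0 -> A s = 0) ->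
  smooth1 (fun t => A t * t `^ b).
Proof.
move=> t00 sA A0 k; elim: k A b sA A0 => [//|k IH] A b sA A0.
have [A' dA sA'] := smooth1_deriv sA.
exists (fun t => A t * (b * t `^ (b - 1)) + t `^ b * A' t).
  by move=> t; exact: is_derive_powmul A0 (dA t).
have -> : (fun t => A t * (b * t `^ (b - 1)) + t `^ b * A' t) =
    fun t => b * (A t * t `^ (b - 1)) + A' t * t `^ b.
  by apply/funext => t; rewrite mulrCA [X in _ + X]mulrC.
apply: D1kD; first by apply: D1kM; [exact: D1k_cst|exact: IH].
apply: IH => // s st.
by apply: (@is_derive_locally_cst R A s (A' s) 0 [set s | s < t0]).
Qed.

(** The operator t d/dt commutes with dilations, so t theta' and t^2 theta'' are bounded uniformly
    in n, although theta' itself is of size [kap n] near the origin. *)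
Lemma theta_derivatives : exists th1 th2 : nat -> R -> R, exists C : R,
  [/\ 0 <= C, forall n t, is_derive t 1 (theta n) (th1 n t),
      forall n t, is_derive t 1 (th1 n) (th2 n t),
      forall n, continuous (th1 n) /\ continuous (th2 n) &
      forall n t, [/\ `|t * th1 n t| <= C, `|t ^+ 2 * th2 n t| <= C &
        ~~ (kap R n <= t <= 2 * kap R n) -> ~~ ((kap R n)^-1 <= t <= 2 * (kap R n)^-1) ->
        th1 n t = 0 /\ th2 n t = 0]].
Proof.
have [c1 [c2 [C [C0 d1 d2 s2 hC]]]] := cutoff_derivatives R.
have scal (c c' : R -> R) (a t : R) : (forall t, is_derive t 1 c (c' t)) ->
    is_derive t 1 (fun t => c (a * t)) (a * c' (a * t)).
  move=> h; have da : is_derive t 1 (fun t : R => a * t) a.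
    have := @is_derive_mul R R (cst a) id t 1 0 1 (is_derive_cst a t 1) (is_derive_id t 1).
    by move=> /is_derive_cast; apply; rewrite mulr0 addr0 mulr1.
  by have := is_derive_comp (h (a * t)) da; move=> /is_derive_cast; apply; rewrite mulrC.
have sub (f g : R -> R) (t l m : R) : is_derive t 1 f l -> is_derive t 1 g m ->
    is_derive t 1 (fun t => f t - g t) (l - m).
  by move=> hf hg; exact: is_deriveB.
have mulc (f : R -> R) (a t l : R) : is_derive t 1 f l -> is_derive t 1 (fun t => a * f t) (a * l).
  move=> h; have := is_derive_mul (is_derive_cst a t 1) h.
  by move=> /is_derive_cast; apply; rewrite mulr0 addr0.
have bd (c : R -> R) : (forall t, `|c t| <= C) ->
    (forall t, ~~ (1 <= t <= 2) -> c t = 0) -> forall t, `|t * c t| <= 2 * C /\ `|t ^+ 2 * c t| <= 4 * C.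
  move=> cC c0 t; have [/andP[t1 t2]|/c0 ->] := boolP (1 <= t <= 2); last first.
    by rewrite !mulr0 normr0; split; rewrite mulr_ge0.
  have t0 : 0 <= t by rewrite (le_trans _ t1).
  rewrite (normrM t) (normrM (t ^+ 2)) (ger0_norm t0) (ger0_norm (exprn_ge0 2 t0)); split; apply: ler_pM => //; rewrite ?exprn_ge0//.
  by rewrite expr2 (_ : 4 = 2 * 2) ?ler_pM// -natrM.
have c1C t : `|c1 t| <= C by have [] := hC t.
have c2C t : `|c2 t| <= C by have [_ []] := hC t.
have c10 t : ~~ (1 <= t <= 2) -> c1 t = 0 by have [_ [_ h]] := hC t; move=> /h[].
have c20 t : ~~ (1 <= t <= 2) -> c2 t = 0 by have [_ [_ h]] := hC t; move=> /h[].
have cc1 : continuous c1.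
  move=> t; apply: differentiable_continuous; apply/derivable1_diffP.
  by have [] := d1 t => *; have [] := d2 t.
have cc2 : continuous c2 := smooth1_continuous s2.
pose k := @kap R.
exists (fun n t => (k n)^-1 * c1 ((k n)^-1 * t) - k n * c1 (k n * t)).
exists (fun n t => (k n)^-1 * ((k n)^-1 * c2 ((k n)^-1 * t)) - k n * (k n * c2 (k n * t))).
(* On [1, 2] the products s c1(s) and s^2 c2(s) are at most 2 C and 4 C, and each derivative of
   [theta] is a difference of two rescaled terms. *)
exists (8 * C); split.
- by rewrite mulr_ge0.
- by move=> n t; apply: sub; exact: scal.
- by move=> n t; apply: sub; apply: mulc; exact: scal.
- move=> n.
  have sc (c : R -> R) (a : R) : continuous c -> continuous (fun t => c (a * t)).
    move=> cc; apply: continuous_chi => //; apply: continuous_mul; [exact: continuous_cst|].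
    by move=> x; exact: cvg_id.
  have cB (f g : R -> R) (a b : R) : continuous f -> continuous g -> continuous (fun t => a * f t - b * g t).
    move=> cf cg; have -> : (fun t => a * f t - b * g t) = fun t => a * f t + (- b) * g t.
      by apply/funext => t; rewrite mulNr.
    by apply: continuous_add; apply: continuous_mul => //; exact: continuous_cst.
  by split; apply: cB; do ?apply: continuous_mul; do ?exact: continuous_cst; exact: sc.
move=> n t; have k0 : 0 < k n := kap_gt0 R n.
have [a1 a2] := bd c1 c1C c10 ((k n)^-1 * t).
have [a3 a4] := bd c1 c1C c10 (k n * t).
have [b1 b2] := bd c2 c2C c20 ((k n)^-1 * t).
have [b3 b4] := bd c2 c2C c20 (k n * t).
split.
- have -> : t * ((k n)^-1 * c1 ((k n)^-1 * t) - k n * c1 (k n * t)) =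
    (k n)^-1 * t * c1 ((k n)^-1 * t) - k n * t * c1 (k n * t).
    by move: (c1 (k n * t)) (c1 ((k n)^-1 * t)); move: ((k n)^-1) => D A B; ring.
  by apply: (le_trans (ler_normB _ _)); lra.
- have -> : t ^+ 2 * ((k n)^-1 * ((k n)^-1 * c2 ((k n)^-1 * t)) - k n * (k n * c2 (k n * t))) =
    ((k n)^-1 * t) ^+ 2 * c2 ((k n)^-1 * t) - (k n * t) ^+ 2 * c2 (k n * t).
    by move: (c2 (k n * t)) (c2 ((k n)^-1 * t)); move: ((k n)^-1) => D A B; ring.
  by apply: (le_trans (ler_normB _ _)); lra.
move=> h1 h2.
have g1 : ~~ (1 <= (k n)^-1 * t <= 2).
  by rewrite ler_pdivlMl// ler_pdivrMl// mulr1 [k n * 2]mulrC.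
have g2 : ~~ (1 <= k n * t <= 2).
  apply: contra h2 => /andP[x1 x2]; apply/andP; split; last by rewrite ler_pdivlMr// mulrC.
  by rewrite -[leLHS]mulr1 ler_pdivrMl.
by rewrite !c10// !c20// !mulr0 subrr.
Qed.

End power_weights.

Section radial.
Variables (R : realType) (N : nat).
Local Notation V := 'rV[R]_N.
Local Notation ei i := (delta_mx ord0 i : V).
Implicit Types (h : R -> R) (x : V) (i j : 'I_N).

Lemma is_derive_sqn j x : is_derive x (ei j) (@sqn R N) (2 * x ord0 j).
Proof.
have -> : @sqn R N = fun x => \sum_i x ord0 i * x ord0 i.
  by apply/funext => y; apply: eq_bigr => i _; rewrite expr2.
have := @is_derive_bigsum R N _ (index_enum 'I_N) (fun i (x : V) => x ord0 i * x ord0 i)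
  (fun i => x ord0 i * (j == i)%:R + x ord0 i * (j == i)%:R) x (ei j).
move=> /(_ (fun i => is_derive_mul (is_derive_coord i j x) (is_derive_coord i j x))).
move=> /is_derive_cast; apply; rewrite (bigD1 j)//= big1 ?addr0.
  by rewrite eqxx !mulr1; ring.
by move=> i /negbTE ij; rewrite eq_sym ij !mulr0 addr0.
Qed.

Lemma pderiv_radial h h1 j x : (forall t : R, is_derive t 1 h (h1 t)) ->
  pderiv j (fun x : V => h (sqn x)) x = h1 (sqn x) * (2 * x ord0 j).
Proof.
move=> dh.
have H y : is_derive y (ei j) (fun x : V => h (sqn x)) (h1 (sqn y) * (2 * y ord0 j)).
  exact: is_derive_comp (dh _) (is_derive_sqn j y).
by rewrite (pderiv_fun H).
Qed.

Lemma pderivs2_radial h h1 h2 j x : (forall t : R, is_derive t 1 h (h1 t)) ->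
  (forall t : R, is_derive t 1 h1 (h2 t)) ->
  pderivs [:: j; j] (fun x : V => h (sqn x)) x =
  2 * h1 (sqn x) + 4 * (x ord0 j ^+ 2 * h2 (sqn x)).
Proof.
move=> dh dh1.
have -> : pderivs [:: j; j] (fun x : V => h (sqn x)) =
    pderiv j (fun x : V => h1 (sqn x) * (2 * x ord0 j)).
  rewrite /pderivs /=; congr pderiv; apply/funext => y; exact: pderiv_radial.
have H y : is_derive y (ei j) (fun x : V => h1 (sqn x) * (2 * x ord0 j))
    (h1 (sqn y) * (2 * (j == j)%:R) + 2 * y ord0 j * (h2 (sqn y) * (2 * y ord0 j))).
  apply: is_derive_mul; first exact: is_derive_comp (dh1 _) (is_derive_sqn j y).
  exact: is_derive_mulc (is_derive_coord j j y).
rewrite (pderiv_fun H) eqxx mulr1; move: (h1 _) (h2 _) (x ord0 j) => a b c; ring.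
Qed.

Lemma pderiv_coord i j : pderiv j (fun x : V => x ord0 i) = fun=> (j == i)%:R.
Proof. exact: pderiv_fun (is_derive_coord i j). Qed.

Lemma pderiv_coordM h h1 i j x : smooth1 h -> (forall t : R, is_derive t 1 h (h1 t)) ->
  pderiv j (fun x : V => x ord0 i * h (sqn x)) x =
  x ord0 i * (h1 (sqn x) * (2 * x ord0 j)) + h (sqn x) * (j == i)%:R.
Proof.
move=> sh dh; have sr : smooth (fun x : V => h (sqn x)).
  by apply: smooth_comp => //; exact: smooth_sqn.
rewrite (pderivM j (smooth_coord R i) sr) pderiv_radial//.
by rewrite pderiv_coord.
Qed.

Lemma pderivs2_coordM h h1 h2 i j x : smooth1 h -> (forall t : R, is_derive t 1 h (h1 t)) ->
  (forall t : R, is_derive t 1 h1 (h2 t)) ->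
  pderivs [:: j; j] (fun x : V => x ord0 i * h (sqn x)) x =
  x ord0 i * (2 * h1 (sqn x) + 4 * (x ord0 j ^+ 2 * h2 (sqn x)))
  + 4 * ((j == i)%:R * (h1 (sqn x) * x ord0 j)).
Proof.
move=> sh dh dh1; have sr : smooth (fun x : V => h (sqn x)).
  by apply: smooth_comp => //; exact: smooth_sqn.
rewrite (pderivs2M j (smooth_coord R i) sr) (pderivs2_radial j x dh dh1) (pderiv_radial j x dh).
have -> : pderivs [:: j; j] (fun x : V => x ord0 i) x = 0.
  rewrite /pderivs /= pderiv_coord.
  have H y : is_derive y (ei j) (fun=> (j == i)%:R : R) 0 by exact: is_derive_cst.
  by rewrite (pderiv_fun H).
rewrite pderiv_coord mulr0 addr0; congr (_ + _).
by move: ((j == i)%:R) (h1 _) (x ord0 j) => a b c; ring.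
Qed.

End radial.

(** * Integration by parts for the power nonlinearities *)

Section chain_rule.
Variables (R : realType) (N : nat).
Local Notation V := 'rV[R]_N.
Local Notation ei i := (delta_mx ord0 i : V).
Local Notation mu := (lebesgue_rV R N).
Implicit Types (eta chi : V -> R) (i : 'I_N) (x y z : V).

Variables (u : V -> R) (ud : 'I_N -> V -> R) (a : R).
Hypotheses (a1 : 1 < a) (hu1 : forall j, wd [:: j] u (ud j)) (Lu : L1loc u) (bu : lbd u).
Hypothesis La : L1loc (fun x => `|u x| `^ a).

Let Lud j : L1loc (ud j). Proof. by have [] := hu1 j. Qed.

Lemma measurable_spow (v : V -> R) b : measurable_fun setT v ->
  measurable_fun setT (fun x => spow b (v x)).
Proof. by move=> mv; apply: measurable_funM => //; exact: measurable_powR_norm. Qed.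

Lemma lbd_spow b (v : V -> R) : 1 < b -> lbd v -> lbd (fun x => spow b (v x)).
Proof.
move=> b1 bv r K r0; have [M hM] := bv r K r0; exists (`|M| `^ (b - 1)).
apply: filterS hM => x hx rx; rewrite normr_spow//.
rewrite ge0_ler_powR ?nnegrE ?subr_ge0 ?(ltW b1)//.
by rewrite (le_trans (hx rx))// ler_norm.
Qed.

Definition chain_integrand eta i x := spow a (u x) * eta x * ud i x + a^-1 * (pderiv i eta x * `|u x| `^ a).

Let bS eta : tf0 eta -> bbs (fun x => spow a (u x) * eta x).
Proof.
by move=> te; apply: tf0_bbs => //; [exact: measurable_spow (proj1 Lu)|exact: lbd_spow].
Qed.

Lemma itg_chain_integrand eta i : tf0 eta -> itg mu (chain_integrand eta i).
Proof.
move=> te; apply: itgD; first by apply: itg_T0 => //; exact: bS.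
by apply: itgZ; apply: itg_T0 => //; exact: tf_bbs (tf0_pderiv i te).1.
Qed.

(** Integrates |u|^(a-2) u d_i u by parts without differentiating |u|^a: convexity of |t|^a / a
    makes [Q] - [P] minimal at y = 0, and there its derivative vanishes. *)
Lemma chain_rule_ge0 eta i : tf0 eta -> (forall x, 0 <= eta x) -> \int[mu]_x chain_integrand eta i x = 0.
Proof.
move=> te eta0; have be := tf_bbs te.1.
have bd : bbs (pderiv i eta) by exact: tf_bbs (tf0_pderiv i te).1.
pose P y := Tf (fun x => spow a (u x) * eta x) u y.
pose Q y := a^-1 * Tf eta (fun x => `|u x| `^ a) y.
have dP : is_derive 0 (ei i) P (Tf (fun x => spow a (u x) * eta x) (ud i) 0).
  by apply: is_derive_Tf => //; exact: bS.
have dQ : is_derive 0 (ei i) Q (a^-1 * (-1 * Tf (pderiv i eta) (fun x => `|u x| `^ a) 0)).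
  by apply: is_derive_mulc; apply: is_derive_Tf_test => //; exact: te.1.
have PQ y : P y - P 0 <= Q y - Q 0.
  have iA z : itg mu (fun x => spow a (u x) * eta x * u (x + z)) by apply: itg_T => //; exact: bS.
  have iC z : itg mu (fun x => eta x * `|u (x + z)| `^ a) by exact: (itg_T z be La).
  have QE z : Q z = \int[mu]_x (a^-1 * (eta x * `|u (x + z)| `^ a)) by rewrite RintZ.
  rewrite !QE /P /Tf -!RintB//; [|exact: itgZ..].
  apply: Rint_le; [exact: itgB|by apply: itgB; exact: itgZ|].
  move=> x; rewrite addr0.
  have h := ler_wpM2l (eta0 x) (power_convex (u x) (u (x + y)) a1).
  rewrite -subr_ge0 in h; rewrite -subr_ge0; apply: (le_trans h).
  by rewrite le_eqVlt; apply/orP; left; apply/eqP; ring.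
have dd := is_derive_add dQ (is_derive_mulc (-1) dP).
have /(is_derive_min0 dd) : forall h : R, Q 0 + -1 * P 0 <= Q (0 + h *: ei i) + -1 * P (0 + h *: ei i).
  move=> h; have := PQ (0 + h *: ei i).
  move: (P _) (P _) (Q _) (Q _) => c b e d; lra.
rewrite !Tf0 => E; rewrite RintD; [| |apply: itgZ]; [|by apply: itg_T0 => //; exact: bS|exact: itg_T0].
rewrite RintZ; last exact: itg_T0.
move: E; move: (\int[mu]_x _) (\int[mu]_x _) => c d E.
apply/eqP; rewrite -oppr_eq0 -[X in _ == X]E; apply/eqP; ring.
Qed.

Lemma chain_rule_coord chi i : tf0 chi -> (forall x, 0 <= chi x) ->
  itg mu (chain_integrand (fun x => x ord0 i * chi x) i) /\
  \int[mu]_x chain_integrand (fun x => x ord0 i * chi x) i x = 0.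
Proof.
move=> tc c0; have [K [K0 hK]] : exists K, 0 <= K /\ forall x, K < `|x| -> chi x = 0.
  by have [[_ [K hK]] _] := tc; exists `|K|; split=> // x /(le_lt_trans (ler_norm K))/hK.
have sc := tc.1.1; have ss : smooth (fun x : V => x ord0 i + K).
  by apply: smoothD; [exact: smooth_coord|exact: smooth_cst].
have t1 : tf0 (fun x => (x ord0 i + K) * chi x) by exact: tf0_mul.
have t2 : tf0 (fun x => K * chi x) by apply: tf0_mul => //; exact: smooth_cst.
have h1 x : 0 <= (x ord0 i + K) * chi x.
  have [/hK ->|xK] := ltP K `|x|; first by rewrite mulr0.
  rewrite mulr_ge0// -lerBlDr sub0r; have := le_trans (coord_le_norm x i) xK.
  by rewrite ler_norml => /andP[].
have h2 x : 0 <= K * chi x by rewrite mulr_ge0.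
have E : (fun x : V => x ord0 i * chi x) = fun x => (x ord0 i + K) * chi x - K * chi x.
  by apply/funext => x; rewrite mulrDl addrK.
have EP : chain_integrand (fun x => x ord0 i * chi x) i =
   fun x => chain_integrand (fun x => (x ord0 i + K) * chi x) i x - chain_integrand (fun x => K * chi x) i x.
  apply/funext => x; rewrite E /chain_integrand pderivB; [|exact: t1.1.1|exact: t2.1.1].
  by move: (pderiv _ _ _) (pderiv _ _ _) (_ `^ _) (spow _ _) => A B C D; ring.
have i1 := itg_chain_integrand i t1; have i2 := itg_chain_integrand i t2.
rewrite EP; split; first exact: itgB.
by rewrite RintB// !chain_rule_ge0// subrr.
Qed.

End chain_rule.

(** * Decay of the gradient on shells *)

(** In the application X = r^q and T = 2^q; A, B are the integrals of |g|^q over the two half-shells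
    and H that over their union, while U, G are those of |u|^q and |g2|^q over the larger shell. *)
Lemma shell_algebra (R : realType) (X A B U G H T : R) : 0 < X -> X * A <= T * (T * (2 * U) + X * (X * G)) ->
  X * B <= T * (T * (2 * U) + X * (X * G)) -> H <= A + B -> 0 <= U -> 0 <= G -> 1 <= T ->
  H <= T * (T * 4) * (X^-1 * X^-1 * U + G) * X.
Proof.
move=> X0 h1 h2 h3 U0 G0 T1; rewrite -(ler_pM2l X0).
have -> : X * (T * (T * 4) * (X^-1 * X^-1 * U + G) * X) = 4 * (T * T * U) + 4 * (T * T * (X * X * G)).
  by field; rewrite gt_eqF.
have h4 : X * H <= X * A + X * B by rewrite -mulrDr ler_pM2l.
have h5 : T * (X * X * G) <= T * T * (X * X * G).
  by rewrite -(mulrA T T) ler_peMl// !mulr_ge0// ltW// (lt_le_trans _ T1).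
have E : T * (T * (2 * U) + X * (X * G)) = 2 * (T * T * U) + T * (X * X * G) by ring.
have h6 : 0 <= T * (X * X * G) by rewrite !mulr_ge0// ltW// (lt_le_trans _ T1).
rewrite E in h1 h2; lra.
Qed.

Section shells.
Variables (R : realType) (N : nat).
Local Notation V := 'rV[R]_N.
Local Notation ei i := (delta_mx ord0 i : V).
Local Notation mu := (lebesgue_rV R N).
Implicit Types (f g F v : V -> R) (a b r h e s : R) (x y z : V) (S : set V).

Definition shell a b : set V := [set x | a <= sqn x <= b].

Lemma measurable_sqn : measurable_fun setT (@sqn R N).
Proof. by apply: continuous_rV_measurable => x; exact: continuous_sqn. Qed.

Lemma measurable_shell a b : measurable (shell a b).
Proof.
have -> : shell a b = @sqn R N @^-1` `[a, b]%classic.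
  by apply/seteqP; split => x /=; rewrite in_itv.
rewrite -[X in measurable X]setTI; apply: measurable_sqn => //.
Qed.

Lemma indic01 S x : (\1_S x : R) = if x \in S then 1 else 0.
Proof. by rewrite indicE; case: (x \in S). Qed.

Lemma indic_ge0 S x : 0 <= (\1_S x : R).
Proof. by rewrite indic01; case: ifP. Qed.

Lemma Rint_indic_pow_ge0 S F a : 0 <= \int[mu]_x (\1_S x * `|F x| `^ a).
Proof.
by apply: Rint_ge0 => x; apply: mulr_ge0; [exact: indic_ge0|exact: powR_ge0].
Qed.

Lemma indic_le S S' x y : (S x -> S' y) -> (\1_S x : R) <= \1_S' y.
Proof.
move=> h; rewrite !indic01; case: ifPn => [/set_mem/h Sy|_]; last by case: ifP.
by rewrite mem_set.
Qed.

Lemma itg_indic S F : measurable S -> itg mu F -> itg mu (fun x => \1_S x * F x).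
Proof.
move=> mS iF; apply: (itg_le _ _ (itg_norm iF)).
  by apply: measurable_funM; [exact: measurable_indic|exact: itg_measurable iF].
by move=> x; rewrite normrM ger0_norm ?indic_ge0// indic01; case: ifP; rewrite ?mul1r// mul0r.
Qed.

Lemma lbd_shell_itg S F a b : measurable S -> 0 < a -> S `<=` shell a b ->
  measurable_fun setT F -> lbd F -> itg mu (fun x => \1_S x * F x).
Proof.
move=> mS a0 Sab mF bF.
(* For |x| < r <= 1 one has [sqn x] <= N |x|^2 < a, so the shell stays at distance at least r from
   the origin. *)
pose r := Num.min 1 (a / (N%:R + 1)).
have N1 : 0 < N%:R + 1 :> R by rewrite ltr_pwDr.
have r0 : 0 < r by rewrite lt_min ltr01 divr_gt0.
have [M hM] := bF r (b + 1) r0.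
apply: (itg_ae_le _ _ (itgZ `|M| (itg_cB N (b + 1)))).
  by apply: measurable_funM => //; exact: measurable_indic.
apply: filterS hM => x hx; rewrite normrM ger0_norm ?indic_ge0// indic01.
case: ifPn => [/set_mem/Sab /andP[xa xb]|_]; last first.
  by rewrite mul0r mulr_ge0// cB_ge0.
have n0 := normr_ge0 x; have l1 := norm2_le_sqn x; have l2 := sqn_le x.
have xb1 : `|x| <= b + 1 by have b0 := sqn_ge0 x; nra.
rewrite mul1r cBE xb1 mulr1; apply: le_trans (ler_norm M); apply: hx.
rewrite xb1 andbT leNgt; apply/negP => xr.
have r1 : r <= 1 by rewrite ge_min lexx.
have ra : r <= a / (N%:R + 1) by rewrite ge_min lexx orbT.
have : N%:R * `|x| ^+ 2 < a; last by rewrite ltNge (le_trans xa).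
have : `|x| * (N%:R + 1) < a by rewrite -ltr_pdivlMr// (lt_le_trans xr).
have x1 : `|x| < 1 by rewrite (lt_le_trans xr).
have N0 : 0 <= N%:R :> R by [].
move: (`|x|) (N%:R : R) n0 N0 x1 => t M' t0 M0 t1 h.
have : t * (M' * (1 - t)) >= 0 by rewrite !mulr_ge0// subr_ge0 ltW.
nra.
Qed.

Variables (u g g2 : V -> R) (j : 'I_N) (q : R).
Hypotheses (q1 : 1 < q) (ug : wd [:: j] u g) (gg2 : wd [:: j] g g2)
  (bu : lbd u) (bg : lbd g) (ig2 : itg mu (fun x => `|g2 x| `^ q)).

Let mu_ : measurable_fun setT u. Proof. by have [[]] := ug. Qed.
Let mg : measurable_fun setT g. Proof. by have [[]] := gg2. Qed.
Let mg2 : measurable_fun setT g2. Proof. by have [_ []] := gg2. Qed.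
Let q0 : 0 <= q. Proof. by rewrite ltW// (lt_trans ltr01). Qed.

Lemma lbd_pow F : lbd F -> lbd (fun x => `|F x| `^ q).
Proof.
move=> bF r K r0; have [M hM] := bF r K r0; exists (`|M| `^ q).
apply: filterS hM => x hx rx; rewrite ger0_norm ?powR_ge0//.
by rewrite ge0_ler_powR ?nnegrE// (le_trans (hx rx))// ler_norm.
Qed.

(** The factor 6 makes room for a step of length at most r from a point with |x|^2 <= 2 r^2: the
    cross term is at most 2 r |x_j| <= r^2 + x_j^2 <= 3 r^2, and the square of the step adds r^2. *)
Definition big r := shell (r ^+ 2) (6 * r ^+ 2).

(** For eps = 1 or -1, the part of the shell where a step along eps e_j does not decrease |x|, so
    that the segment keeps away from the origin. *)
Definition half (eps r : R) : set V :=
  shell (r ^+ 2) (2 * r ^+ 2) `&` [set x | 0 <= eps * x ord0 j].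

Lemma sqn_shift x h : sqn (x + h *: ei j) = sqn x + 2 * h * x ord0 j + h ^+ 2.
Proof.
rewrite /sqn (bigD1 j)//= [in RHS](bigD1 j)//= !mxE !eqxx /= mulr1.
have -> : \sum_(i < N | i != j) (x + h *: ei j) ord0 i ^+ 2 = \sum_(i < N | i != j) x ord0 i ^+ 2.
  by apply: eq_bigr => i /negbTE ij; rewrite !mxE ij andbF mulr0 addr0.
by move: (\sum_(i < N | i != j) _) => A; ring.
Qed.

Lemma half_shift eps r x s : `|eps| = 1 -> 0 < r -> half eps r x -> 0 <= s <= 1 ->
  big r (x + s *: ((eps * r) *: ei j)).
Proof.
move=> e1 r0 [/= /andP[x1 x2] xe] /andP[s0 s1].
have e2 : eps ^+ 2 = 1 by rewrite -[eps ^+ 2]real_normK ?num_real// e1 expr1n.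
have xj : x ord0 j ^+ 2 <= sqn x.
  by rewrite /sqn (bigD1 j)//= lerDl; apply: sumr_ge0 => i _; exact: sqr_ge0.
rewrite /big /shell /= scalerA sqn_shift.
have E : 2 * (s * (eps * r)) * x ord0 j = 2 * s * r * (eps * x ord0 j) by ring.
have E2 : (s * (eps * r)) ^+ 2 = s ^+ 2 * r ^+ 2.
  by rewrite exprMn exprMn e2 mul1r.
have y2 : (eps * x ord0 j) ^+ 2 <= 2 * r ^+ 2.
  by rewrite exprMn e2 mul1r (le_trans xj).
rewrite E E2; move: (eps * x ord0 j) xe y2 => y y0 y2.
have s2 : s ^+ 2 <= 1 by rewrite expr_le1.
have h1 : 0 <= s * r * y by rewrite !mulr_ge0// ltW.
have h2 : 0 <= s ^+ 2 * r ^+ 2 by rewrite mulr_ge0// sqr_ge0.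
have h3 : s ^+ 2 * r ^+ 2 <= r ^+ 2 by rewrite ler_piMl// sqr_ge0.
have h4 : s * r * y <= r * y by rewrite -mulrA ler_piMl// mulr_ge0// ltW.
have h5 : 2 * (r * y) <= 3 * r ^+ 2 by have := sqr_ge0 (r - y); rewrite sqrrB; lra.
apply/andP; split; lra.
Qed.

Lemma measurable_half eps r : measurable (half eps r).
Proof.
apply: measurableI; first exact: measurable_shell.
rewrite [X in measurable X](_ : _ =
    (fun x : V => eps * rV_coord j x) @^-1` `[0, +oo[%classic); last first.
  by apply/seteqP; split => x /=; rewrite in_itv /= andbT.
rewrite -[X in measurable X]setTI; apply: measurable_funM => //.
exact: measurable_rV_coord.
Qed.

Lemma half_shell eps r : half eps r `<=` shell (r ^+ 2) (2 * r ^+ 2).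
Proof. by move=> x []. Qed.

Lemma indic_shift F eps r s : `|eps| = 1 -> 0 < r -> 0 <= s <= 1 ->
  measurable_fun setT F -> (forall x, 0 <= F x) ->
  itg mu (fun x => \1_(big r) x * F x) ->
  itg mu (fun x => \1_(half eps r) x * F (x + s *: ((eps * r) *: ei j))) /\
  \int[mu]_x (\1_(half eps r) x * F (x + s *: ((eps * r) *: ei j))) <=
  \int[mu]_x (\1_(big r) x * F x).
Proof.
move=> e1 r0 s01 mF F0 iF; set y := s *: _.
have mbig : measurable (big r) by exact: measurable_shell.
have le x : \1_(half eps r) x * F (x + y) <= \1_(big r) (x + y) * F (x + y).
  by rewrite ler_wpM2r//; apply: indic_le => hx; exact: half_shift.
have i1 : itg mu (fun x => \1_(big r) (x + y) * F (x + y)) by exact: (itg_shift y iF).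
have i2 : itg mu (fun x => \1_(half eps r) x * F (x + y)).
  apply: (itg_le _ _ i1) => [|x].
    apply: measurable_funM; last exact: measurable_shift.
    exact: measurable_indic (measurable_half eps r).
  by rewrite ger0_norm// mulr_ge0// indic_ge0.
split => //; apply: (le_trans (Rint_le i2 i1 le)).
have mbF : measurable_fun setT (fun x => \1_(big r) x * F x) by exact: itg_measurable iF.
by rewrite (@Rint_shift R N (fun x => \1_(big r) x * F x) y mbF).
Qed.

(* Write h g = (u (x + h e) - u x) - (u (x + h e) - u x - h g x) with e the j-th basis
   vector; the sign of h is that of x_j, which keeps x + s h e in the shell big r. *)
Lemma half_bound eps r : `|eps| = 1 -> 0 < r ->
  r `^ q * \int[mu]_x (\1_(half eps r) x * `|g x| `^ q) <=
  2 `^ q * (2 `^ q * (2 * \int[mu]_x (\1_(big r) x * `|u x| `^ q))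
            + r `^ q * (r `^ q * \int[mu]_x (\1_(big r) x * `|g2 x| `^ q))).
Proof.
move=> e1 r0; set h := eps * r; set S := half eps r.
have r2 : 0 < r ^+ 2 by rewrite exprn_gt0.
have hr : `|h| = r by rewrite normrM e1 mul1r gtr0_norm.
have mS : measurable S := measurable_half eps r.
have mb : measurable (big r) := measurable_shell _ _.
have Sb : S `<=` shell (r ^+ 2) (6 * r ^+ 2).
  move=> x [/= /andP[x1 x2] _]; apply/andP; split => //; lra.
have iu : itg mu (fun x => \1_(big r) x * `|u x| `^ q).
  by apply: (lbd_shell_itg mb r2 (b := 6 * r ^+ 2)) => //;
    [exact: measurable_powR_norm|exact: lbd_pow].
have ig2b : itg mu (fun x => \1_(big r) x * `|g2 x| `^ q) by exact: itg_indic.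
have igS : itg mu (fun x => \1_S x * `|g x| `^ q).
  by apply: (lbd_shell_itg mS r2 Sb); [exact: measurable_powR_norm|exact: lbd_pow].
have iuS : itg mu (fun x => \1_S x * `|u x| `^ q).
  by apply: (lbd_shell_itg mS r2 Sb); [exact: measurable_powR_norm|exact: lbd_pow].
have s11 : 0 <= (1 : R) <= 1 by rewrite ler01 lexx.
have mpu : measurable_fun setT (fun x => `|u x| `^ q) by exact: measurable_powR_norm.
have mpg2 : measurable_fun setT (fun x => `|g2 x| `^ q) by exact: measurable_powR_norm.
have [i1 b1] := indic_shift e1 r0 s11 mpu (fun x => powR_ge0 _ _) iu.
rewrite scale1r -/h -/S in i1 b1.
set B := r `^ q * \int[mu]_x (\1_(big r) x * `|g2 x| `^ q).
have I20 : 0 <= \int[mu]_x (\1_(big r) x * `|g2 x| `^ q).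
  exact: Rint_indic_pow_ge0.
have B0 : 0 <= B by rewrite mulr_ge0 ?powR_ge0.
(* The increment of g over the partial step s h is controlled by g2 on the segment of points x + s'
   s h e_j with s' s in [0, 1], which remains in [big r]. *)
have hB s : 0 <= s <= 1 ->
  (\int[mu]_x (\1_S x * `|g (x + s *: (h *: ei j)) - g x| `^ q)%:E <= B%:E)%E.
  move=> s01; have /andP[s0 s1] := s01.
  have := @ftc_pow R N g g2 j (s * h) q S (\int[mu]_x (\1_(big r) x * `|g2 x| `^ q))%:E q1 gg2 mS.
  rewrite lee_fin => /(_ I20) H; rewrite scalerA.
  apply: (le_trans (H _)).
    move=> s' /andP[s'0 s'1].
    have -> : s' *: ((s * h) *: ei j) = (s' * s) *: (h *: ei j) by rewrite !scalerA mulrA.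
    have ss : 0 <= s' * s <= 1 by rewrite mulr_ge0//= mulr_ile1.
    have [i2 b2] := indic_shift e1 r0 ss mpg2 (fun x => powR_ge0 _ _) ig2b.
    by rewrite -(Rint_EFin i2) lee_fin.
  rewrite -EFinM lee_fin /B ler_wpM2r// ge0_ler_powR ?nnegrE//; first exact: ltW.
  by rewrite normrM hr ger0_norm// ler_piMl// ltW.
have D := ftc_pow_sub q1 ug mg mS (_ : (0 <= B%:E)%E) hB; rewrite lee_fin in D.
move: (D B0) => {}D.
have iD : itg mu (fun x => \1_S x * `|u (x + h *: ei j) - u x - h * g x| `^ q).
  apply/itgP; split.
    apply: measurable_funM; first exact: measurable_indic.
    apply: measurable_powR_norm; apply: measurable_funB; last exact: measurable_funM.
    by apply: measurable_funB => //; exact: measurable_shift.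
  under eq_integral do rewrite ger0_norm ?mulr_ge0 ?indic_ge0 ?powR_ge0//.
  by apply: (le_lt_trans D); rewrite -EFinM ltry.
rewrite -(Rint_EFin iD) -EFinM lee_fin hr in D.
have pw x : r `^ q * (\1_S x * `|g x| `^ q) <=
  2 `^ q * (2 `^ q * (\1_S x * `|u (x + h *: ei j)| `^ q + \1_S x * `|u x| `^ q)
   + \1_S x * `|u (x + h *: ei j) - u x - h * g x| `^ q).
  have -> : r `^ q * (\1_S x * `|g x| `^ q) = \1_S x * `|h * g x| `^ q.
    by rewrite normrM hr powRM// ?(ltW r0)// mulrCA.
  rewrite -mulrDr mulrCA -mulrDr mulrCA ler_wpM2l ?indic_ge0//.
  move: (u (x + h *: ei j)) (u x) (h * g x) => a b c.
  have := powR_add_le (a - b) (- (a - b - c)) q0.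
  rewrite normrN (_ : a - b + - (a - b - c) = c); last by ring.
  move=> /le_trans; apply; rewrite ler_wpM2l ?powR_ge0// lerD2r.
  by have := powR_add_le a (- b) q0; rewrite normrN.
rewrite -RintZ//.
apply: (le_trans (Rint_le (itgZ _ igS) _ pw)).
  by apply: itgZ; apply: itgD => //; apply: itgZ; exact: itgD.
rewrite RintZ; last by apply: itgD => //; apply: itgZ; exact: itgD.
rewrite ler_wpM2l ?powR_ge0// RintD//; last by apply: itgZ; exact: itgD.
rewrite RintZ; last exact: itgD.
apply: lerD; last exact: D.
apply: ler_wpM2l; first exact: powR_ge0.
have b2 : \int[mu]_x (\1_S x * `|u x| `^ q) <= \int[mu]_x (\1_(big r) x * `|u x| `^ q).
  apply: (Rint_le iuS iu) => x; apply: ler_wpM2r; first exact: powR_ge0.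
  by apply: indic_le; exact: Sb.
have two (t : R) : t + t = 2 * t by ring.
by rewrite (RintD i1 iuS) -two; exact: lerD.
Qed.

(** A scaled interpolation inequality: r^-1 d_j u is controlled in L^q by r^-2 u and d_j d_j u on a
    larger shell. The two signs of eps together cover the shell. *)
Lemma shell_bound r : 0 < r ->
  r `^ (- q) * \int[mu]_x (\1_(shell (r ^+ 2) (2 * r ^+ 2)) x * `|g x| `^ q) <=
  2 `^ q * (2 `^ q * 4) * (r `^ (- (2 * q)) * \int[mu]_x (\1_(big r) x * `|u x| `^ q)
            + \int[mu]_x (\1_(big r) x * `|g2 x| `^ q)).
Proof.
move=> r0; have r2 : 0 < r ^+ 2 by rewrite exprn_gt0.
have nN1 : `|-1 : R| = 1 by rewrite normrN1.
have h1 := half_bound (normr1 R) r0; have h2 := half_bound nN1 r0.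
have ih eps : itg mu (fun x => \1_(half eps r) x * `|g x| `^ q).
  apply: (lbd_shell_itg (measurable_half eps r) r2 (@half_shell eps r)).
    exact: measurable_powR_norm.
  exact: lbd_pow.
have iS : itg mu (fun x => \1_(shell (r ^+ 2) (2 * r ^+ 2)) x * `|g x| `^ q).
  apply: (lbd_shell_itg (measurable_shell _ _) r2 (@subset_refl _ _)).
    exact: measurable_powR_norm.
  exact: lbd_pow.
have le x : \1_(shell (r ^+ 2) (2 * r ^+ 2)) x * `|g x| `^ q <=
    \1_(half 1 r) x * `|g x| `^ q + \1_(half (-1) r) x * `|g x| `^ q.
  rewrite -mulrDl ler_wpM2r ?powR_ge0// indic01; case: ifPn => [/set_mem sx|_]; last first.
    by rewrite addr_ge0 ?indic_ge0.
  have [x0|x0] := leP 0 (x ord0 j).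
    rewrite (_ : \1_(half 1 r) x = 1) ?lerDl ?indic_ge0// indic01 mem_set//.
    by split => //=; rewrite mul1r.
  rewrite (_ : \1_(half (-1) r) x = 1) ?lerDr ?indic_ge0// indic01 mem_set//.
  by split => //=; rewrite mulN1r oppr_ge0 ltW.
have := Rint_le iS (itgD (ih 1) (ih (-1))) le; rewrite RintD// => h3.
have rq : 0 < r `^ q by exact: powR_gt0.
have -> : r `^ (- q) = (r `^ q)^-1 by rewrite powRN.
have -> : r `^ (- (2 * q)) = (r `^ q)^-1 * (r `^ q)^-1.
  by rewrite powRN mulrC powRrM powR_mulrn ?(ltW rq)// expr2 invfM.
have I2 : 0 <= \int[mu]_x (\1_(big r) x * `|g2 x| `^ q).
  exact: Rint_indic_pow_ge0.
have I1 : 0 <= \int[mu]_x (\1_(big r) x * `|u x| `^ q).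
  exact: Rint_indic_pow_ge0.
have t1 : 1 <= 2 `^ q :> R by rewrite -[leLHS](powRr0 2) ler_powR ?ler1n.
rewrite -[leLHS]mulrC ler_pdivrMr//.
exact: (shell_algebra rq h1 h2 h3 I1 I2 t1).
Qed.

(** Young's inequality with the conjugate exponents a = N / (N - 2 q) and N / (2 q). The first turns
    t^q into the critical power of t, the second turns r^(-2q) into r^-N, which balances the volume
    of the shell. *)
Lemma young_scaled (e : R) : 2 * q < N%:R -> 0 < e ->
  exists2 D, 0 <= D & forall r t, 0 < r -> 0 <= t ->
  r `^ (- (2 * q)) * t `^ q <= D * t `^ (critical2 N q) + e * (r ^+ N)^-1.
Proof.
move=> hN e0; pose a : R := N%:R / (N%:R - 2 * q).
have d0 : 0 < N%:R - 2 * q by rewrite subr_gt0.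
have qp : 0 < q by rewrite (lt_trans ltr01).
have N0 : 0 < N%:R :> R by rewrite (lt_trans _ hN)// mulr_gt0.
have a1 : 1 < a by rewrite /a ltr_pdivlMr// mul1r ltrBlDr ltrDl mulr_gt0.
have a0 : 0 < a by rewrite (lt_trans ltr01).
have qa : q * a = critical2 N q by rewrite /a /critical2 mulrA (mulrC q).
(* Chosen so that c^(N / (2 q)) = e, the coefficient wanted for r^-N. *)
pose c := e `^ (2 * q / N%:R); have c0 : 0 < c by exact: powR_gt0.
exists (a^-1 * c^-1 `^ a); first by rewrite mulr_ge0 ?powR_ge0// invr_ge0 ltW.
move=> r t r0 t0; pose X := (c * r `^ (- (2 * q))) `^ ((a - 1)^-1).
have X0 : 0 <= X by exact: powR_ge0.
have b0 : 0 <= c * r `^ (- (2 * q)) by rewrite mulr_ge0 ?powR_ge0// ltW.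
have am1 : a - 1 != 0 by rewrite subr_eq0 gt_eqF.
have Xa1 : X `^ (a - 1) = c * r `^ (- (2 * q)) by rewrite /X -powRrM mulVf// powRr1.
have y0 : 0 <= c^-1 * t `^ q by rewrite mulr_ge0 ?powR_ge0// invr_ge0 ltW.
have := young a1 X0 y0; rewrite Xa1.
have -> : c * r `^ (- (2 * q)) * (c^-1 * t `^ q) = r `^ (- (2 * q)) * t `^ q.
  by rewrite mulrACA divff ?mul1r// gt_eqF.
move=> /le_trans; apply; rewrite addrC; apply: lerD.
  rewrite powRM ?invr_ge0 ?powR_ge0 ?(ltW c0)// -powRrM qa mulrA.
  exact: lexx.
have Xa : X `^ a = e * (r ^+ N)^-1.
  have ea : (a - 1)^-1 * a = N%:R / (2 * q).
    have am : a - 1 = (2 * q) / (N%:R - 2 * q) by rewrite /a; field; rewrite gt_eqF.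
    by rewrite am /a; field; rewrite !gt_eqF// mulr_gt0.
  rewrite /X -powRrM ea powRM ?powR_ge0 ?(ltW c0)// /c -!powRrM.
  rewrite (_ : 2 * q / N%:R * (N%:R / (2 * q)) = 1); last by field; rewrite !gt_eqF// mulr_gt0.
  rewrite (_ : - (2 * q) * (N%:R / (2 * q)) = - N%:R); last by field; rewrite gt_eqF// mulr_gt0.
  by rewrite powRr1 ?(ltW e0)// powRN powR_mulrn// ltW.
rewrite Xa ler_piMl//; first by rewrite mulr_ge0 ?invr_ge0 ?exprn_ge0 ?(ltW r0) ?(ltW e0).
by rewrite gerBl invr_ge0 ltW.
Qed.

Lemma indic_big_le r x : 0 < r -> (\1_(big r) x : R) <= cB (3 * r) x.
Proof.
move=> r0; rewrite /cB; apply: indic_le => /andP[_ h] /=.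
have := norm2_le_sqn x; have n0 := normr_ge0 x; nra.
Qed.

Lemma itg_big r : 0 < r -> itg mu (fun x => \1_(big r) x : R).
Proof.
move=> r0; apply: (itg_le _ _ (itg_cB N (3 * r))) => [|x].
  by apply: measurable_indic; exact: measurable_shell.
by rewrite ger0_norm ?indic_ge0// indic_big_le.
Qed.

Lemma big_measure r : 0 < r -> \int[mu]_x (\1_(big r) x : R) <= 6 ^+ N * r ^+ N.
Proof.
move=> r0; have r30 : 0 <= 3 * r by rewrite mulr_ge0// ltW.
apply: (le_trans (Rint_le (itg_big r0) (itg_cB N (3 * r)) (fun x => indic_big_le x r0))).
rewrite /cB /Rintegral integral_indic//; last exact: measurable_norm_ball.
rewrite setIT [X in fine X](lebesgue_norm_ball N r30) /= -exprMn.
by rewrite (_ : 2 * (3 * r) = 6 * r)//; ring.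
Qed.

Lemma indic_vanish (r_ : nat -> R) F :
  (forall x, exists n, forall k, (n <= k)%N -> ~ big (r_ k) x) -> itg mu F ->
  \int[mu]_x (\1_(big (r_ n)) x * F x) @[n --> \oo] --> (0 : R).
Proof.
move=> hr iF; have -> : (0 : R) = \int[mu]_x (fun _ : V => 0 : R) x.
  by rewrite Rint_fun0.
apply: (Rint_dct (g := fun x => `|F x|)) => //.
- move=> n; apply: measurable_funM; last exact: itg_measurable iF.
  by apply: measurable_indic; exact: measurable_shell.
- exact: itg_norm.
- apply: aeW => x; apply: cvg_near_cst; have [n hn] := hr x.
  by exists n => // k /= /hn h; rewrite indic01 memNset// mul0r.
- move=> n; apply: aeW => x; rewrite normrM ger0_norm ?indic_ge0// indic01.
  by case: ifP; rewrite ?mul1r// mul0r.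
Qed.

Lemma shell_cvg (r_ : nat -> R) : 2 * q < N%:R -> (forall n, 0 < r_ n) ->
  itg mu (fun x => `|u x| `^ (critical2 N q)) ->
  (forall x, exists n, forall k, (n <= k)%N -> ~ big (r_ k) x) ->
  r_ n `^ (- q) * \int[mu]_x (\1_(shell (r_ n ^+ 2) (2 * r_ n ^+ 2)) x * `|g x| `^ q)
    @[n --> \oo] --> (0 : R).
Proof.
move=> hN r0 iu hr; apply/cvgrPdist_le => /= e e0.
pose C : R := 2 `^ q * (2 `^ q * 4).
have C0 : 0 < C by rewrite !mulr_gt0 ?powR_gt0.
have N60 : 0 < 6 ^+ N :> R by exact: exprn_gt0.
(* The factor 6^N bounds r^-N times the volume of [big r]; C is the constant of [shell_bound], and
   three terms share the error e / C. *)
pose e' := e / C / 3 / 6 ^+ N.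
have e'0 : 0 < e' by rewrite !divr_gt0.
have [D D0 hD] := young_scaled hN e'0.
have D1 : 0 < D + 1 by rewrite ltr_pwDr.
have eC : 0 < e / C / 3 by rewrite !divr_gt0.
have c1 := indic_vanish hr iu; have c2 := indic_vanish hr ig2.
have /cvgrPdist_le/(_ _ (divr_gt0 eC D1)) [n1 _ h1] := c1.
have /cvgrPdist_le/(_ _ eC) [n2 _ h2] := c2.
exists (maxn n1 n2) => // n /=; rewrite geq_max => /andP[l1 l2].
have r2 : 0 < r_ n ^+ 2 by rewrite exprn_gt0.
have mb : measurable (big (r_ n)) := measurable_shell _ _.
have iub : itg mu (fun x => \1_(big (r_ n)) x * `|u x| `^ q).
  by apply: (lbd_shell_itg mb r2 (b := 6 * r_ n ^+ 2)) => //;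
    [exact: measurable_powR_norm|exact: lbd_pow].
have i1 : itg mu (fun x => \1_(big (r_ n)) x * `|u x| `^ (critical2 N q)) by exact: itg_indic.
have i0 := itg_big (r0 n).
have rN0 : 0 < r_ n ^+ N by rewrite exprn_gt0.
have hU : r_ n `^ (- (2 * q)) * \int[mu]_x (\1_(big (r_ n)) x * `|u x| `^ q) <=
    D * \int[mu]_x (\1_(big (r_ n)) x * `|u x| `^ (critical2 N q)) + e / C / 3.
  rewrite -RintZ//.
  apply: (@le_trans _ _ (\int[mu]_x (D * (\1_(big (r_ n)) x * `|u x| `^ (critical2 N q))
      + e' * (r_ n ^+ N)^-1 * \1_(big (r_ n)) x))).
    apply: Rint_le; [exact: itgZ|by apply: itgD; exact: itgZ|move=> x].
    have := ler_wpM2l (indic_ge0 (big (r_ n)) x) (hD _ _ (r0 n) (normr_ge0 (u x))).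
    move: (\1_(big (r_ n)) x : R) (_ `^ _) (_ `^ _) (_ `^ _) => i A B E h.
    by apply: le_trans (le_trans h _); rewrite le_eqVlt; apply/orP; left; apply/eqP; ring.
  rewrite RintD; [|exact: itgZ..]; rewrite !RintZ// lerD2l.
  apply: (le_trans (ler_wpM2l _ (big_measure (r0 n)))).
    by rewrite mulr_ge0 ?invr_ge0 ?(ltW e'0) ?(ltW rN0).
  by rewrite (mulrC (6 ^+ N)) mulrA divfK ?gt_eqF// /e' divfK// gt_eqF.
have I1 : 0 <= \int[mu]_x (\1_(big (r_ n)) x * `|u x| `^ (critical2 N q)).
  exact: Rint_indic_pow_ge0.
have I2 : 0 <= \int[mu]_x (\1_(big (r_ n)) x * `|g2 x| `^ q).
  exact: Rint_indic_pow_ge0.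
have k1 := h1 n l1; have k2 := h2 n l2.
rewrite /= sub0r normrN (ger0_norm I1) in k1.
rewrite /= sub0r normrN (ger0_norm I2) in k2.
rewrite sub0r normrN ger0_norm; last first.
  by apply: mulr_ge0; [exact: powR_ge0|exact: Rint_indic_pow_ge0].
apply: (le_trans (shell_bound (r0 n))); rewrite -/C mulrC -ler_pdivlMr//.
apply: (le_trans (lerD hU k2)).
have k3 : D * \int[mu]_x (\1_(big (r_ n)) x * `|u x| `^ (critical2 N q)) <= e / C / 3.
  rewrite ler_pdivlMr// in k1; apply: le_trans k1.
  by rewrite mulrC ler_wpM2l// lerDl.
apply: (le_trans (lerD (lerD k3 (lexx _)) (lexx _))); lra.
Qed.

End shells.

(** * Multiplication by x.grad u *)

Section radial_multiplier.
Variables (R : realType) (N : nat).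
Local Notation V := 'rV[R]_N.
Local Notation mu := (lebesgue_rV R N).
Implicit Types (x : V) (i j : 'I_N) (a b c : R).

Variables (u : V -> R) (ud : 'I_N -> V -> R) (ud2 : 'I_N -> 'I_N -> V -> R).
Variables (f : V -> R) (p q : R).
Hypotheses (p1 : 1 < p) (q1 : 1 < q).

Definition rad x := \sum_i x ord0 i * ud i x.
Definition hessr x := \sum_i \sum_j x ord0 i * x ord0 j * ud2 j i x.

(** Here a, b, c stand for h, h', h'' at |x|^2, and the inserted values are the first and pure
    second derivatives of x_i h(|x|^2). Summing over i leaves radial quantities only. *)
Lemma sum_energy_expr_radial a b c x : \sum_i energy_expr ud ud2 f p q
    (fun j => x ord0 i * (b * (2 * x ord0 j)) + a * (j == i)%:R)
    (fun j => x ord0 i * (2 * b + 4 * (x ord0 j ^+ 2 * c))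
              + 4 * ((j == i)%:R * (b * x ord0 j)))
    (x ord0 i * a) i x =
  (N%:R * a + 2 * (sqn x * b)) * (q^-1 * `|lap ud2 x| `^ q + p^-1 * grn ud x `^ p)
  - 2 * a * `|lap ud2 x| `^ q - a * grn ud x `^ p
  - 4 * b * (wfun ud2 q x * hessr x) - 2 * b * (grn ud x `^ (p - 2) * rad x ^+ 2)
  - wfun ud2 q x * ((2 * N%:R + 4) * b + 4 * (sqn x * c)) * rad x + a * (f x * rad x).
Proof.
have hG : \sum_i afun ud p i x * ud i x = grn ud x `^ p.
  rewrite -(vnorm_pow2 (ud^~ x) p1) mulr_sumr; apply: eq_bigr => i _.
  by rewrite /afun mulrA.
have hL : wfun ud2 q x * lap ud2 x = `|lap ud2 x| `^ q by exact: spow_mul.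
set w := wfun ud2 q x in hL *; set A := \sum_j afun ud p j x * x ord0 j.
have hA : A = grn ud x `^ (p - 2) * rad x.
  by rewrite /A /rad mulr_sumr; apply: eq_bigr => i _; rewrite /afun; ring.
have pick (F : 'I_N -> R) i : \sum_j (j == i)%:R * F j = F i.
  rewrite (bigD1 i)//= eqxx mul1r big1 ?addr0// => j /negbTE ->.
  by rewrite mul0r.
have term i : energy_expr ud ud2 f p q
    (fun j => x ord0 i * (b * (2 * x ord0 j)) + a * (j == i)%:R)
    (fun j => x ord0 i * (2 * b + 4 * (x ord0 j ^+ 2 * c))
              + 4 * ((j == i)%:R * (b * x ord0 j)))
    (x ord0 i * a) i x =
   (2 * b * x ord0 i ^+ 2 + a) * (q^-1 * `|lap ud2 x| `^ q + p^-1 * grn ud x `^ p)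
   - (4 * (w * b) * (\sum_j x ord0 i * x ord0 j * ud2 j i x) + 2 * (w * a) * ud2 i i x
      + (w * ((2 * N%:R + 4) * b + 4 * (sqn x * c)) * (x ord0 i * ud i x)
         + 2 * b * A * (x ord0 i * ud i x) + a * (afun ud p i x * ud i x)
         - a * f x * (x ord0 i * ud i x))).
  rewrite /energy_expr eqxx mulr1 -/w.
  have -> : \sum_j 2 * (w * (x ord0 i * (b * (2 * x ord0 j)) + a * (j == i)%:R)) * ud2 j i x =
    4 * (w * b) * (\sum_j x ord0 i * x ord0 j * ud2 j i x) + 2 * (w * a) * ud2 i i x.
    rewrite -(pick (fun j => ud2 j i x)) !mulr_sumr -big_split; apply: eq_bigr => j _ /=.
    by move: (ud2 j i x) => t; ring.
  (* The Laplacian of x_i h(|x|^2) is x_i ((2 N + 4) h' + 4 |x|^2 h''). *)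
  have -> : \sum_j (x ord0 i * (2 * b + 4 * (x ord0 j ^+ 2 * c))
              + 4 * ((j == i)%:R * (b * x ord0 j))) =
    ((2 * N%:R + 4) * b + 4 * (sqn x * c)) * x ord0 i.
    transitivity (\sum_(j < N) (2 * b * x ord0 i + 4 * c * x ord0 i * x ord0 j ^+ 2
        + 4 * b * ((j == i)%:R * x ord0 j))).
      by apply: eq_bigr => j _; ring.
    rewrite !big_split/= -!mulr_sumr pick -/(sqn x) sumr_const card_ord -[_ *+ N]mulr_natr.
    by move: (sqn x) (N%:R : R) => T M; ring.
  have -> : \sum_j afun ud p j x * (x ord0 i * (b * (2 * x ord0 j)) + a * (j == i)%:R) =
    2 * b * A * x ord0 i + a * afun ud p i x.
    rewrite -(pick (fun j => afun ud p j x)) /A mulr_sumr mulr_suml mulr_sumr -big_split.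
    apply: eq_bigr => j _ /=; by move: (afun ud p j x) => t; ring.
  move: (\sum_j x ord0 i * x ord0 j * ud2 j i x) => S.
  move: (`|lap ud2 x| `^ q) (grn ud x `^ p) => L' G'.
  move: (sqn x) (afun ud p i x) (ud2 i i x) (ud i x) (f x) (x ord0 i) => T a' u2 u1 f' y.
  ring.
rewrite (eq_bigr _ (fun i _ => term i)) sumrB -mulr_suml.
have -> : \sum_(i < N) (2 * b * x ord0 i ^+ 2 + a) = N%:R * a + 2 * (sqn x * b).
  rewrite big_split/= -mulr_sumr -/(sqn x) sumr_const card_ord -[_ *+ N]mulr_natr.
  by move: (N%:R : R) => M; ring.
rewrite !big_split/= sumrN -!mulr_sumr -/(hessr x) -/(lap ud2 x) -/(rad x) hG hA -hL.
move: (hessr x) (rad x) (lap ud2 x) (grn ud x `^ p) (grn ud x `^ (p - 2)) (sqn x) (N%:R : R) (f x).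
move=> H S L' G P T M f'; ring.
Qed.

Lemma sum_chain_integrand_radial e (h h1 : R -> R) x : smooth1 h -> (forall t : R, is_derive t 1 h (h1 t)) ->
  \sum_i chain_integrand u ud e (fun x => x ord0 i * h (sqn x)) i x =
  h (sqn x) * (spow e (u x) * rad x)
  + e^-1 * ((2 * (sqn x * h1 (sqn x)) + N%:R * h (sqn x)) * `|u x| `^ e).
Proof.
move=> sh dh; rewrite /chain_integrand big_split/=; congr (_ + _).
  by rewrite /rad !mulr_sumr; apply: eq_bigr => i _; ring.
rewrite -mulr_sumr -mulr_suml; congr (_ * (_ * _)).
transitivity (\sum_(i < N) (2 * h1 (sqn x) * x ord0 i ^+ 2 + h (sqn x))).
  apply: eq_bigr => i _; rewrite (pderiv_coordM i i x sh dh) eqxx mulr1; congr (_ + _).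
  by move: (h1 _) (x ord0 i) => A B; ring.
rewrite big_split/= -mulr_sumr -/(sqn x) sumr_const card_ord -[_ *+ N]mulr_natl.
by rewrite -mulrA (mulrC (h1 _)).
Qed.

Lemma sum_energy_integrand_radial (h h1 h2 : R -> R) x : smooth1 h ->
  (forall t : R, is_derive t 1 h (h1 t)) -> (forall t : R, is_derive t 1 h1 (h2 t)) ->
  \sum_i energy_integrand ud ud2 f p q (fun x => x ord0 i * h (sqn x)) i x =
  (N%:R * h (sqn x) + 2 * (sqn x * h1 (sqn x)))
    * (q^-1 * `|lap ud2 x| `^ q + p^-1 * grn ud x `^ p)
  - 2 * h (sqn x) * `|lap ud2 x| `^ q - h (sqn x) * grn ud x `^ p
  - 4 * h1 (sqn x) * (wfun ud2 q x * hessr x)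
  - 2 * h1 (sqn x) * (grn ud x `^ (p - 2) * rad x ^+ 2)
  - wfun ud2 q x * ((2 * N%:R + 4) * h1 (sqn x) + 4 * (sqn x * h2 (sqn x))) * rad x
  + h (sqn x) * (f x * rad x).
Proof.
move=> sh dh dh1; rewrite -sum_energy_expr_radial; apply: eq_bigr => i _; rewrite energy_integrandE.
congr (energy_expr _ _ _ _ _ _ _ _ i x); apply/funext => j; first exact: pderiv_coordM.
exact: pderivs2_coordM.
Qed.

Lemma rad_le x : rad x ^+ 2 <= sqn x * grn ud x ^+ 2.
Proof.
have := cauchy_schwarz (fun i => x ord0 i) (ud^~ x); rewrite -/(rad x) -/(grn ud x) => h.
rewrite -[leLHS]real_normK ?num_real//.
have -> : sqn x * grn ud x ^+ 2 = (vnorm (fun i => x ord0 i) * grn ud x) ^+ 2.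
  by rewrite exprMn (vnorm_sqr (fun i => x ord0 i)).
by rewrite ler_pXn2r ?nnegrE// mulr_ge0 ?vnorm_ge0.
Qed.

End radial_multiplier.

(** * Passage to the limit *)

Section local_boundedness.
Variables (R : realType) (N : nat).
Local Notation V := 'rV[R]_N.
Local Notation mu := (lebesgue_rV R N).
Implicit Types (F G : V -> R) (x : V).

Lemma lbdD F G : lbd F -> lbd G -> lbd (fun x => F x + G x).
Proof.
move=> hF hG r K r0; have [A hA] := hF r K r0; have [B hB] := hG r K r0.
exists (A + B); apply: filterS2 hA hB => x a b rx.
by rewrite (le_trans (ler_normD _ _))// lerD ?a ?b.
Qed.

Lemma lbdM F G : lbd F -> lbd G -> lbd (fun x => F x * G x).
Proof.
move=> hF hG r K r0; have [A hA] := hF r K r0; have [B hB] := hG r K r0.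
by exists (A * B); apply: filterS2 hA hB => x a b rx; rewrite normrM ler_pM ?a ?b.
Qed.

Lemma lbd_cst c : lbd ((fun=> c) : V -> R).
Proof. by move=> r K r0; exists `|c|; apply: aeW. Qed.

Definition weight (sg : R) x := sqn x `^ (- (sg / 2)).

(** The origin is included: there both sides are 0 if sg is nonzero and 1 if sg = 0. *)
Lemma weightE sg x : (enorm x `^ sg)^-1 = weight sg x.
Proof.
rewrite enorm_sqn -powR12_sqrt ?sqn_ge0// -powRrM -powRN /weight; congr powR.
by rewrite mulrC.
Qed.

Lemma weight_ge0 sg x : 0 <= weight sg x. Proof. exact: powR_ge0. Qed.

Lemma measurable_weight sg : measurable_fun setT (@weight sg).
Proof.
have -> : @weight sg = fun x => `|sqn x| `^ (- (sg / 2)).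
  by apply/funext => x; rewrite ger0_norm ?sqn_ge0.
by apply: measurable_powR_norm; exact: measurable_sqn.
Qed.

Lemma lbd_weight sg : 0 <= sg -> lbd (@weight sg).
Proof.
move=> s0 r K r0; exists ((r ^+ 2) `^ (- (sg / 2))); apply: aeW => x /andP[rx _].
have h : r ^+ 2 <= sqn x.
  by apply: le_trans (norm2_le_sqn x); rewrite ler_pXn2r ?nnegrE ?(ltW r0).
have r2 : 0 < r ^+ 2 by rewrite exprn_gt0.
rewrite ger0_norm ?weight_ge0// /weight !powRN lef_pV2 ?posrE ?powR_gt0 ?(lt_le_trans r2)//.
by rewrite ge0_ler_powR ?nnegrE ?divr_ge0 ?sqn_ge0 ?(ltW r2).
Qed.

Lemma ae_neq0 : (0 < N)%N -> {ae mu, forall x : V, x != 0}.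
Proof.
move=> N0; exists [set x : V | `|x| <= 0]; split.
- exact: measurable_norm_ball.
- by rewrite [LHS](lebesgue_norm_ball N (lexx 0)) mulr0 expr0n eqn0Ngt N0.
- by move=> x /= /negP; rewrite negbK => /eqP ->; rewrite normr0.
Qed.

Lemma sqn_gt0 x : x != 0 -> 0 < sqn x.
Proof.
move=> x0; apply: lt_le_trans (norm2_le_sqn x).
by rewrite exprn_gt0// normr_gt0.
Qed.

(** On a ball the weight |x|^-sg is bounded below off the origin because sg >= 0. This makes |u|^r
    locally integrable, as the chain rule demands. *)
Lemma L1loc_weighted F sg : (0 < N)%N -> 0 <= sg -> measurable_fun setT F ->
  (forall x, 0 <= F x) -> itg mu (fun x => F x * weight sg x) -> L1loc F.
Proof.
move=> N0 s0 mF F0 iF; split=> // K.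
pose C : R := (N%:R * K ^+ 2) `^ (sg / 2).
apply: (itg_ae_le _ _ (itgZ C iF)).
  by apply: measurable_funM => //; exact: measurable_cB.
apply: filterS (ae_neq0 N0) => x x0; have t0 := sqn_gt0 x0.
rewrite cBE; case: ifPn => xK; last by rewrite mul0r normr0 mulr_ge0 ?powR_ge0// mulr_ge0// weight_ge0.
rewrite mul1r ger0_norm// mulrCA ler_peMr// /weight powRN ler_pdivlMr ?powR_gt0// mul1r /C.
have K0 : 0 <= K by exact: le_trans xK.
rewrite ge0_ler_powR ?nnegrE ?divr_ge0 ?sqn_ge0 ?mulr_ge0 ?sqr_ge0//.
by apply: (le_trans (sqn_le x)); rewrite ler_wpM2l// ler_pXn2r ?nnegrE.
Qed.

End local_boundedness.

(** Here a is theta, tb is |x|^2 theta', o the weight and S = x.grad u; each U is a power |u|^(k-2)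
    u and each v the matching |u|^k; X and Y are the Hessian and gradient boundary terms, e the
    remainder. The terms a S U of the source cancel against those of the three chain rules. *)
Lemma total_algebra (R : realType) (q' p' r' ps' qs' lam tau1 tau2 sg M a tb LL GG X Y e S o
    Ur Ups Uqs vr vps vqs : R) :
  (M * a + 2 * tb) * (q' * LL + p' * GG) - 2 * a * LL - a * GG - X - Y - e
    + a * ((lam * (Ur * o) + tau1 * Ups + tau2 * Uqs) * S)
  - lam * (a * o * (Ur * S) + r' * ((2 * (o * tb - sg / 2 * (a * o)) + M * (a * o)) * vr))
  - tau1 * (a * (Ups * S) + ps' * ((2 * tb + M * a) * vps))
  - tau2 * (a * (Uqs * S) + qs' * ((2 * tb + M * a) * vqs)) =
  (a * ((M * q' - 2) * LL + (M * p' - 1) * GG - lam * ((M - sg) * r') * (vr * o)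
        - tau1 * (M * ps') * vps - tau2 * (M * qs') * vqs)
   + 2 * tb * (q' * LL + p' * GG - lam * r' * (vr * o) - tau1 * ps' * vps
       - tau2 * qs' * vqs) - X - Y) - e.
Proof. by field. Qed.

Lemma kap_large (R : realType) (t : R) : 0 < t ->
  exists n, forall k, (n <= k)%N -> 2 * (kap R k)^-1 < t < kap R k.
Proof.
move=> t0; exists (Num.truncn (t + 2 / t)).+1 => k nk.
have h : t + 2 / t < kap R k.
  apply: (lt_le_trans (truncnS_gt _)); apply: le_trans (kap_ge_nat _ k).
  by rewrite ler_nat.
have t2 : 0 < 2 / t by rewrite divr_gt0.
have k0 := kap_gt0 R k; apply/andP; split; last lra.
rewrite ltr_pdivrMr// mulrC -ltr_pdivrMr//; lra.
Qed.

Lemma young_le (R : realType) (q x y : R) : 1 < q -> 0 <= x -> 0 <= y ->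
  x `^ (q - 1) * y <= x `^ q + y `^ q.
Proof.
move=> q1 x0 y0; have q0 : 0 < q by rewrite (lt_trans ltr01).
have := young q1 x0 y0; move=> /le_trans; apply; apply: lerD.
  by rewrite ler_piMl ?powR_ge0// gerBl invr_ge0 ltW.
by rewrite ler_piMl ?powR_ge0// invf_le1// ltW.
Qed.

Lemma cvg_bigsum0 (R : realType) (J : Type) (s : seq J) (F : J -> nat -> R) :
  (forall j, F j n @[n --> \oo] --> (0 : R)) ->
  (\sum_(j <- s) F j n) @[n --> \oo] --> (0 : R).
Proof.
move=> h; elim: s => [|j s IH].
  by under eq_fun do rewrite big_nil; exact: cvg_cst.
have H : F j n + \sum_(k <- s) F k n @[n --> \oo] --> (0 + 0 : R) by exact: cvgD.
rewrite addr0 in H; rewrite (_ : (fun n => _) = fun n => F j n + \sum_(k <- s) F k n)//.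
by apply/funext => n; rewrite big_cons.
Qed.

Section pohozaev.
Variables (R : realType) (N : nat).
Local Notation V := 'rV[R]_N.
Local Notation mu := (lebesgue_rV R N).
Implicit Types (x : V) (i j : 'I_N) (n : nat).

Variables (u : V -> R) (ud : 'I_N -> V -> R) (ud2 : 'I_N -> 'I_N -> V -> R).
Variables (p q sg r ps qs lam tau1 tau2 : R).
Hypotheses (N0 : (0 < N)%N) (p1 : 1 < p) (q1 : 1 < q) (qN : 2 * q < N%:R)
  (sg0 : 0 <= sg) (r1 : 1 < r) (ps1 : 1 < ps) (qs1 : 1 < qs) (qsE : qs = critical2 N q).
Hypotheses (hu1 : forall j, wd [:: j] u (ud j))
  (hu2 : forall j i, wd [:: i] (ud j) (ud2 j i))
  (hui : forall i, wd [:: i; i] u (ud2 i i)) (Lu : L1loc u).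
Hypotheses (bu : lbd u) (bud : forall j, lbd (ud j)) (bw : lbd (wfun ud2 q)).
Hypotheses (iL : itg mu (fun x => `|lap ud2 x| `^ q)) (iG : itg mu (fun x => grn ud x `^ p))
  (iH : forall j i, itg mu (fun x => `|ud2 j i x| `^ q))
  (ir : itg mu (fun x => `|u x| `^ r * weight sg x))
  (ips : itg mu (fun x => `|u x| `^ ps)) (iqs : itg mu (fun x => `|u x| `^ qs)).

Definition source x := lam * (spow r (u x) * weight sg x) + tau1 * spow ps (u x) + tau2 * spow qs (u x).

Hypothesis weak : forall v, tf v ->
  \int[mu]_x (wfun ud2 q x * \sum_i pderivs [:: i; i] v x) +
  \int[mu]_x (grn ud x `^ (p - 2) * \sum_i ud i x * pderiv i v x) =
  \int[mu]_x (source x * v x).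

Let mu_ : measurable_fun setT u := proj1 Lu.

Lemma measurable_source : measurable_fun setT source.
Proof.
apply: measurable_funD; last by apply: measurable_funM => //; exact: measurable_spow.
apply: measurable_funD; apply: measurable_funM => //; last exact: measurable_spow.
by apply: measurable_funM; [exact: measurable_spow|exact: measurable_weight].
Qed.

Lemma lbd_source : lbd source.
Proof.
apply: lbdD; last by apply: lbdM; [exact: lbd_cst|exact: lbd_spow].
apply: lbdD; apply: lbdM; [exact: lbd_cst| |exact: lbd_cst|exact: lbd_spow].
by apply: lbdM; [exact: lbd_spow|exact: lbd_weight].
Qed.

(* The radial profile of the cutoff times |x|^-sg, in terms of the square of |x|. *)
Definition hsig n (t : R) := theta n t * t `^ (- (sg / 2)).

Lemma smooth1_hsig n : smooth1 (hsig n).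
Proof.
have /andP[k0 _] := kapV R n.
by apply: (smooth1_powmul _ k0) => [|t /ltW tk]; [exact: smooth1_theta|exact: theta_eq0_le].
Qed.

Lemma tf0_radial (h : R -> R) n : smooth1 h -> (forall t, theta n t = 0 -> h t = 0) ->
  tf0 (fun x : V => h (sqn x)).
Proof.
move=> sh h0; have [[_ [K hK]] [e e0 he]] := tf0_psi R N n.
split; first split.
- by apply: smooth_comp => //; exact: smooth_sqn.
- by exists K => x /hK; exact: h0.
- by exists e => // x /he; exact: h0.
Qed.

Variables (th1 th2 : nat -> R -> R) (C : R).
Hypotheses (C0 : 0 <= C) (d1 : forall n (t : R), is_derive t 1 (theta n) (th1 n t))
  (d2 : forall n (t : R), is_derive t 1 (th1 n) (th2 n t))
  (cth : forall n, continuous (th1 n) /\ continuous (th2 n))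
  (hth : forall n t, [/\ `|t * th1 n t| <= C, `|t ^+ 2 * th2 n t| <= C &
        ~~ (kap R n <= t <= 2 * kap R n) -> ~~ ((kap R n)^-1 <= t <= 2 * (kap R n)^-1) ->
        th1 n t = 0 /\ th2 n t = 0]).

Definition hsig1 n (t : R) := theta n t * (- (sg / 2) * t `^ (- (sg / 2) - 1))
  + t `^ (- (sg / 2)) * th1 n t.

Lemma is_derive_hsig n (t : R) : is_derive t 1 (hsig n) (hsig1 n t).
Proof.
have /andP[k0 _] := kapV R n.
by apply: (is_derive_powmul _ k0) => s /ltW; exact: theta_eq0_le.
Qed.

(** The last term, from the derivative of t^(-sg/2), is what turns N into N - sg in the weighted
    part of [limit_integrand]. *)
Lemma hsig1E n x : sqn x * hsig1 n (sqn x) =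
  weight sg x * (sqn x * th1 n (sqn x)) - sg / 2 * (theta n (sqn x) * weight sg x).
Proof.
rewrite /hsig1 /weight; have t0 := sqn_ge0 x; move: (sqn x) t0 => t t0.
have [->|tn0] := eqVneq t 0.
  by rewrite theta_eq0_le ?(ltW (proj1 (andP (kapV R n))))// !mul0r mulr0 mulr0 subrr.
have tp : 0 < t by rewrite lt_def tn0.
have -> : t `^ (- (sg / 2)) = t * t `^ (- (sg / 2) - 1).
  rewrite -{2}(powRr1 t0) -powRD; last by rewrite tn0 implybT.
  by rewrite addrC subrK.
by move: (t `^ _) (theta n t) (th1 n t) => A B D; ring.
Qed.

(** The factor of [theta n] in [bulk]; its integral is the difference of the two sides of the
    Pohozaev identity. *)
Definition limit_integrand x :=
  (N%:R / q - 2) * `|lap ud2 x| `^ q + (N%:R / p - 1) * grn ud x `^ p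
  - lam * ((N%:R - sg) / r) * (`|u x| `^ r * weight sg x)
  - tau1 * (N%:R / ps) * `|u x| `^ ps - tau2 * (N%:R / qs) * `|u x| `^ qs.

Definition boundary_integrand x := q^-1 * `|lap ud2 x| `^ q + p^-1 * grn ud x `^ p
  - lam * r^-1 * (`|u x| `^ r * weight sg x) - tau1 * ps^-1 * `|u x| `^ ps
  - tau2 * qs^-1 * `|u x| `^ qs.

Definition bulk n x := theta n (sqn x) * limit_integrand x + 2 * (sqn x * th1 n (sqn x)) * boundary_integrand x
  - 4 * th1 n (sqn x) * (wfun ud2 q x * hessr ud2 x)
  - 2 * th1 n (sqn x) * (grn ud x `^ (p - 2) * rad ud x ^+ 2).

(** The product of w, the Laplacian factor of the cutoff and x.grad u. It is kept apart from [bulk],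
    since its bound involves |grad u|^q on shells depending on n. *)
Definition remainder n x := wfun ud2 q x * ((2 * N%:R + 4) * th1 n (sqn x)
  + 4 * (sqn x * th2 n (sqn x))) * rad ud x.

(** Each chain rule carries its coefficient from the source, so that the products of the source with
    x.grad u cancel. *)
Definition total n x := \sum_i energy_integrand ud ud2 source p q (fun x => x ord0 i * theta n (sqn x)) i x
  - lam * (\sum_i chain_integrand u ud r (fun x => x ord0 i * hsig n (sqn x)) i x)
  - tau1 * (\sum_i chain_integrand u ud ps (fun x => x ord0 i * theta n (sqn x)) i x)
  - tau2 * (\sum_i chain_integrand u ud qs (fun x => x ord0 i * theta n (sqn x)) i x).

Lemma totalE n x : total n x = bulk n x - remainder n x.
Proof.
rewrite /total (sum_energy_integrand_radial _ _ _ p1 q1 _ (@smooth1_theta R n) (d1 n) (d2 n)).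
rewrite (sum_chain_integrand_radial _ _ _ _ (smooth1_hsig n) (is_derive_hsig n)).
rewrite !(sum_chain_integrand_radial _ _ _ _ (@smooth1_theta R n) (d1 n)) hsig1E.
exact: total_algebra.
Qed.

Let Lr : L1loc (fun x => `|u x| `^ r).
Proof.
by apply: (L1loc_weighted N0 sg0 _ _ ir) => //; exact: measurable_powR_norm.
Qed.

Lemma total_int n : itg mu (total n) /\ \int[mu]_x total n x = 0.
Proof.
have tp := tf0_psi R N n; have tp0 x : 0 <= theta n (sqn x) by exact: theta_ge0.
have ts : tf0 (fun x : V => hsig n (sqn x)).
  by apply: (tf0_radial (n := n)) (smooth1_hsig n) _ => t; rewrite /hsig => ->; rewrite mul0r.
have ts0 x : 0 <= hsig n (sqn x) by rewrite mulr_ge0 ?powR_ge0// theta_ge0.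
have hP i := energy_identity_coord p1 q1 hu1 hu2 hui measurable_source bud bw lbd_source iL iG weak Lu i tp tp0.
have hr i := chain_rule_coord r1 hu1 Lu bu Lr i ts ts0.
have hps i := chain_rule_coord ps1 hu1 Lu bu (itg_L1loc ips) i tp tp0.
have hqs i := chain_rule_coord qs1 hu1 Lu bu (itg_L1loc iqs) i tp tp0.
have sum (F : 'I_N -> V -> R) : (forall i, itg mu (F i) /\ \int[mu]_x F i x = 0) ->
    itg mu (fun x => \sum_i F i x) /\ \int[mu]_x (\sum_i F i x) = 0.
  move=> h; split; first by apply: itg_sum => i; have [] := h i.
  rewrite Rint_sum; last by move=> i; have [] := h i.
  by rewrite big1// => i _; have [] := h i.
have [iP eP] := sum _ hP; have [ir' er] := sum _ hr.
have [ip' ep] := sum _ hps; have [iq' eq] := sum _ hqs.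
have j1 := itgB iP (itgZ lam ir'); have j2 := itgB j1 (itgZ tau1 ip').
split; first exact: (itgB j2 (itgZ tau2 iq')).
rewrite /total (RintB j2 (itgZ tau2 iq')) (RintB j1 (itgZ tau1 ip')) (RintB iP (itgZ lam ir')).
by rewrite (RintZ _ ir') (RintZ _ ip') (RintZ _ iq') eP er ep eq !mulr0 !subr0.
Qed.

Let mud j : measurable_fun setT (ud j). Proof. by have [_ []] := hu1 j. Qed.
Let mud2 j i : measurable_fun setT (ud2 j i). Proof. by have [_ []] := hu2 j i. Qed.

Let mlap : measurable_fun setT (lap ud2).
Proof. by apply: measurable_sum => i; exact: mud2. Qed.

Let mw : measurable_fun setT (wfun ud2 q). Proof. exact: measurable_spow. Qed.

Let mgrn : measurable_fun setT (grn ud). Proof. exact: measurable_grn hu1. Qed.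

Let mrad : measurable_fun setT (rad ud).
Proof.
apply: measurable_sum => i; apply: measurable_funM; last exact: mud.
exact: measurable_rV_coord.
Qed.

Let mhessr : measurable_fun setT (hessr ud2).
Proof.
apply: measurable_sum => i; apply: measurable_sum => j.
apply: measurable_funM; last exact: mud2.
by apply: measurable_funM; exact: measurable_rV_coord.
Qed.

Let mrd (h : R -> R) : continuous h -> measurable_fun setT (fun x : V => h (sqn x)).
Proof.
move=> ch; apply: continuous_rV_measurable; apply: continuous_chi => //.
exact: continuous_sqn.
Qed.

Let cth1 n : continuous (th1 n) := proj1 (cth n).
Let cth2 n : continuous (th2 n) := proj2 (cth n).

Lemma itg_limit_integrand : itg mu limit_integrand.
Proof.
apply: itgB; last exact: itgZ.
apply: itgB; last exact: itgZ.
apply: itgB; last exact: itgZ.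
by apply: itgD; exact: itgZ.
Qed.

Lemma itg_boundary_integrand : itg mu boundary_integrand.
Proof.
apply: itgB; last exact: itgZ.
apply: itgB; last exact: itgZ.
apply: itgB; last exact: itgZ.
by apply: itgD; exact: itgZ.
Qed.

Definition hessd x := \sum_i \sum_j (`|lap ud2 x| `^ q + `|ud2 j i x| `^ q).

Definition bulk_dom x := `|limit_integrand x| + 2 * C * `|boundary_integrand x| + 4 * C * hessd x + 2 * C * grn ud x `^ p.

Lemma itg_bulk_dom : itg mu bulk_dom.
Proof.
apply: itgD; last exact: itgZ.
apply: itgD; last first.
  by apply: itgZ; apply: itg_sum => i; apply: itg_sum => j; exact: itgD.
apply: itgD; first exact: itg_norm itg_limit_integrand.
by apply: itgZ; exact: itg_norm itg_boundary_integrand.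
Qed.

Lemma normr_wfun x : `|wfun ud2 q x| = `|lap ud2 x| `^ (q - 1).
Proof. exact: normr_spow. Qed.

Lemma coord2_le x i j : `|x ord0 i * x ord0 j| <= sqn x.
Proof.
have h k : x ord0 k ^+ 2 <= sqn x.
  by rewrite /sqn (bigD1 k)//= lerDl; apply: sumr_ge0 => l _; exact: sqr_ge0.
have h1 := h i; have h2 := h j.
have a1 := sqr_ge0 (x ord0 i - x ord0 j); have a2 := sqr_ge0 (x ord0 i + x ord0 j).
rewrite sqrrB in a1; rewrite sqrrD in a2.
by rewrite ler_norml; apply/andP; split; lra.
Qed.

(** Since |x_i x_j| <= |x|^2, the factor theta' becomes the bounded |x|^2 theta'; Young's inequality
    then separates w from the second derivatives. *)
Lemma hessr_bound n x : `|th1 n (sqn x) * (wfun ud2 q x * hessr ud2 x)| <= C * hessd x.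
Proof.
have [h1 _ _] := hth n (sqn x).
have -> : th1 n (sqn x) * (wfun ud2 q x * hessr ud2 x) =
  \sum_i \sum_j th1 n (sqn x) * (x ord0 i * x ord0 j) * (wfun ud2 q x * ud2 j i x).
  rewrite /hessr !mulr_sumr; apply: eq_bigr => i _; rewrite !mulr_sumr.
  by apply: eq_bigr => j _; move: (th1 _ _) (ud2 j i x) => A B; ring.
rewrite /hessd mulr_sumr; apply: (le_trans (ler_norm_sum _ _ _)); apply: ler_sum => i _.
rewrite mulr_sumr; apply: (le_trans (ler_norm_sum _ _ _)); apply: ler_sum => j _.
rewrite normrM; apply: ler_pM => //.
  apply: le_trans h1; rewrite !normrM [leRHS]mulrC (ger0_norm (sqn_ge0 x)) ler_wpM2l//.
  by rewrite -normrM coord2_le.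
by rewrite normrM normr_wfun; exact: young_le.
Qed.

Lemma rad_bound n x : `|th1 n (sqn x) * (grn ud x `^ (p - 2) * rad ud x ^+ 2)| <=
  C * grn ud x `^ p.
Proof.
have [h1 _ _] := hth n (sqn x).
have g0 : 0 <= grn ud x by exact: vnorm_ge0.
have -> : grn ud x `^ p = grn ud x `^ (p - 2) * grn ud x ^+ 2.
  have := spow_mul (grn ud x) p1; rewrite /spow ger0_norm// => <-.
  by rewrite -mulrA expr2.
rewrite (normrM (th1 n _)) (normrM (_ `^ _)) (ger0_norm (powR_ge0 _ _)) (ger0_norm (sqr_ge0 _)).
rewrite !(mulrCA _ (grn ud x `^ (p - 2))) ler_wpM2l ?powR_ge0//.
apply: (@le_trans _ _ (`|th1 n (sqn x)| * (sqn x * grn ud x ^+ 2))).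
  by rewrite ler_wpM2l// rad_le.
rewrite mulrA ler_wpM2r ?sqr_ge0//; apply: le_trans h1.
by rewrite normrM (ger0_norm (sqn_ge0 x)) mulrC.
Qed.

Lemma bulk_bound n x : `|bulk n x| <= bulk_dom x.
Proof.
have [h1 _ _] := hth n (sqn x).
have t0 : 0 <= theta n (sqn x) by exact: theta_ge0.
have t1 : theta n (sqn x) <= 1 by exact: theta_le1.
have k1 : `|theta n (sqn x) * limit_integrand x| <= `|limit_integrand x|.
  by rewrite normrM ger0_norm// ler_piMl.
have k2 : `|sqn x * th1 n (sqn x) * boundary_integrand x| <= C * `|boundary_integrand x|.
  by rewrite normrM ler_wpM2r.
have k3 := hessr_bound n x; have k4 := rad_bound n x.
rewrite /bulk /bulk_dom.
have -> : 2 * (sqn x * th1 n (sqn x)) * boundary_integrand x = 2 * (sqn x * th1 n (sqn x) * boundary_integrand x).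
  by rewrite !mulrA.
have -> : 4 * th1 n (sqn x) * (wfun ud2 q x * hessr ud2 x) =
  4 * (th1 n (sqn x) * (wfun ud2 q x * hessr ud2 x)) by rewrite !mulrA.
have -> : 2 * th1 n (sqn x) * (grn ud x `^ (p - 2) * rad ud x ^+ 2) =
  2 * (th1 n (sqn x) * (grn ud x `^ (p - 2) * rad ud x ^+ 2)) by rewrite !mulrA.
move: k1 k2 k3 k4.
move: (theta n (sqn x) * limit_integrand x) (sqn x * th1 n (sqn x) * boundary_integrand x)
  (th1 n (sqn x) * (wfun ud2 q x * hessr ud2 x))
  (th1 n (sqn x) * (grn ud x `^ (p - 2) * rad ud x ^+ 2)) => a b c d.
rewrite -!(mulrA _ C).
move: (`|limit_integrand x|) (C * `|boundary_integrand x|) (C * hessd x) (C * grn ud x `^ p) => A B E D.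
rewrite !ler_norml => /andP[a1 a2] /andP[b1 b2] /andP[c1 c2] /andP[e1 e2].
by apply/andP; split; lra.
Qed.

Lemma measurable_bulk n : measurable_fun setT (bulk n).
Proof.
have mt : measurable_fun setT (fun x : V => theta n (sqn x)).
  by apply: mrd; exact: smooth1_continuous (@smooth1_theta R n).
have m1 : measurable_fun setT (fun x : V => th1 n (sqn x)) by exact: mrd.
have mmain := itg_measurable itg_limit_integrand; have maux := itg_measurable itg_boundary_integrand.
have c2 (k : R) (F : V -> R) : measurable_fun setT F -> measurable_fun setT (fun x => k * F x).
  by move=> mF; exact: measurable_funM.
apply: measurable_funB; last first.
  apply: measurable_funM; first exact: c2.
  apply: measurable_funM; last exact: measurable_funX.
  have -> : (fun x => grn ud x `^ (p - 2)) = fun x => `|grn ud x| `^ (p - 2).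
    by apply/funext => x; rewrite ger0_norm// vnorm_ge0.
  exact: measurable_powR_norm.
apply: measurable_funB; last first.
  by apply: measurable_funM; [exact: c2|exact: measurable_funM].
apply: measurable_funD; first exact: measurable_funM.
apply: measurable_funM => //; apply: c2; apply: measurable_funM => //.
exact: measurable_sqn.
Qed.

Lemma bulk_cvg : \int[mu]_x bulk n x @[n --> \oo] --> \int[mu]_x limit_integrand x.
Proof.
apply: (Rint_dct (g := bulk_dom)); first exact: measurable_bulk.
- exact: itg_measurable itg_limit_integrand.
- exact: itg_bulk_dom.
(* At a point off the origin [theta n] is eventually 1 and [th1 n] is 0, so [bulk n] is eventually
   constant there. *)
- apply: filterS (ae_neq0 R N0) => x x0; apply: cvg_near_cst.
  have [n hn] := kap_large (sqn_gt0 x0); exists n => // k /= /hn /andP[k1 k2].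
  have [_ _ h] := hth k (sqn x).
  have [||e1 _] := h; first by rewrite negb_and -!ltNge k2.
    by rewrite negb_and -!ltNge k1 orbT.
  rewrite /bulk e1 theta_eq1 ?(ltW k1) ?(ltW k2)//.
  by rewrite !(mulr0, mul0r) !subr0 addr0 mul1r.
- by move=> n; apply: aeW => x; exact: bulk_bound.
Qed.

(** The squares of [rout n] and [rin n] are [kap n] and its inverse: the derivatives of [theta n]
    live on the shells [sh (rout n)] and [sh (rin n)]. *)
Definition rout n : R := n.+2%:R.
Definition rin n : R := n.+2%:R^-1.

Lemma rout_gt0 n : 0 < rout n. Proof. by rewrite /rout ltr0n. Qed.
Lemma rin_gt0 n : 0 < rin n. Proof. by rewrite invr_gt0 ltr0n. Qed.

Lemma big_rout x : exists n, forall k, (n <= k)%N -> ~ big (rout k) x.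
Proof.
exists (Num.truncn (sqn x)).+1 => k nk /andP[h _]; move: h; apply/negP; rewrite -ltNge.
apply: (lt_le_trans (truncnS_gt _)); apply: le_trans (kap_ge_nat _ k).
by rewrite ler_nat.
Qed.

Lemma big_rin x : exists n, forall k, (n <= k)%N -> ~ big (rin k) x.
Proof.
have [x0|x0] := leP (sqn x) 0.
  exists 0%N => k _ /andP[h _]; move: (le_trans h x0); apply/negP; rewrite -ltNge.
  by rewrite exprn_gt0// rin_gt0.
exists (Num.truncn (6 / sqn x)).+1 => k nk /andP[_ h]; move: h; apply/negP; rewrite -ltNge.
have k0 := kap_gt0 R k; rewrite /rin exprVn -/(kap R k) ltr_pdivrMr//.
rewrite mulrC -ltr_pdivrMr//.
apply: (lt_le_trans (truncnS_gt _)); apply: le_trans (kap_ge_nat _ k).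
by rewrite ler_nat.
Qed.

Definition sh (s : R) : set V := shell (s ^+ 2) (2 * s ^+ 2).

(** What Young's inequality gives for |w| |grad u| / s on the shell, coordinate by coordinate. The
    term with [lap] lives on the larger shell [big s], the one in [indic_vanish]. *)
Definition errd (s : R) x := \sum_j (\1_(big s) x * `|lap ud2 x| `^ q
  + s `^ (- q) * (\1_(sh s) x * `|ud j x| `^ q)).

Lemma errd_ge0 (s : R) x : 0 <= errd s x.
Proof.
apply: sumr_ge0 => j _; apply: addr_ge0; apply: mulr_ge0; rewrite ?mulr_ge0 ?powR_ge0 ?indic_ge0//.
Qed.

Lemma itg_shell_ud (s : R) j : 0 < s -> itg mu (fun x => \1_(sh s) x * `|ud j x| `^ q).
Proof.
move=> s0; have s2 : 0 < s ^+ 2 by rewrite exprn_gt0.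
apply: (lbd_shell_itg (measurable_shell _ _) s2 (@subset_refl _ _)).
  exact: measurable_powR_norm.
exact: lbd_pow.
Qed.

Lemma itg_big_lap (s : R) : itg mu (fun x => \1_(big s) x * `|lap ud2 x| `^ q).
Proof. by apply: itg_indic => //; exact: measurable_shell. Qed.

Lemma itg_errd (s : R) : 0 < s -> itg mu (errd s).
Proof.
move=> s0; apply: itg_sum => j; apply: itgD; first exact: itg_big_lap.
by apply: itgZ; exact: itg_shell_ud.
Qed.

Lemma errd_cvg (s_ : nat -> R) : (forall n, 0 < s_ n) ->
  (forall x, exists n, forall k, (n <= k)%N -> ~ big (s_ k) x) ->
  \int[mu]_x errd (s_ n) x @[n --> \oo] --> (0 : R).
Proof.
move=> s0 hs.
have E n : \int[mu]_x errd (s_ n) x = \sum_j (\int[mu]_x (\1_(big (s_ n)) x * `|lap ud2 x| `^ q)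
    + s_ n `^ (- q) * \int[mu]_x (\1_(sh (s_ n)) x * `|ud j x| `^ q)).
  have i1 := itg_big_lap (s_ n).
  have i2 j := itg_shell_ud j (s0 n).
  have i3 j := itgZ (s_ n `^ (- q)) (i2 j).
  rewrite /errd Rint_sum; last by move=> j; exact: itgD.
  by apply: eq_bigr => j _; rewrite (RintD i1 (i3 j)) (RintZ _ (i2 j)).
rewrite (_ : (fun n => _) = fun n => \sum_j (\int[mu]_x (\1_(big (s_ n)) x * `|lap ud2 x| `^ q)
    + s_ n `^ (- q) * \int[mu]_x (\1_(sh (s_ n)) x * `|ud j x| `^ q))); last first.
  by apply/funext => n; exact: E.
apply: cvg_bigsum0 => j.
have c1 := indic_vanish hs iL.
have iqs' : itg mu (fun x => `|u x| `^ critical2 N q) by rewrite -qsE.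
have c2 := shell_cvg q1 (hu1 j) (hu2 j j) bu (bud j) (iH j j) qN s0 iqs' hs.
have := cvgD c1 c2; rewrite addr0; exact.
Qed.

(** The remainder is w times |x|^2 [co] times x.grad u / |x|^2. The middle factor is at most (2 N +
    4) C + 4 C by scale invariance, the last at most |grad u| / s. *)
Lemma remainder_shell n x (s : R) : 0 < s -> sh s x ->
  `|remainder n x| <= (2 * N%:R + 8) * C * errd s x.
Proof.
move=> s0 shx; have /andP[x1 x2] := shx.
have s2 : 0 < s ^+ 2 by rewrite exprn_gt0.
have t0 : 0 < sqn x by exact: lt_le_trans x1.
have [h1 h2 _] := hth n (sqn x).
have bx : big s x by apply/andP; split => //; lra.
set co := (2 * N%:R + 4) * th1 n (sqn x) + 4 * (sqn x * th2 n (sqn x)).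
have hco : `|sqn x * co| <= (2 * N%:R + 8) * C.
  have -> : sqn x * co = (2 * N%:R + 4) * (sqn x * th1 n (sqn x)) + 4 * (sqn x ^+ 2 * th2 n (sqn x)).
    by rewrite /co; move: (th1 _ _) (th2 _ _) (N%:R : R) => A B M; ring.
  move: h1 h2; move: (sqn x * th1 n (sqn x)) (sqn x ^+ 2 * th2 n (sqn x)) => A B h1 h2.
  apply: (le_trans (ler_normD _ _)).
  have M4 : 0 <= 2 * N%:R + 4 :> R by rewrite addr_ge0 ?mulr_ge0.
  rewrite !normrM (ger0_norm M4) (ger0_norm (_ : 0 <= 4))//.
  have := ler_wpM2l M4 h1; lra.
have hS : `|rad ud x| / sqn x <= grn ud x / s.
  rewrite -(ler_pXn2r (_ : 0 < 2)%N) ?nnegrE ?divr_ge0 ?vnorm_ge0 ?(ltW t0) ?(ltW s0)//.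
  rewrite !expr_div_n real_normK ?num_real// ler_pdivrMr ?exprn_gt0//.
  apply: (le_trans (rad_le _ _)).
  have -> : grn ud x ^+ 2 / s ^+ 2 * sqn x ^+ 2 = grn ud x ^+ 2 * sqn x * (sqn x / s ^+ 2).
    by rewrite expr2; move: (grn ud x) ((s ^+ 2)^-1) (sqn x) => a b c; ring.
  have g0 : 0 <= grn ud x by exact: vnorm_ge0.
  rewrite [leLHS]mulrC ler_peMr ?mulr_ge0 ?sqr_ge0 ?(ltW t0)//.
  by rewrite ler_pdivlMr// mul1r.
have -> : remainder n x = wfun ud2 q x * (sqn x * co) * (rad ud x / sqn x).
  have alg (w c S t : R) : t != 0 -> w * c * S = w * (t * c) * (S / t) by move=> ?; field.
  by apply: alg; rewrite gt_eqF.
have E : errd s x = \sum_j (`|lap ud2 x| `^ q + s `^ (- q) * `|ud j x| `^ q).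
  by apply: eq_bigr => j _; rewrite !indic01 !mem_set// !mul1r.
have hw : `|wfun ud2 q x| * (grn ud x / s) <= errd s x.
  apply: (@le_trans _ _ (\sum_j `|wfun ud2 q x| * (`|ud j x| / s))).
    rewrite -mulr_sumr -mulr_suml ler_wpM2l// ler_wpM2r ?invr_ge0 ?(ltW s0)//.
    exact: vnorm_le_sum.
  rewrite E; apply: ler_sum => j _; rewrite normr_wfun.
  have -> : s `^ (- q) * `|ud j x| `^ q = (`|ud j x| / s) `^ q.
    rewrite powRM ?invr_ge0 ?(ltW s0)// mulrC; congr (_ * _).
    by rewrite -(powR_inv1 (ltW s0)) -powRrM mulN1r.
  by apply: young_le; rewrite // divr_ge0// ltW.
have -> : `|wfun ud2 q x * (sqn x * co) * (rad ud x / sqn x)| =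
    `|wfun ud2 q x| * `|sqn x * co| * (`|rad ud x| / sqn x).
  rewrite (normrM (_ * _)) (normrM (wfun _ _ _)) (normrM (rad _ _)).
  by rewrite (gtr0_norm (_ : 0 < (sqn x)^-1)) ?invr_gt0.
have r0 : 0 <= `|rad ud x| / sqn x by rewrite divr_ge0// ltW.
have D0 : 0 <= (2 * N%:R + 8) * C by rewrite mulr_ge0// addr_ge0// mulr_ge0.
apply: (@le_trans _ _ ((2 * N%:R + 8) * C * (`|wfun ud2 q x| * (grn ud x / s)))).
  rewrite (mulrC `|wfun ud2 q x|) -(mulrA `|sqn x * co|).
  by apply: ler_pM; [by []|by rewrite mulr_ge0|by []|by rewrite ler_wpM2l].
by rewrite ler_wpM2l.
Qed.

Lemma remainder_bound n x : `|remainder n x| <= (2 * N%:R + 8) * C * (errd (rout n) x + errd (rin n) x).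
Proof.
have D0 : 0 <= (2 * N%:R + 8) * C by rewrite mulr_ge0// addr_ge0// mulr_ge0.
have [s1|s1] := pselect (sh (rout n) x).
  apply: (le_trans (remainder_shell n (rout_gt0 n) s1)).
  by rewrite ler_wpM2l// lerDl errd_ge0.
have [s2|s2] := pselect (sh (rin n) x).
  apply: (le_trans (remainder_shell n (rin_gt0 n) s2)).
  by rewrite ler_wpM2l// lerDr errd_ge0.
have [_ _ h] := hth n (sqn x).
have [||e1 e2] := h; first by apply/negP => k; apply: s1.
  by apply/negP => k; apply: s2; rewrite /sh /shell /= /rin exprVn.
rewrite /remainder e1 e2 !mulr0 addr0 mulr0 mul0r normr0.
by rewrite mulr_ge0// addr_ge0 ?errd_ge0.
Qed.

Lemma measurable_remainder n : measurable_fun setT (remainder n).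
Proof.
have m1 : measurable_fun setT (fun x : V => th1 n (sqn x)) by exact: mrd.
have m2 : measurable_fun setT (fun x : V => th2 n (sqn x)) by exact: mrd.
have c2 (k : R) (F : V -> R) : measurable_fun setT F -> measurable_fun setT (fun x => k * F x).
  by move=> mF; exact: measurable_funM.
apply: measurable_funM => //; apply: measurable_funM => //.
apply: measurable_funD; first exact: c2.
by apply: c2; apply: measurable_funM => //; exact: measurable_sqn.
Qed.

Lemma remainder_cvg : \int[mu]_x remainder n x @[n --> \oo] --> (0 : R).
Proof.
pose D := (2 * N%:R + 8) * C.
have D0 : 0 <= D by rewrite mulr_ge0// addr_ge0// mulr_ge0.
have i1 n := itg_errd (rout_gt0 n); have i2 n := itg_errd (rin_gt0 n).
have b n : `|\int[mu]_x remainder n x| <= D * (\int[mu]_x errd (rout n) x + \int[mu]_x errd (rin n) x).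
  rewrite -(RintD (i1 n) (i2 n)) -(RintZ _ (itgD (i1 n) (i2 n))).
  apply: Rint_norm_le; [exact: measurable_remainder|by apply: itgZ; exact: itgD|].
  exact: remainder_bound.
have c : D * (\int[mu]_x errd (rout n) x + \int[mu]_x errd (rin n) x) @[n --> \oo] --> (0 : R).
  have := cvgM (cvg_cst D) (cvgD (errd_cvg rout_gt0 big_rout) (errd_cvg rin_gt0 big_rin)).
  by rewrite addr0 mulr0; exact.
apply/cvgr0Pnorm_le => e e0; have /cvgr0Pnorm_le/(_ e e0) := c.
apply: filterS => n; apply: le_trans; apply: (le_trans (b n)); exact: ler_norm.
Qed.

(** [total n] has integral 0, so [bulk n] and [remainder n] have equal integrals; one sequence tends
    to the integral of [limit_integrand], the other to 0. *)
Lemma Rint_limit_integrand : \int[mu]_x limit_integrand x = 0.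
Proof.
have E n : \int[mu]_x bulk n x = \int[mu]_x remainder n x.
  have [iI I0] := total_int n.
  have iE : itg mu (remainder n).
    apply: (itg_le (measurable_remainder n) (remainder_bound n)).
    by apply: itgZ; apply: itgD; apply: itg_errd; [exact: rout_gt0|exact: rin_gt0].
  rewrite -[RHS]add0r -I0 -(RintD iI iE); apply: eq_Rint => x.
  by rewrite totalE subrK.
have c := bulk_cvg; have c0 := remainder_cvg.
have EE : (fun n => \int[mu]_x bulk n x) = (fun n => \int[mu]_x remainder n x) by apply/funext.
rewrite EE in c; exact: (cvg_unique _ c c0).
Qed.

End pohozaev.

(** * The Pohozaev identity *)

Lemma critical1_gt1 (R : realType) (N : nat) (p : R) : 1 < p < N%:R -> 1 < critical1 N p.
Proof.
move=> /andP[p1 pN]; rewrite /critical1 ltr_pdivlMr ?subr_gt0// mul1r.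
have N0 : 0 < N%:R :> R by rewrite (lt_trans _ pN)// (lt_trans ltr01).
have : N%:R < N%:R * p by rewrite ltr_pMr.
lra.
Qed.

Lemma critical2_gt1 (R : realType) (N : nat) (q : R) : 1 < q -> 2 * q < N%:R ->
  1 < critical2 N q.
Proof.
move=> q1 qN; rewrite /critical2 ltr_pdivlMr ?subr_gt0// mul1r.
have N0 : 0 < N%:R :> R by rewrite (lt_trans _ qN)// mulr_gt0// (lt_trans ltr01).
have : N%:R < N%:R * q by rewrite ltr_pMr.
lra.
Qed.

Lemma coord_le_enorm (R : realType) (m n : nat) (A : 'M[R]_(m, n)) i j : `|A i j| <= enorm A.
Proof.
have S0 : 0 <= \sum_i \sum_j A i j ^+ 2.
  by apply: sumr_ge0 => k _; apply: sumr_ge0 => l _; exact: sqr_ge0.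
rewrite -(ler_pXn2r (_ : 0 < 2)%N) ?nnegrE ?sqrtr_ge0// sqr_sqrtr// real_normK ?num_real//.
rewrite (bigD1 i)//= (bigD1 j)//= -addrA lerDl addr_ge0//.
  by apply: sumr_ge0 => l _; exact: sqr_ge0.
by apply: sumr_ge0 => k _; apply: sumr_ge0 => l _; exact: sqr_ge0.
Qed.

Theorem proposition8p2 (R : realType) (N : nat)
    (p q sigma r lambda tau1 tau2 : R) (u : 'rV[R]_N -> R)
    (hp : 1 < p < N%:R) (hq : 1 < q < N%:R / 2)
    (hsigma : 0 <= sigma < N%:R) (hr : 1 < r)
    (htau1 : tau1 = 0 \/ tau1 = 1) (htau2 : tau2 = 0 \/ tau2 = 1)
    (huW : spaceW p q u) (huL : Lp_weighted r sigma u)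
    (husol : weak_solution p q (fun x t =>
       lambda * (spow r t / enorm x `^ sigma)
       + tau1 * spow (critical1 N p) t + tau2 * spow (critical2 N q) t) u)
    (hureg : exists m : R, [/\ N%:R < m,
       sobolev_loc 2 m [set~ 0] u &
       sobolev_loc 1 m [set~ 0] (fun x => spow q (wlaplacian u x))]) :
  (N%:R - 2 * q) / q * (\int[lebesgue_rV R N]_x `|wlaplacian u x| `^ q)
  + (N%:R - p) / p * (\int[lebesgue_rV R N]_x enorm (wgrad u x) `^ p)
  = lambda * ((N%:R - sigma) / r)
      * (\int[lebesgue_rV R N]_x (`|u x| `^ r / enorm x `^ sigma))
    + tau1 * (N%:R / critical1 N p)
      * (\int[lebesgue_rV R N]_x `|u x| `^ critical1 N p)
    + tau2 * (N%:R / critical2 N q)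
      * (\int[lebesgue_rV R N]_x `|u x| `^ critical2 N q).
Proof.
have /andP[p1 pN] := hp; have /andP[q1 qN2] := hq; have /andP[s0 sN] := hsigma.
have q0 : 0 <= q by rewrite ltW// (lt_trans ltr01).
have qN : 2 * q < N%:R by rewrite mulrC -ltr_pdivlMr.
have NR0 : 0 < N%:R :> R by rewrite (lt_trans _ pN)// (lt_trans ltr01).
have N0 : (0 < N)%N by rewrite ltr0n in NR0.
have ps1 := critical1_gt1 hp; have qs1 := critical2_gt1 q1 qN.
have [[Lps D1u Lgr] [Lqs D2u Lhe]] := huW.
pose ud j := wderiv [:: j] u; pose ud2 j i := wderiv [:: j; i] u.
have hu1 j : wd [:: j] u (ud j) by exact: wderiv_wd.
have hu2' j i : wd [:: j; i] u (ud2 j i) by exact: wderiv_wd.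
(* [ud2 j i] is chosen as a derivative of u, independently of the choice of [ud j]; it is also a
   derivative of [ud j]. *)
have hu2 j i : wd [:: i] (ud j) (ud2 j i) by exact: wd_iter (hu1 j) (hu2' j i).
have Lu : L1loc u by rewrite -(patch_setT (fun=> point) u); exact: Lp_L1loc (ltW ps1) Lps.
have LpT (a : R) F : 1 <= a -> Lp setT a F ->
    measurable_fun setT F /\ itg (lebesgue_rV R N) (fun x => `|F x| `^ a).
  by move=> a1 /(Lp_itg a1); rewrite patch_setT.
have [mu_ ips] := LpT _ _ (ltW ps1) Lps; have [_ iqs] := LpT _ _ (ltW qs1) Lqs.
have grE x : grn ud x = enorm (wgrad u x) by rewrite /grn -enorm_row.
have iG : itg (lebesgue_rV R N) (fun x => grn ud x `^ p).
  have [_] := LpT _ _ (ltW p1) Lgr; congr (itg _ _); apply/funext => x.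
  by rewrite grE ger0_norm// sqrtr_ge0.
have [mhe ihe] := LpT _ _ (ltW q1) Lhe.
have mud2 j i : measurable_fun setT (ud2 j i) by have [_ []] := hu2 j i.
have iH j i : itg (lebesgue_rV R N) (fun x => `|ud2 j i x| `^ q).
  apply: (itg_le _ _ ihe); first exact: measurable_powR_norm.
  move=> x; rewrite ger0_norm ?powR_ge0// ge0_ler_powR ?nnegrE//.
  rewrite [leRHS]ger0_norm ?sqrtr_ge0//.
  by have := coord_le_enorm (whess u x) j i; rewrite mxE.
have iL : itg (lebesgue_rV R N) (fun x => `|lap ud2 x| `^ q).
  have mlap : measurable_fun setT (lap ud2) by apply: measurable_sum => i; exact: mud2.
  apply: (itg_le _ _ (itgZ (N%:R `^ q) ihe)); first exact: measurable_powR_norm.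
  move=> x; rewrite ger0_norm ?powR_ge0// -powRM// ge0_ler_powR ?nnegrE ?mulr_ge0//.
  rewrite (ger0_norm (sqrtr_ge0 _)) /lap (le_trans (ler_norm_sum _ _ _))//.
  rewrite mulr_natl -[X in _ *+ X](card_ord N) -sumr_const; apply: ler_sum => i _.
  by have := coord_le_enorm (whess u x) i i; rewrite mxE.
have [_ ir0] := huL.
have iro : itg (lebesgue_rV R N) (fun x => `|u x| `^ r / enorm x `^ sigma).
  apply/itgP; split; last first.
    under eq_integral do rewrite ger0_norm ?mulr_ge0 ?invr_ge0 ?powR_ge0//.
    exact: ir0.
  under eq_fun do rewrite weightE.
  by apply: measurable_funM; [exact: measurable_powR_norm|exact: measurable_weight].
have ir : itg (lebesgue_rV R N) (fun x => `|u x| `^ r * weight sigma x).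
  by move: iro; congr (itg _ _); apply/funext => x; rewrite weightE.
have [m [Nm su sw]] := hureg.
have m1 : 1 < m by rewrite (le_lt_trans _ Nm)// ler1n.
have bu : lbd u by exact: lbd_sobolev1 m1 Nm (sobolev_locW _ su).
have bud j : lbd (ud j) by exact: lbd_sobolev2 m1 Nm su (hu1 j).
have bw : lbd (wfun ud2 q) by exact: lbd_sobolev1 m1 Nm sw.
have [th1 [th2 [C [C0 d1 d2 cth hth]]]] := theta_derivatives R.
have [_ _ hsol] := husol.
have weak v : tf v ->
  \int[lebesgue_rV R N]_x (wfun ud2 q x * \sum_i pderivs [:: i; i] v x) +
  \int[lebesgue_rV R N]_x (grn ud x `^ (p - 2) * \sum_i ud i x * pderiv i v x) =
  \int[lebesgue_rV R N]_x (source u sigma r (critical1 N p) (critical2 N q) lambda tau1 tau2 x * v x).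
  move=> /tf_test_function/hsol h; transitivity (\int[lebesgue_rV R N]_x
    ((lambda * (spow r (u x) / enorm x `^ sigma) + tau1 * spow (critical1 N p) (u x)
      + tau2 * spow (critical2 N q) (u x)) * v x)); last first.
    by apply: eq_Rint => x; rewrite /source weightE.
  rewrite -h; congr (_ + _); apply: eq_Rint => x; rewrite grE; congr (_ * _).
  by apply: eq_bigr => i _; rewrite mxE.
have := Rint_limit_integrand N0 p1 q1 qN s0 hr ps1 qs1 erefl hu1 hu2 (fun i => hu2' i i) Lu bu bud bw
  iL iG iH ir ips iqs weak C0 d1 d2 cth hth.
have j1 := itgZ (N%:R / q - 2) iL; have j2 := itgZ (N%:R / p - 1) iG.
have j3 := itgZ (lambda * ((N%:R - sigma) / r)) ir.
have j4 := itgZ (tau1 * (N%:R / critical1 N p)) ips.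
have j5 := itgZ (tau2 * (N%:R / critical2 N q)) iqs.
rewrite /limit_integrand (RintB (itgB (itgB (itgD j1 j2) j3) j4) j5) (RintB (itgB (itgD j1 j2) j3) j4).
rewrite (RintB (itgD j1 j2) j3) (RintD j1 j2) (RintZ _ iL) (RintZ _ iG) (RintZ _ ir).
rewrite (RintZ _ ips) (RintZ _ iqs) => E.
have -> : (N%:R - 2 * q) / q = N%:R / q - 2 by field; rewrite gt_eqF// (lt_trans ltr01).
have -> : (N%:R - p) / p = N%:R / p - 1 by field; rewrite gt_eqF// (lt_trans ltr01).
have -> : \int[lebesgue_rV R N]_x enorm (wgrad u x) `^ p = \int[lebesgue_rV R N]_x grn ud x `^ p.
  by apply: eq_Rint => x; rewrite grE.
have -> : \int[lebesgue_rV R N]_x (`|u x| `^ r / enorm x `^ sigma) =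
    \int[lebesgue_rV R N]_x (`|u x| `^ r * weight sigma x).
  by apply: eq_Rint => x; rewrite weightE.
move: E; rewrite -/(wlaplacian u).
move: (\int[_]_x _) (\int[_]_x _) (\int[_]_x _) (\int[_]_x _) (\int[_]_x _) => I1 I2 I3 I4 I5.
by move=> E; apply/eqP; rewrite -subr_eq0 -[X in _ == X]E; apply/eqP; ring.
Qed.
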